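(* (I) If $\int_1^\infty x\,\nu(\mathrm{d}x)<\infty$, then the form $(\mathscr{E},\mathscr{F}C_b^\infty)$ is closable in $L^2(\mu^S)$, and its closure $(\mathscr{E},\mathscr{D}(\mathscr{E}))$ is a conservative symmetric Dirichlet form on $L^2(\mu^S)$. (II) If $T<\infty$, $M=\infty$, $\sigma_0>0$ and $\kappa<1-1/\sigma_0$, then the form $(\mathscr{E}^{(\kappa)},\mathscr{F}C_b^\infty)$ is closable in $L^2(\mu^S)$, and its closure $(\mathscr{E}^{(\kappa)},\mathscr{D}(\mathscr{E}^{(\kappa)}))$ is a conservative symmetric Dirichlet form on $L^2(\mu^S)$.
   Context: Conventions: for $A\in(0,\infty]$, $[0,A]$ denotes the usual closed interval if $A<\infty$ and $[0,\infty)$ if $A=\infty$; $\int_u^v$ means $\int_{(u,v)}$; $0^0:=1$. Let $0<T\le\infty$ and let $S=(S_t)_{t\in[0,T]}$ be a non-trivial subordinator, i.e. an increasing L\'evy process with $S_0=0$ and $\mathbb{E}\,e^{-uS_t}=e^{-t\phi(u)}$, $u>0$, where $\phi(u)=bu+\int_0^\infty(1-e^{-ux})\,\nu(\mathrm{d}x)$ with $b\ge0$ and $\nu$ a measure on $(0,\infty)$ with $\int_0^\infty(x\wedge1)\,\nu(\mathrm{d}x)<\infty$. If $T=\infty$, put $S_\infty:=\lim_{t\uparrow\infty}S_t$ ($=\infty$ a.s.). Let $M=\operatorname{ess\,sup}S_T\in(0,\infty]$ and $\sigma_0:=\sup\{\alpha\ge0:\lim_{u\downarrow0}\phi(u)/u^\alpha=0\}\in[0,1]$.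 Let $(W_t)_{t\in[0,M]}$ be a standard $d$-dimensional Brownian motion started at $0$, independent of $S$. $\mathbb{W}_M$ is the space of continuous $w:[0,M]\to\mathbb{R}^d$ with $w(0)=0$. For $\kappa\in\mathbb{R}$, $\mathbb{H}_M^{(\kappa)}$ is the Hilbert space of absolutely continuous $h\in\mathbb{W}_M$ (if $M=\infty$: absolutely continuous on every compact subinterval) with $\int_0^M|h'(t)|^2[\mathbb{P}(S_T\ge t)]^\kappa\,\mathrm{d}t<\infty$, with inner product $\langle g,h\rangle_{\mathbb{H}_M^{(\kappa)}}=\int_0^M\langle g'(t),h'(t)\rangle_{\mathbb{R}^d}[\mathbb{P}(S_T\ge t)]^\kappa\,\mathrm{d}t$; $\mathbb{H}_M:=\mathbb{H}_M^{(0)}$. Let $\mu$ be the law of $W$ on $\mathbb{W}_M$ and $\lambda$ the law of $S$ on $\mathbb{S}_T=\{\ell:[0,T]\to[0,\infty):\ell_0=0,\ \ell\text{ increasing, c\`adl\`ag}\}$. $\mu^S$ is the law of $(W_{S_t})_{t\in[0,T]}$ on $\Omega=\{w\circ\ell:w\in\mathbb{W}_M,\ \ell\in\mathbb{S}_T\}$, where $W_{S_t}(w,\ell)=w(\ell_t)$ on $(\mathbb{W}_M\times\mathbb{S}_T,\mu\times\lambda)$. Derivatives are regarded as functions of $(w,\ell)$, and their integrals $\int_\Omega\cdots\mathrm{d}\mu^S$ are computed under $\mu\times\lambda$. $\mathscr{F}C_b^\infty$ is the set of functions $F(w\circ\ell)=f(w(\ell_{t_1}),\dots,w(\ell_{t_n}))$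 on $\Omega$ with $n\in\mathbb{N}$, $f\in C_b^\infty(\mathbb{R}^{d\cdot n})$ and $t_1<\dots<t_n$ in $[0,T]$. For $h\in\mathbb{W}_M$, $D_hF(w\circ\ell)=\sum_{i=1}^n\langle\nabla_if(w(\ell_{t_1}),\dots,w(\ell_{t_n})),h(\ell_{t_i})\rangle_{\mathbb{R}^d}$, where $\nabla_i f$ is the gradient in the $i$th variable. For all $w$ and $\lambda$-a.a. $\ell$, $D^{(\kappa)}F(w\circ\ell)\in\mathbb{H}_M^{(\kappa)}$ is the unique element with $\langle D^{(\kappa)}F(w\circ\ell),h\rangle_{\mathbb{H}_M^{(\kappa)}}=D_hF(w\circ\ell)$ for all $h\in\mathbb{H}_M^{(\kappa)}$; $DF:=D^{(0)}F$. The forms ($\mathscr{E}$ being finite if $\int_1^\infty x\,\nu(\mathrm{d}x)<\infty$, and $\mathscr{E}^{(\kappa)}$ being finite if $T<\infty$, $M=\infty$, $\sigma_0>0$ and $\kappa<1-1/\sigma_0$) are, for $F,G\in\mathscr{F}C_b^\infty$, $$\mathscr{E}(F,G)=\int_\Omega\langle DF,DG\rangle_{\mathbb{H}_M}\,\mathrm{d}\mu^S,\qquad \mathscr{E}^{(\kappa)}(F,G)=\int_\Omega\langle D^{(\kappa)}F,D^{(\kappa)}G\rangle_{\mathbb{H}_M^{(\kappa)}}\,\mathrm{d}\mu^S.$$ For $F\in\mathscr{F}C_b^\infty$ of the form $F(w\circ\ell)=f(w(\ell_{t_1}),\dots,w(\ell_{t_n}))$ with $n\in\mathbb{N}$, $f\in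 C_b^\infty(\mathbb{R}^{d\cdot n})$ and $t_1<\dots<t_n$ in $[0,T]$, these satisfy $\mathscr{E}(F,F)=\mathbb{E}\big[\sum_{i=1}^n(S_{t_i}-S_{t_{i-1}})|\sum_{j=i}^n\nabla_jf(W_{S_{t_1}},\dots,W_{S_{t_n}})|^2\big]$ with $t_0:=0$, and $\mathscr{E}^{(\kappa)}(F,F)=\mathbb{E}\big[\sum_{i,j=1}^n\langle\nabla_if(W_{S_{t_1}},\dots,W_{S_{t_n}}),\nabla_jf(W_{S_{t_1}},\dots,W_{S_{t_n}})\rangle_{\mathbb{R}^d}\int_0^{S_{t_i\wedge t_j}}[\mathbb{P}(S_T\ge s)]^{-\kappa}\,\mathrm{d}s\big]$. *)

(* Defs.v *)
From HB Require Import structures.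
From mathcomp Require Import all_boot all_order all_algebra.
From mathcomp Require Import all_classical all_reals all_analysis.
From mathcomp Require Import measurable_realfun ess_sup_inf.

Set Implicit Arguments.
Unset Strict Implicit.
Unset Printing Implicit Defensive.
Import Order.TTheory GRing.Theory Num.Theory.
Import numFieldNormedType.Exports.
Local Open Scope classical_set_scope.
Local Open Scope ring_scope.

Section time_intervals.
Context {R : realType}.
Implicit Types (A : \bar R).

(* [0, A], read as [0, oo) when A = +oo *)
Definition time_dom A : set R := [set t | 0 <= t /\ (t%:E <= A)%E].

Definition open_time_dom A : set R := [set t | 0 < t /\ (t%:E < A)%E].

Definition dotr (d : nat) (u v : 'rV[R]_d) : R := \sum_(i < d) u ord0 i * v ord0 i.

Definition coord_system (X I : Type) (e : I -> X -> R) : set (set X) :=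
  [set C | exists i (B : set R), measurable B /\ C = e i @^-1` B].

End time_intervals.

(* A path on [0, A] is encoded by its extension by 0 to R, so that equality of
   encodings is equality of paths. With this convention (w \o l) is the
   extension by 0 of the composed path, because w 0 = 0; it also sends to 0 the
   times t with l t > M, which, M being ess sup S_T, only concerns a null set of l. *)
Section path_spaces.
Context {R : realType}.

Definition is_wpath (d : nat) (M : \bar R) (w : R -> 'rV[R]_d) : Prop :=
  [/\ w 0 = 0, {within time_dom M, continuous w}
    & forall t, ~ time_dom M t -> w t = 0].

Record wpath (d : nat) (M : \bar R) := WPath {
  wpath_fun :> R -> 'rV[R]_d;
  wpathP : is_wpath M wpath_fun }.

Definition is_spath (T : \bar R) (l : R -> R) : Prop :=
  [/\ [/\ l 0 = 0, forall t, time_dom T t -> 0 <= l t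
        & forall s t, time_dom T s -> time_dom T t -> s <= t -> l s <= l t],
      forall t, time_dom T t -> (t%:E < T)%E -> l x @[x --> t^'+] --> l t,
      forall t, time_dom T t -> 0 < t -> cvg (l x @[x --> t^'-])
    & forall t, ~ time_dom T t -> l t = 0].

Record spath (T : \bar R) := SPath {
  spath_fun :> R -> R;
  spathP : is_spath T spath_fun }.

Record opath (d : nat) (M T : \bar R) := OPath {
  opath_fun :> R -> 'rV[R]_d;
  opathP : exists (w : wpath d M) (l : spath T), opath_fun = w \o l }.

Definition comp_path (d : nat) (M T : \bar R) (wl : wpath d M * spath T) :
    opath d M T :=
  OPath (ex_intro _ wl.1 (ex_intro _ wl.2 erefl)).

End path_spaces.

Section path_instances.
Context {R : realType}.

Lemma is_wpath0 (d : nat) (M : \bar R) : is_wpath M (fun=> 0 : 'rV[R]_d).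
Proof. by split => // t; exact: cvg_cst. Qed.

Lemma is_spath0 (T : \bar R) : is_spath T (fun=> 0 : R).
Proof.
split => // [t _ _|t _ _]; first exact: cvg_cst.
exact: is_cvg_cst.
Qed.

Definition wpath0 (d : nat) (M : \bar R) : wpath d M := WPath (is_wpath0 d M).
Definition spath0 (T : \bar R) : spath T := SPath (is_spath0 T).

HB.instance Definition _ (d : nat) (M : \bar R) := gen_eqMixin (wpath d M).
HB.instance Definition _ (d : nat) (M : \bar R) := gen_choiceMixin (wpath d M).
HB.instance Definition _ (d : nat) (M : \bar R) :=
  isPointed.Build (wpath d M) (wpath0 d M).

HB.instance Definition _ (T : \bar R) := gen_eqMixin (spath T).
HB.instance Definition _ (T : \bar R) := gen_choiceMixin (spath T).
HB.instance Definition _ (T : \bar R) := isPointed.Build (spath T) (spath0 T).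

HB.instance Definition _ (d : nat) (M T : \bar R) := gen_eqMixin (opath d M T).
HB.instance Definition _ (d : nat) (M T : \bar R) :=
  gen_choiceMixin (opath d M T).
HB.instance Definition _ (d : nat) (M T : \bar R) :=
  isPointed.Build (opath d M T) (comp_path (wpath0 d M, spath0 T)).

Definition wcoord (d : nat) (M : \bar R) :=
  coord_system (fun (ti : R * 'I_d) (w : wpath d M) => w ti.1 ord0 ti.2).
Definition scoord (T : \bar R) := coord_system (fun (t : R) (l : spath T) => l t).
Definition ocoord (d : nat) (M T : \bar R) :=
  coord_system (fun (ti : R * 'I_d) (x : opath d M T) => x ti.1 ord0 ti.2).

HB.instance Definition _ (d : nat) (M : \bar R) :=
  @isMeasurable.Build (sigma_display (@wcoord d M)) (wpath d M) <<s @wcoord d M >>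
    (@sigma_algebra0 _ setT _) (@sigma_algebraC _ _) (@sigma_algebra_bigcup _ setT _).
HB.instance Definition _ (T : \bar R) :=
  @isMeasurable.Build (sigma_display (@scoord T)) (spath T) <<s @scoord T >>
    (@sigma_algebra0 _ setT _) (@sigma_algebraC _ _) (@sigma_algebra_bigcup _ setT _).
HB.instance Definition _ (d : nat) (M T : \bar R) :=
  @isMeasurable.Build (sigma_display (@ocoord d M T)) (opath d M T)
    <<s @ocoord d M T >>
    (@sigma_algebra0 _ setT _) (@sigma_algebraC _ _) (@sigma_algebra_bigcup _ setT _).

End path_instances.

Section comp_path_measurable.
Context {R : realType} (d : nat) (M T : \bar R).

Lemma measurable_wcoord (t : R) (i : 'I_d) :
  measurable_fun setT (fun w : wpath d M => w t ord0 i).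
Proof.
move=> _ B mB; rewrite setTI; apply: sub_sigma_algebra.
by exists (t, i), B.
Qed.

Lemma measurable_scoord (t : R) : measurable_fun setT (fun l : spath T => l t).
Proof.
move=> _ B mB; rewrite setTI; apply: sub_sigma_algebra.
by exists t, B.
Qed.

Lemma spath_ge0 (l : spath T) (t : R) : 0 <= l t.
Proof.
have [[_ l0 _] _ _ lout] := spathP l.
by have [/l0//|/lout ->] := pselect (time_dom T t).
Qed.

Let disc (n : nat) (s : R) : R := (Num.truncn (s * n.+1%:R))%:R / n.+1%:R.

Let disc_le n s : 0 <= s -> 0 <= disc n s <= s.
Proof.
move=> s0; rewrite /disc divr_ge0//= ler_pdivrMr// truncn_le//.
by rewrite mulr_ge0.
Qed.

Let disc_cvg s : 0 <= s -> disc n s @[n --> \oo] --> s.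
Proof.
move=> s0.
apply: (@squeeze_cvgr _ _ _ _ (fun n => s - n.+1%:R^-1) (fun=> s)).
- apply: nearW => n; have /andP[_ ->] := disc_le n s0; rewrite andbT.
  rewrite /disc lerBlDr -[X in _ + X]div1r -mulrDl ler_pdivlMr//.
  by rewrite natr1 ltW// truncnS_gt.
- rewrite -[X in _ --> X]subr0; apply: cvgB; first exact: cvg_cst.
  exact: cvg_harmonic.
- exact: cvg_cst.
Qed.

Let wdisc_cvg (w : wpath d M) (i : 'I_d) (s : R) : 0 <= s ->
  w (disc n s) ord0 i @[n --> \oo] --> w s ord0 i.
Proof.
move=> s0; have [_ cw wout] := wpathP w.
suff h : w (disc n s) @[n --> \oo] --> w s.
  apply: (cvg_comp (fun n => w (disc n s)) (fun v : 'rV[R]_d => v ord0 i) h).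
  exact: coord_continuous.
have [sM|sM] := pselect (time_dom M s).
- have dM n : time_dom M (disc n s).
    have /andP[d0 ds] := disc_le n s0; split => //.
    by case: sM => _; apply: le_trans; rewrite lee_fin.
  have /subspace_continuousP/(_ _ sM) cws := cw.
  apply: (cvg_comp (fun n => disc n s) w _ cws) => A /= wA.
  have : \forall n \near \oo, time_dom M (disc n s) -> A (disc n s).
    exact: disc_cvg s0 _ wA.
  by apply: filterS => n; exact.
- have sM' : (M < s%:E)%E.
    by rewrite ltNge; apply/negP => sM'; apply: sM; split.
  rewrite (wout _ sM); apply: cvg_near_cst.
  have [M' [M'M M's]] : exists r, (M <= r%:E)%E /\ r < s.
    by case: M sM' => [r| |]//= rs; [exists r|exists (s - 1)];
      rewrite ?leNye ?gtrBl.
  have h : \forall n \near \oo, M' < disc n s := cvgr_gt s (disc_cvg s0) _ M's.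
  near=> n; rewrite wout// => -[_]; apply/negP; rewrite -ltNge.
  by rewrite (le_lt_trans M'M)// lte_fin; near: n; exact: h.
Unshelve. all: by end_near. Qed.

Lemma measurable_comp_path_coord (t : R) (i : 'I_d) :
  measurable_fun setT
    (fun wl : wpath d M * spath T => wl.1 (wl.2 t) ord0 i).
Proof.
apply: (@measurable_fun_cvg _ _ _ setT
  (fun n (wl : wpath d M * spath T) => wl.1 (disc n (wl.2 t)) ord0 i)
  (fun wl : wpath d M * spath T => wl.1 (wl.2 t) ord0 i)).
  move=> n _ B mB; rewrite setTI.
  have -> : (fun wl : wpath d M * spath T =>
      wl.1 (disc n (wl.2 t)) ord0 i) @^-1` B =
    \bigcup_k (((fun w : wpath d M => w (k%:R / n.+1%:R) ord0 i) @^-1` B) `*`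
      ((fun l : spath T => l t) @^-1`
        [set s | k%:R <= s * n.+1%:R < k.+1%:R])).
    apply/seteqP; split => [[w l]/= Bwl|[w l]/= [k _ /=[Bw kl]]].
      exists (Num.truncn (l t * n.+1%:R)) => //=; split => //.
      by apply: truncn_itv; rewrite mulr_ge0// spath_ge0.
    by rewrite /disc (truncn_def kl).
  apply: bigcupT_measurable => k; apply: measurableX.
  - by rewrite -[X in measurable X]setTI; exact: measurable_wcoord.
  - rewrite -[X in measurable X]setTI; apply: measurable_scoord => //.
    rewrite (_ : [set _ | _] = ( *%R^~ n.+1%:R) @^-1` `[k%:R, k.+1%:R[%classic).
      rewrite -[X in measurable X]setTI.
      by apply: (mulrr_measurable n.+1%:R) => //.
    by apply/seteqP; split => s /=; rewrite in_itv.
by move=> [w l] _ /=; apply: wdisc_cvg; exact: spath_ge0.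
Qed.

Lemma measurable_comp_path :
  measurable_fun setT (@comp_path R d M T).
Proof.
apply: (@measurability _ _ _ _ _ _ (@ocoord R d M T)) => //.
move=> _ [_ [[t i] [B [mB ->]]] <-] /=.
exact: measurable_comp_path_coord.
Qed.

HB.instance Definition _ :=
  isMeasurableFun.Build _ _ _ _ (@comp_path R d M T) measurable_comp_path.

End comp_path_measurable.

Section processes.
Context {R : realType} (dO : measure_display) (Om : measurableType dO).
Variable P : probability Om R.

Definition mutually_independent (I : finType) (X : I -> Om -> R) : Prop :=
  forall B : I -> set R, (forall i, measurable (B i)) ->
    P [set om | forall i, B i (X i om)] =
    (\prod_(i : I) P [set om | B i (X i om)])%E.

Definition partition_of (A : \bar R) (n : nat) (t : nat -> R) : Prop :=
  (forall k, (k <= n)%N -> time_dom A (t k)) /\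
  (forall k, (k < n)%N -> t k < t k.+1).

(* nu is a measure on R of which only the trace on (0, oo) is used *)
Definition laplace_exponent (b : R) (nu : {measure set R -> \bar R}) (u : R) : R :=
  b * u + \int[nu]_(x in `]0, +oo[) (1 - expR (- (u * x))).

Definition lower_index (phi : R -> R) : R :=
  sup [set a | 0 <= a /\ phi u / u `^ a @[u --> 0^'+] --> (0 : R)].

Record subordinator (T : \bar R) (b : R) (nu : {measure set R -> \bar R})
    (S : Om -> spath T) : Prop := Subordinator {
  sub_indep_incr : forall n t, partition_of T n t ->
    mutually_independent (fun (k : 'I_n) om => S om (t k.+1) - S om (t k));
  sub_stat_incr : forall s t, time_dom T s -> time_dom T t -> s <= t ->
    forall B : set R, measurable B ->
      P [set om | B (S om t - S om s)] = P [set om | B (S om (t - s))];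
  sub_laplace : forall t u, time_dom T t -> 0 < u ->
    ('E_P[fun om => expR (- (u * S om t))])%E =
    (expR (- (t * laplace_exponent b nu u)))%:E }.

Definition nontrivial (T : \bar R) (S : Om -> spath T) : Prop :=
  ~ forall t, time_dom T t -> {ae P, forall om, S om t = 0}.

Record brownian_motion (d : nat) (M : \bar R) (W : Om -> wpath d M) : Prop :=
  BrownianMotion {
  bm_indep_incr : forall n t, partition_of M n t ->
    mutually_independent (fun (ki : 'I_n * 'I_d) om =>
      W om (t ki.1.+1) ord0 ki.2 - W om (t ki.1) ord0 ki.2);
  bm_gauss_incr : forall s t (i : 'I_d), time_dom M s -> time_dom M t -> s < t ->
    forall B : set R, measurable B ->
      P [set om | B (W om t ord0 i - W om s ord0 i)] =
      normal_prob 0 (Num.sqrt (t - s)) B }.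

Definition independent_elements (d1 d2 : measure_display)
    (X1 : measurableType d1) (X2 : measurableType d2)
    (f : Om -> X1) (g : Om -> X2) : Prop :=
  forall A B, measurable A -> measurable B ->
    P (f @^-1` A `&` g @^-1` B) = (P (f @^-1` A) * P (g @^-1` B))%E.

Definition terminal (T : \bar R) (S : Om -> spath T) (om : Om) : \bar R :=
  match T with
  | r%:E => (S om r)%:E
  | _ => lim ((S om t)%:E @[t --> +oo%R])
  end.

Definition survival (T : \bar R) (S : Om -> spath T) (t : R) : R :=
  fine (P [set om | (t%:E <= terminal S om)%E]).

Definition mu_S (d : nat) (M T : \bar R) (W : {RV P >-> wpath d M})
    (S : {RV P >-> spath T}) : probability (opath d M T) R :=
  distribution (distribution P W \x distribution P S)%E (@comp_path R d M T).

End processes.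

(* The measure m on pairs (w, l) stands for mu x lambda and p for the function
   t |-> P(S_T >= t). *)
Section gradient_forms.
Context {R : realType} (d : nat) (M T : \bar R).
Variable p : R -> R.
Implicit Types (h g : wpath d M) (kappa : R).

Definition abs_continuous (h : R -> 'rV[R]_d) (a : R) : Prop :=
  forall e : R, 0 < e -> exists2 delta : R, 0 < delta &
    forall (n : nat) (u v : 'I_n -> R),
      (forall i, [/\ 0 <= u i, u i <= v i & v i <= a]) ->
      trivIset setT (fun i => `]u i, v i[%classic) ->
      \sum_(i < n) (v i - u i) < delta ->
      \sum_(i < n) `|h (v i) - h (u i)| < e.

Definition H_space kappa : set (wpath d M) := [set h |
  (forall a, time_dom M a -> abs_continuous h a) /\
  (\int[lebesgue_measure]_(t in open_time_dom M)
     (dotr (derive1 h t) (derive1 h t) * p t `^ kappa)%:E < +oo)%E].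

Definition H_inner kappa g h : R :=
  \int[lebesgue_measure]_(t in open_time_dom M)
    (dotr (derive1 g t) (derive1 h t) * p t `^ kappa).

Definition iter_partial (n : nat) (f : 'M[R]_(n, d) -> R)
    (s : seq ('I_n * 'I_d)) : 'M[R]_(n, d) -> R :=
  foldr (fun ik (g : 'M[R]_(n, d) -> R) x => 'D_(delta_mx ik.1 ik.2) g x) f s.

Definition smooth_bounded (n : nat) (f : 'M[R]_(n, d) -> R) : Prop :=
  forall s : seq ('I_n * 'I_d),
    [/\ continuous (iter_partial f s),
        forall x ik, derivable (iter_partial f s) x (delta_mx ik.1 ik.2)
      & exists C : R, forall x, `|iter_partial f s x| <= C].

Record cylinder := Cylinder {
  cyl_n : nat;
  cyl_t : 'I_cyl_n -> R;
  cyl_f : 'M[R]_(cyl_n, d) -> R }.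

HB.instance Definition _ := gen_eqMixin cylinder.
HB.instance Definition _ := gen_choiceMixin cylinder.

Definition is_cylinder (c : cylinder) : Prop :=
  [/\ (0 < cyl_n c)%N, forall i, time_dom T (@cyl_t c i),
      forall i j : 'I_(cyl_n c), (i < j)%N -> cyl_t i < cyl_t j
    & smooth_bounded (@cyl_f c)].

Definition cyl_points (c : cylinder) (x : R -> 'rV[R]_d) : 'M[R]_(cyl_n c, d) :=
  \matrix_(i < cyl_n c) x (cyl_t i).

Definition cyl_eval (c : cylinder) (x : opath d M T) : R :=
  cyl_f (cyl_points c x).

Definition FCb : set (opath d M T -> R) :=
  [set F | exists2 c, is_cylinder c & F = cyl_eval c].

Definition cyl_grad (c : cylinder) (i : 'I_(cyl_n c)) (x : R -> 'rV[R]_d) :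
    'rV[R]_d :=
  \row_(k < d) 'D_(delta_mx i k) (@cyl_f c) (cyl_points c x).

Definition cyl_repr (F : opath d M T -> R) : cylinder :=
  xget (@Cylinder 0 (fun=> 0) (fun=> 0)) [set c | is_cylinder c /\ F = cyl_eval c].

(* The value does not depend on the chosen representation of F, as it equals the
   derivative of e |-> F ((w + e h) \o l) at 0 *)
Definition dir_deriv (F : opath d M T -> R) h (wl : wpath d M * spath T) : R :=
  let c := cyl_repr F in
  \sum_(i < cyl_n c) dotr (cyl_grad i (wl.1 \o wl.2)) (h (wl.2 (cyl_t i))).

Definition gradient kappa (F : opath d M T -> R) (wl : wpath d M * spath T) :
    wpath d M :=
  xget point [set g | H_space kappa g /\
    forall h, H_space kappa h -> H_inner kappa g h = dir_deriv F h wl].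

Definition grad_form (m : {measure set (wpath d M * spath T) -> \bar R}) kappa
    (F G : opath d M T -> R) : R :=
  \int[m]_wl H_inner kappa (gradient kappa F wl) (gradient kappa G wl).

End gradient_forms.

Section dirichlet_forms.
Context {R : realType} (dX : measure_display) (X : measurableType dX).
Variable m : {measure set X -> \bar R}.
Implicit Types (u v w : X -> R) (a : nat -> X -> R).
Implicit Types (D : set (X -> R)) (E : (X -> R) -> (X -> R) -> R).

Local Notation L2 := (Lfun m 2%:E).

Definition L2_norm u : \bar R := 'N[m]_2%:E [EFin \o u].
Definition L2_inner u v : R := \int[m]_x (u x * v x).
Definition L2_cvg a u : Prop := L2_norm (a n \- u) @[n --> \oo] --> 0%E.
Definition L2_cauchy a : Prop := forall e : R, 0 < e -> exists N : nat,
  forall j k, (N <= j)%N -> (N <= k)%N -> (L2_norm (a j \- a k)%R < e%:E)%E.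
Definition form_cauchy E a : Prop := forall e : R, 0 < e -> exists N : nat,
  forall j k, (N <= j)%N -> (N <= k)%N -> E (a j \- a k) (a j \- a k) < e.

Definition closable D E : Prop := forall a, (forall n, D (a n)) ->
  L2_cvg a (cst 0) -> form_cauchy E a -> E (a n) (a n) @[n --> \oo] --> (0 : R).

Definition approximates D E u a : Prop :=
  [/\ forall n, D (a n), form_cauchy E a & L2_cvg a u].

Definition closure_dom D E : set (X -> R) :=
  [set u | u \in L2 /\ exists a, approximates D E u a].

Definition approx_seq D E u : nat -> X -> R :=
  xget (fun=> cst 0) [set a | approximates D E u a].

Definition closure_form D E u v : R :=
  lim (E (approx_seq D E u n) (approx_seq D E v n) @[n --> \oo]).

(* Elements of L^2 are handled through representatives, hence the field df_ae *)
Record dirichlet_form D E : Prop := DirichletForm {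
  df_L2 : forall u, D u -> u \in L2;
  df_ae : forall u v w, D u -> v \in L2 -> u = v %[ae m] -> D w ->
    D v /\ E u w = E v w;
  df_dense : forall u (e : R), u \in L2 -> 0 < e ->
    exists2 v, D v & (L2_norm (u \- v)%R < e%:E)%E;
  df_linear_dom : forall (c : R) u v, D u -> D v -> D (fun x => c * u x + v x);
  df_linear : forall (c : R) u v w, D u -> D v -> D w ->
    E (fun x => c * u x + v x) w = c * E u w + E v w;
  df_sym : forall u v, D u -> D v -> E u v = E v u;
  df_ge0 : forall u, D u -> 0 <= E u u;
  df_closed : forall a, (forall n, D (a n)) -> L2_cauchy a -> form_cauchy E a ->
    exists u, [/\ D u, L2_cvg a u
                & E (a n \- u) (a n \- u) @[n --> \oo] --> (0 : R)];
  df_markov : forall u, D u ->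
    D (fun x => Num.min (Num.max (u x) 0) 1) /\
    E (fun x => Num.min (Num.max (u x) 0) 1)
      (fun x => Num.min (Num.max (u x) 0) 1) <= E u u }.

(* Q is the strongly continuous symmetric contraction semigroup on L^2 associated
   with the closed form (E, D) *)
Record semigroup_of D E (Q : R -> (X -> R) -> X -> R) : Prop := SemigroupOf {
  sg_L2 : forall t u, 0 <= t -> u \in L2 -> Q t u \in L2;
  sg_linear : forall t (c : R) u v, 0 <= t -> u \in L2 -> v \in L2 ->
    Q t (fun x => c * u x + v x) = (fun x => c * Q t u x + Q t v x) %[ae m];
  sg_sym : forall t u v, 0 <= t -> u \in L2 -> v \in L2 ->
    L2_inner (Q t u) v = L2_inner u (Q t v);
  sg_contr : forall t u, 0 <= t -> u \in L2 -> (L2_norm (Q t u) <= L2_norm u)%E;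
  sg_0 : forall u, u \in L2 -> Q 0 u = u %[ae m];
  sg_add : forall s t u, 0 <= s -> 0 <= t -> u \in L2 ->
    Q (s + t) u = Q s (Q t u) %[ae m];
  sg_cont : forall u, u \in L2 -> L2_norm (Q t u \- u) @[t --> 0^'+] --> 0%E;
  sg_dom : forall u, u \in L2 ->
    (D u <-> cvg (L2_inner (u \- Q t u) u / t @[t --> (0 : R)^'+]));
  sg_form : forall u v, D u -> D v ->
    L2_inner (u \- Q t u) v / t @[t --> (0 : R)^'+] --> E u v }.

(* On a probability space, "1 belongs to D and E(1, 1) = 0" and "Q_t 1 = 1 for the
   associated semigroup" are both in use as the definition, and are equivalent;
   a closed form has exactly one associated semigroup. *)
Definition conservative D E : Prop :=
  [/\ D (cst 1), E (cst 1) (cst 1) = 0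
    & forall Q, semigroup_of D E Q -> forall t, 0 <= t ->
        Q t (cst 1) = cst 1 %[ae m]].

End dirichlet_forms.

(* Main.v *)
(* Let q = 1 in (I), q = P(S_T >= .)^(-kappa) in (II), and A(x) = int_0^x q. For
   cylinder functions F, G with functions f, g and times s_i, t_j,
   <DF, DG>(w o l) = sum_ij <d_i f, d_j g> A(min (l s_i) (l t_j)). Hence the form is
   finite because E[A(S_t)] < oo: in (I) this follows from the Laplace transform of
   S_t, in (II) it reduces to the finiteness of int P(S_T >= s)^(1 - kappa) ds, and the
   definition of sigma_0 gives P(S_T >= s) <= C s^(-a) with a (1 - kappa) > 1.

   For closability fix l. Then (W_(l t_i))_i is a Gaussian vector, and Stein's identity
   for its increments moves the derivative of F in E_W[<DF, DG>] to the other factor,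
   which bounds this expectation by a multiple of the L^2-norm of F, uniformly over
   the l with l(t_n) bounded. Truncating in l, E(F_k, G) -> 0 for every cylinder
   function G as soon as F_k -> 0 in L^2 with bounded energies; for an E-Cauchy
   sequence this forces E(F_k, F_k) -> 0.

   The Markov property passes to the closure: smooth clamps do not increase the
   energy, and energy-bounded L^2-convergent sequences have E-Cauchy convex
   combinations. Conservativeness holds because 1 is a cylinder function with zero
   gradient. *)
Require Import Defs.
From HB Require Import structures.
From mathcomp Require Import all_boot all_order all_algebra.
From mathcomp Require Import all_classical all_reals all_analysis.
From mathcomp Require Import measurable_realfun ess_sup_inf.
From mathcomp Require Import ring lra.
Set Implicit Arguments.
Unset Strict Implicit.
Unset Printing Implicit Defensive.
Import Order.TTheory GRing.Theory Num.Theory.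
Import numFieldNormedType.Exports.
Local Open Scope classical_set_scope.
Local Open Scope ring_scope.

(** * Absolutely continuous functions *)

Section absolutely_continuous.
Context {R : realType}.
Implicit Types (f F h : R -> R) (a : R) (s : seq (R * R)).
Local Notation mu := (@lebesgue_measure R).

(** The gradient is specified only through its inner products, and these are integrals of [derive1].
    Everything therefore rests on recovering an absolutely continuous path from its derivative,
    whence the fundamental theorem of calculus below. The Riesz representative does not come from
    completeness: it is an explicit combination of the paths t |-> A(min t a), whose derivative is q
    before a and 0 after, so that q cancels the weight.

    Both cases are instances of one statement about a nonnegative measurable q, bounded on every
    half-line ]-oo, a], with q p^kappa = 1 and E[A(S_t)] < oo.

    These paths depend on l but not on w, which permits integration by parts in w. The resulting
    constant involves only a bound on the time a, not the number or position of the times of F; this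
    matters because F runs through a sequence with arbitrary times. Young's inequality with a free
    parameter takes the place of Cauchy-Schwarz.

    If M is finite, a time l(t_i) may fall beyond M, where paths are extended by 0; such a
    coordinate is frozen and drops out of all kernels. *)

Definition nonoverlapping s :=
  pairwise (fun I J : R * R => (I.2 <= J.1) || (J.2 <= I.1)) s.

Definition subitvs a s :=
  all (fun I : R * R => (0 <= I.1) && (I.1 <= I.2) && (I.2 <= a)) s.

(** Intervals come as a list, so that one of them can be replaced by a partition of it through
    concatenation. The closed bound [<= e] survives the supremum over such partitions. *)
Definition ac_on a f := forall e, 0 < e -> exists2 dl : R, 0 < dl &
  forall s, subitvs a s -> nonoverlapping s ->
    \sum_(I <- s) (I.2 - I.1) < dl -> \sum_(I <- s) `|f I.2 - f I.1| <= e.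

(** The outer interval is half-open because the Stieltjes measure of []u, v]] is exactly F v - F u.
    The last hypothesis says that [J] has no least element, which keeps [inf J] out of [J]. *)
Lemma interval_hull (J : set R) : J !=set0 -> has_lbound J -> has_ubound J ->
  is_interval J -> (forall x, J x -> exists2 y, J y & y < x) ->
  J `<=` `]inf J, sup J] /\ `]inf J, sup J[ `<=` J.
Proof.
move=> J0 lJ uJ iJ oJ; split => [x Jx|x] /=; rewrite in_itv/=.
  have [y Jy yx] := oJ _ Jx.
  by rewrite (le_lt_trans _ yx) ?ge_inf//= ub_le_sup.
move=> /andP[ix xs].
have [y Jy yx] := inf_lt J0 ix; have [z Jz xz] := sup_gt J0 xs.
by apply: (iJ y z) => //; rewrite !ltW.
Qed.

(** * Nondecreasing absolutely continuous functions as primitives *)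

Section monotone.
Variables (F : R -> R) (a : R).
Hypotheses (a_gt0 : 0 < a) (Fnd : {homo F : x y / x <= y}) (cF : continuous F)
  (acF : ac_on a F).

Let Frc : right_continuous F.
Proof. by move=> x; apply: cvg_at_right_filter; exact: cF. Qed.

HB.instance Definition _ := isCumulative.Build R _ _ F Fnd Frc.

Let muF : set R -> \bar R := lebesgue_stieltjes_measure F.

Let muF_oc (x y : R) : x <= y -> muF `]x, y] = (F y - F x)%:E.
Proof.
move=> xy; rewrite /muF /lebesgue_stieltjes_measure /=.
rewrite /measure_extension measurable_mu_extE//=; last by exists (x, y).
by rewrite wlength_itv_bnd.
Qed.

(** The null set is covered by an open set of Lebesgue measure below [dl]. Its components, cut by
    []0, a]], are nonoverlapping intervals of total length below [dl], so absolute continuity bounds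
    every finite sum of their Stieltjes measures by [e]. *)
Let nulln (N : set R) : measurable N -> mu N = 0%E -> muF (N `&` `]0, a]) = 0%E.
Proof.
move=> mN N0; apply/eqP; rewrite eq_le; apply/andP; split; last first.
  exact: measure_ge0.
apply/lee_addgt0Pr => e e0; rewrite add0e.
have [dl dl0 acdl] := acF e0.
have muNoo : (mu N < +oo)%E by rewrite N0.
have [U [oU NU UN]] := lebesgue_regularity_outer mN muNoo dl0.
have mU : measurable U by exact: open_measurable.
have Udl : (mu U < dl%:E)%E.
  rewrite -(setDUK NU); rewrite (le_lt_trans (measureU2 _ _ _))//.
  - exact: measurableD.
  - by move: N0; rewrite /= => ->; rewrite add0e.
pose I := open_disjoint_itv oU.
pose J k := I k `&` `]0, a]%classic.
have mI k : measurable (I k).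
  by apply: open_measurable; exact: open_disjoint_itv_open.
have mJ k : measurable (J k) by apply: measurableI.
have tI : trivIset setT I by exact: open_disjoint_itv_trivIset.
have tJ : trivIset setT J by exact: trivIset_setIr.
apply: (@le_trans _ _ (muF (\bigcup_k J k))).
  apply: le_measure; rewrite ?inE; [exact: measurableI|exact: bigcupT_measurable|].
  by rewrite -setI_bigcupl -/I; apply: setSI; rewrite -open_disjoint_itv_bigcup.
rewrite /muF (@measure_bigcup _ _ _ (lebesgue_stieltjes_measure F))//=; last by move=> k _; exact: mJ.
apply: lime_le; first exact: is_cvg_nneseries.
apply: nearW => n.
pose u k := inf (J k).
pose v k := sup (J k).
(* [inf] and [sup] of the empty set are 0, so a component that misses []0, a]] gives the degenerate
   interval (0, 0). *)
have J0uv k : ~ (J k !=set0) -> u k = 0 /\ v k = 0.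
  by move=> /set0P/negP/negPn/eqP J0; rewrite /u /v J0 inf0 sup0.
have JP k : J k !=set0 -> J k `<=` `]u k, v k] /\ `]u k, v k[ `<=` J k.
  move=> J0; apply: interval_hull => //.
  - by exists 0 => x [_ /=]; rewrite in_itv/= => /andP[/ltW].
  - by exists a => x [_ /=]; rewrite in_itv/= => /andP[].
  - move=> x y [Ix Jx] [Iy Jy] z xyz; split.
      exact: (@open_disjoint_itv_is_interval R U oU k x y Ix Iy z xyz).
    move: Jx Jy xyz => /=; rewrite !in_itv/= => /andP[x0 xa] /andP[y0 ya] /andP[xz zy].
    by rewrite (lt_le_trans x0)//= (le_trans zy).
  - move=> x [Ix /=]; rewrite in_itv/= => /andP[x0 xa].
    have : \forall y \near x, I k y /\ 0 < y.
      near=> y; split.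
        near: y; apply: open_nbhs_nbhs; split => //.
        exact: open_disjoint_itv_open.
      by near: y; exact: lt_nbhsr.
    move=> /nbhs_ballP[r /= r0 /(_ (x - r / 2))].
    have r20 : 0 < r / 2 by rewrite divr_gt0.
    case=> [|Iy y0].
      by rewrite /ball/= opprB addrC subrK gtr0_norm// ltr_pdivrMr// ltr_pMr// ltr1n.
    exists (x - r / 2); last by rewrite ltrBlDr ltrDl.
    split => //=; rewrite in_itv/= y0/= (le_trans _ xa)// gerBl//.
    exact: ltW.
have uvP k : [/\ 0 <= u k, u k <= v k, v k <= a,
    ((v k - u k)%:E <= mu (J k))%E & (muF (J k) <= (F (v k) - F (u k))%:E)%E].
  have [J0|J0] := pselect (J k !=set0); last first.
    have [-> ->] := J0uv _ J0; rewrite !subrr lexx ltW//; split => //.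
    move: J0 => /set0P/negP/negPn/eqP ->.
    by rewrite /muF measure0.
  have [J1 J2] := JP _ J0.
  have [x Jx] := J0; have := J1 _ Jx; rewrite /= in_itv/= => /andP[ux xv].
  have uv : u k <= v k by rewrite ltW// (lt_le_trans ux).
  split => //.
  - apply: lb_le_inf => // y [_ /=].
    by rewrite in_itv/= => /andP[/ltW].
  - apply: ge_sup => // y [_ /=].
    by rewrite in_itv/= => /andP[_].
  - have <- : mu `]u k, v k[ = (v k - u k)%:E.
      rewrite lebesgue_measure_itv/= lte_fin; case: ltP => // vu.
      by rewrite (le_anti (introT andP (conj uv vu))) subrr.
    by apply: le_measure => //; rewrite inE; [exact: measurable_itv|exact: mJ].
  - rewrite -muF_oc//.
    by apply: le_measure => //; rewrite inE; [exact: mJ|exact: measurable_itv].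
rewrite (le_trans (lee_sum _ (fun k _ => _ : _ <= (F (v k) - F (u k))%:E)%E))//.
  by move=> k _; have [] := uvP k.
rewrite sumEFin lee_fin.
have := acdl [seq (u k, v k) | k <- index_iota 0 n].
rewrite !big_map => H; apply: le_trans (H _ _ _).
- rewrite big_mkcond; apply: ler_sum => k _ /=.
  by case: ifP => _; rewrite ?ler_norm ?normr_ge0.
- apply/allP => _ /mapP[k _ ->] /=; by have [-> -> ->] := uvP k.
- rewrite /nonoverlapping pairwise_map.
  apply/(pairwiseP 0%N) => i j; rewrite !inE size_iota subn0 => il jl ij.
  rewrite !nth_iota ?subn0//.
  rewrite !add0n/=.
  have [Ji|Ji] := pselect (J i !=set0); last first.
    by have [+ _ _ _ _] := uvP j; have [_ ->] := J0uv _ Ji => ->.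
  have [Jj|Jj] := pselect (J j !=set0); last first.
    by have [+ _ _ _ _] := uvP i; have [_ ->] := J0uv _ Jj => ->; rewrite orbT.
  (* If neither interval precedes the other, the midpoint of their overlap lies in both components,
     against disjointness. *)
  apply: contraT; rewrite negb_or -!ltNge => /andP[uv1 uv2].
  have [_ hi] := JP _ Ji; have [_ hj] := JP _ Jj.
  have [Ji1 _] := JP _ Ji; have [Jj1 _] := JP _ Jj.
  have uvi : u i < v i.
    by case: Ji => x /Ji1/=; rewrite in_itv/= => /andP[]; exact: lt_le_trans.
  have uvj : u j < v j.
    by case: Jj => x /Jj1/=; rewrite in_itv/= => /andP[]; exact: lt_le_trans.
  pose lo := Num.max (u i) (u j); pose up := Num.min (v i) (v j).
  have lu : lo < up by rewrite lt_min !gt_max uvi uv1 uv2 uvj.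
  pose x := (lo + up) / 2.
  have lx : lo < x by rewrite midf_lt.
  have xu : x < up by rewrite midf_lt.
  have Jix : J i x.
    apply: hi; rewrite /= in_itv/=.
    by move: lx xu; rewrite gt_max lt_min => /andP[-> _] /andP[->].
  have Jjx : J j x.
    apply: hj; rewrite /= in_itv/=.
    by move: lx xu; rewrite gt_max lt_min => /andP[_ ->] /andP[_ ->].
  have ijE : i = j by apply: (tJ i j) => //; exists x.
  by move: ij; rewrite ijE ltnn.
- rewrite -lte_fin -sumEFin.
  apply: le_lt_trans (_ : _ <= mu U)%E Udl.
  apply: (@le_trans _ _ (\sum_(0 <= k < n) mu (J k))%E).
    by apply: lee_sum => k _; have [] := uvP k.
  rewrite big_mkord -(measure_bigsetU mu)//.
  apply: le_measure; rewrite ?inE;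
    [by apply: bigsetU_measurable => k _; exact: mJ|exact: mU|].
  rewrite (open_disjoint_itv_bigcup oU) => x.
  by rewrite -bigcup_mkord => -[k _ [Ikx _]]; exists k.
Unshelve. all: by end_near. Qed.

(** The density is a Radon-Nikodym derivative: the Stieltjes measure of [F] on []0, a]] is finite
    and dominated by Lebesgue measure. *)
Lemma nondecreasing_ac_FTC : exists f : R -> R,
  mu.-integrable setT (EFin \o f) /\
  forall x, 0 <= x -> x <= a -> F x - F 0 = \int[mu]_(t in `]0, x]) f t.
Proof.
have mD : measurable (`]0, a]%classic : set (measurableTypeR R)) by [].
have Doo : (muF `]0%R, a] < +oo)%E by rewrite muF_oc ?ltW// ltry.
pose nu := mfrestr mD Doo.
have nu_mu : nu `<< mu.
  apply/null_content_dominatesP => N mN N0; exact: nulln.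
have [f [f0 ffin intf fE]] := radon_nikodym_sigma_finite nu_mu.
exists (fine \o f).
have ff : EFin \o (fine \o f) = f by apply/funext => x /=; rewrite fineK.
split; first by rewrite ff.
move=> x x0 xa; rewrite /Rintegral.
under eq_integral do rewrite /= fineK//.
rewrite -fE//= /nu /mfrestr /mrestr/= setIidl; last first.
  by move=> y /=; rewrite !in_itv/= => /andP[-> /le_trans]; exact.
by have := muF_oc x0; rewrite /muF => ->.
Qed.

End monotone.

Lemma ac_onB a f g : ac_on a f -> ac_on a g -> ac_on a (f \- g).
Proof.
move=> acf acg e e0; have e20 : 0 < e / 2 by rewrite divr_gt0.
have [d1 d10 H1] := acf _ e20; have [d2 d20 H2] := acg _ e20.
exists (Num.min d1 d2); first by rewrite lt_min d10.
move=> s s1 s2; rewrite lt_min => /andP[sd1 sd2].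
rewrite (@le_trans _ _ (\sum_(I <- s) (`|f I.2 - f I.1| + `|g I.2 - g I.1|)))//.
  apply: ler_sum => I _ /=; rewrite (_ : _ - _ - _ = (f I.2 - f I.1) - (g I.2 - g I.1)).
    exact: ler_normB.
  by ring.
by rewrite big_split/= [leRHS]splitr lerD// ?H1 ?H2.
Qed.

Lemma eq_ac_on a f g : {in `[0, a], f =1 g} -> ac_on a f -> ac_on a g.
Proof.
move=> fg acf e e0; have [dl dl0 H] := acf _ e0; exists dl => // s sa so ss.
rewrite (le_trans _ (H s sa so ss))// big_seq [leRHS]big_seq.
apply: ler_sum => I Is; have /allP/(_ _ Is)/andP[/andP[I0 I12] Ia] := sa.
rewrite !fg ?in_itv/= ?I0 ?Ia ?(le_trans I0)//.
by rewrite (le_trans I12).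
Qed.

Lemma nonoverlapping_partition (x y : R) (s : seq R) : itv_partition x y s ->
  let s' := zip (x :: s) s in
  [/\ all (fun I : R * R => (x <= I.1) && (I.1 <= I.2) && (I.2 <= y)) s',
     nonoverlapping s' & \sum_(I <- s') (I.2 - I.1) = y - x].
Proof.
elim: s x => [|z s ih] x xys /=.
  by have <- := itv_partition_nil xys; rewrite big_nil subrr.
have xz : x < z by case: xys => /= /andP[].
have zys := itv_partition_cons xys.
have zy := itv_partition_le zys.
have [h1 h2 h3] := ih _ zys; split.
- rewrite lexx zy ltW//=; apply: sub_all h1 => I /andP[/andP[zI ->] ->].
  by rewrite (le_trans (ltW xz)).
- rewrite /nonoverlapping/= -/(nonoverlapping _) h2 andbT.
  by apply: sub_all h1 => I /andP[/andP[-> _] _].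
- by rewrite big_cons/= h3 addrC subrKA.
Qed.

Lemma variation_zipE (x y : R) f (s : seq R) : itv_partition x y s ->
  variation x y f s = \sum_(I <- zip (x :: s) s) `|f I.2 - f I.1|.
Proof.
move=> /variation_zip ->; elim: s x => [|z s ih] x /=; first by rewrite !big_nil.
by rewrite !big_cons ih.
Qed.

(** * Total variation of an absolutely continuous function *)

Section total_variation_ac.
Variables (h : R -> R) (a : R).
Hypothesis ach : ac_on a h.

Local Notation TV := (@total_variation R).

(** Induction on [s2]: its head is replaced by a partition whose pieces join [s1]. The total length
    does not change, so the induction hypothesis applies, and the supremum over the partitions turns
    these increments into a total variation. *)
Lemma ac_on_sumTV e dl s1 s2 :
  (forall s, subitvs a s -> nonoverlapping s ->
    \sum_(I <- s) (I.2 - I.1) < dl -> \sum_(I <- s) `|h I.2 - h I.1| <= e) ->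
  subitvs a (s1 ++ s2) -> nonoverlapping (s1 ++ s2) ->
  \sum_(I <- s1 ++ s2) (I.2 - I.1) < dl ->
  ((\sum_(I <- s1) `|h I.2 - h I.1|)%:E + \sum_(I <- s2) TV I.1 I.2 h <= e%:E)%E.
Proof.
move=> H; elim: s2 s1 => [|I s2 ih] s1.
  by rewrite cats0 big_nil adde0 lee_fin; exact: H.
move=> sa so sl.
have /andP[/andP[I0 I12] Ia] : (0 <= I.1) && (I.1 <= I.2) && (I.2 <= a).
  by apply: (allP sa); rewrite mem_cat inE eqxx orbT.
have sTV : (0 <= \sum_(J <- s2) TV J.1 J.2 h)%E.
  rewrite big_seq; apply: sume_ge0 => J Js.
  apply: total_variation_ge0; move/allP/(_ J): sa; rewrite mem_cat inE Js !orbT.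
  by move=> /(_ isT)/andP[/andP[]].
have key p : itv_partition I.1 I.2 p ->
    ((variation I.1 I.2 h p)%:E + ((\sum_(J <- s1) `|h J.2 - h J.1|)%:E +
      \sum_(J <- s2) TV J.1 J.2 h) <= e%:E)%E.
  move=> Ip; have [p1 p2 p3] := nonoverlapping_partition Ip.
  rewrite variation_zipE// addeA -EFinD -big_cat.
  apply: ih.
  - move: sa; rewrite /subitvs -!catA !all_cat /= => /and3P[-> _ ->]; rewrite andbT.
    apply/andP; split => //; apply: sub_all p1 => J /andP[/andP[h1 ->] h2].
    by rewrite (le_trans I0)//= (le_trans h2).
  - move: so; rewrite /nonoverlapping -catA !pairwise_cat /= => /and4P[].
    move=> /allrelP r1 -> /allP rI ->; rewrite !andbT -/(nonoverlapping _) p2 /=.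
    have r1z J K : J \in s1 -> K \in zip (I.1 :: p) p ->
        (J.2 <= K.1) || (K.2 <= J.1).
      move=> J1 /(allP p1)/andP[/andP[K1 _] K2].
      have := r1 J I J1; rewrite inE eqxx => /(_ isT)/orP[JI|IJ].
        by rewrite (le_trans JI).
      by rewrite (le_trans K2)// orbT.
    have rz2 K L : K \in zip (I.1 :: p) p -> L \in s2 ->
        (K.2 <= L.1) || (L.2 <= K.1).
      move=> /(allP p1)/andP[/andP[K1 _] K2] /rI/orP[JI|IJ].
        by rewrite (le_trans K2).
      by rewrite (le_trans IJ)// orbT.
    apply/andP; split; last first.
      by apply/allrelP => J L J1 L2; apply: r1; rewrite // inE L2 orbT.
    apply/allrelP => K L Kz; rewrite mem_cat => /orP[L1|L2]; last exact: rz2.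
    by rewrite orbC; exact: r1z.
  - move: sl; rewrite !big_cat/= big_cons p3 addrCA addrA.
    by [].
rewrite big_cons addeCA.
set C := ((\sum_(J <- s1) _)%:E + _)%E in key *.
have C0 : (0 <= C)%E by rewrite adde_ge0// lee_fin sumr_ge0.
(* One partition is enough to see that [C] is finite, so that it can be subtracted before the
   supremum is taken. *)
have [p0 Ip0] : exists p, itv_partition I.1 I.2 p.
  move: I12; rewrite le_eqVlt => /predU1P[->|I12]; first by exists [::].
  by exists [:: I.2]; exact: itv_partition1.
have Cfin : C \is a fin_num.
  rewrite ge0_fin_numE//; apply: le_lt_trans (_ : _ <= e%:E)%E _; last exact: ltry.
  by apply: le_trans (key _ Ip0); rewrite leeDr// lee_fin variation_ge0.
rewrite -leeBrDr//; apply: ge_ereal_sup => _ /= [_ [p Ip <-] <-].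
by rewrite leeBrDr//; exact: key.
Qed.

(** [[0, a]] is cut into equal pieces shorter than the [dl] that belongs to e = 1; on each of them
    the total variation is at most 1. *)
Lemma ac_on_bounded_variation : 0 < a -> bounded_variation 0 a h.
Proof.
move=> a0; apply/bounded_variationP; first exact: ltW.
have [dl dl0 H] := ach ltr01.
have [N aN] : exists N : nat, a / N.+1%:R < dl.
  exists (Num.truncn (a / dl)); rewrite ltr_pdivrMr// mulrC -ltr_pdivrMr//.
  exact: truncnS_gt.
pose x k : R := k%:R * (a / N.+1%:R).
have aN0 : 0 < a / N.+1%:R by rewrite divr_gt0.
have xS k : x k.+1 - x k = a / N.+1%:R by rewrite /x -natr1; ring.
have x_ge0 k : 0 <= x k by rewrite /x mulr_ge0// ltW.
have xle k : x k <= x k.+1 by rewrite -subr_ge0 xS ltW.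
have xN : x N.+1 = a by rewrite /x mulrC divfK.
have xa k : (k <= N.+1)%N -> x k <= a.
  by move=> kN; rewrite -xN /x ler_wpM2r ?ler_nat// ltW.
suff fin k : (k <= N.+1)%N -> TV 0 (x k) h \is a fin_num by rewrite -xN fin.
elim: k => [_|k ih kN]; first by rewrite /x mul0r total_variationxx.
rewrite (@total_variationD _ 0 (x k.+1) (x k))// fin_numD ih ?(ltnW kN)//=.
rewrite ge0_fin_numE; last exact: total_variation_ge0.
have := @ac_on_sumTV 1 dl [::] [:: (x k, x k.+1)] H.
rewrite /= !big_nil add0e !big_seq1 /= x_ge0 xle xa// xS => /(_ isT isT aN).
by move=> /le_lt_trans -> //; exact: ltry.
Qed.

Lemma ac_on_total_variation : 0 < a -> ac_on a (fun x => fine (TV 0 x h)).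
Proof.
move=> a0 e e0; have [dl dl0 H] := ach e0; exists dl => // s sa so sl.
have := @ac_on_sumTV e dl [::] s H sa so sl; rewrite big_nil add0e.
have fin x : 0 <= x <= a -> TV 0 x h \is a fin_num.
  move=> /andP[x0 xa]; apply/bounded_variationP => //.
  exact: (bounded_variationl x0 xa (ac_on_bounded_variation a0)).
rewrite -lee_fin => /(le_trans _); apply; rewrite -sumEFin big_seq [leRHS]big_seq.
apply: lee_sum => I Is; have /allP/(_ _ Is)/andP[/andP[I0 I12] Ia] := sa.
have I02 : 0 <= I.2 by exact: le_trans I12.
have I1a : I.1 <= a by exact: le_trans Ia.
have D := total_variationD h I0 I12.
have f2 : TV 0 I.2 h \is a fin_num by rewrite fin ?I02.
have f1 : TV 0 I.1 h \is a fin_num by rewrite fin ?I0.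
have f12 : total_variation I.1 I.2 h \is a fin_num.
  by move: f2; rewrite D fin_numD => /andP[].
rewrite D fineD// addrAC subrr add0r ger0_norm ?fineK//.
exact/fine_ge0/total_variation_ge0.
Qed.

End total_variation_ac.

(** Stieltjes measures are built from functions on the whole line; clamping the argument extends a
    function from [[0, a]] by constants. *)
Lemma within_continuous_clamp a h : 0 <= a -> {within `[0, a], continuous h} ->
  continuous (fun x : R => h (Num.min (Num.max x 0) a)).
Proof.
move=> a0 /subspace_continuousP ch x; pose c (y : R) := Num.min (Num.max y 0) a.
have cc : continuous c.
  move=> y; have : {for y, continuous ((idfun \max cst 0) \min cst a : R -> R^o)}.
    apply: continuous_min; last exact: cvg_cst.
    by apply: continuous_max; [exact: cvg_id|exact: cvg_cst].
  exact.
have c01 y : `[0, a]%classic (c y).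
  by rewrite /= in_itv/= /c le_min a0 andbT le_max lexx orbT ge_min lexx orbT.
move=> B hB; have : \forall y \near x, `[0, a]%classic (c y) -> B (h (c y)).
  exact: cc _ _ (ch _ (c01 x) _ hB).
by apply: filterS => y /(_ (c01 y)).
Qed.

Lemma is_derive_cstD (c : R) (F : R -> R) (x l : R) :
  is_derive x 1 F l -> is_derive x 1 (fun y => c + F y) l.
Proof.
by move=> dF; rewrite -[l]add0r; exact: (is_deriveD (is_derive_cst c x 1) dF).
Qed.

(** Jordan decomposition: h is the difference of its total variation [V] and of [G = V - h], both
    nondecreasing, continuous and absolutely continuous. The densities of [V] and [G] are
    subtracted, and Lebesgue differentiation identifies the difference as the derivative almost
    everywhere. *)
Theorem ac_FTC a h : 0 < a -> ac_on a h -> {within `[0, a], continuous h} ->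
  exists f : R -> R, [/\ mu.-integrable setT (EFin \o f),
    forall x, 0 <= x -> x <= a -> h x - h 0 = \int[mu]_(t in `]0, x]) f t &
    {ae mu, forall x, 0 < x < a -> is_derive x 1 h (f x)}].
Proof.
move=> a0 ach ch; have BVh := ac_on_bounded_variation ach a0.
pose c (y : R) := Num.min (Num.max y 0) a.
have c01 y : 0 <= c y <= a.
  by rewrite /c le_min (ltW a0) andbT le_max lexx orbT ge_min lexx orbT.
have cE y : 0 <= y <= a -> c y = y.
  by move=> /andP[y0 ya]; rewrite /c max_l// min_l.
have cle x y : x <= y -> c x <= c y.
  move=> xy; rewrite /c le_min !ge_min lexx orbT andbT ge_max.
  by rewrite le_max xy/= le_max lexx orbT.
pose V x := fine (total_variation 0 (c x) h).
pose G x := V x - h (c x).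
have fin x : 0 <= x <= a -> total_variation 0 x h \is a fin_num.
  move=> /andP[x0 xa]; apply/bounded_variationP => //.
  exact: (bounded_variationl x0 xa BVh).
have Vinc x y : x <= y -> `|h (c y) - h (c x)| <= V y - V x.
  move=> /cle cxy; have /andP[cx0 cxa] := c01 x.
  have D := total_variationD h cx0 cxy.
  rewrite -lee_fin /V EFinB !fineK ?fin//.
  rewrite D addeAC subee ?fin// add0e.
  exact: total_variation_ge.
have ndV : {homo V : x y / x <= y}.
  by move=> x y /Vinc; rewrite -(subr_ge0 (V x)); exact: le_trans.
have ndG : {homo G : x y / x <= y}.
  move=> x y /Vinc H; rewrite /G lerBrDr -addrA -lerBrDl (le_trans _ H)//.
  by rewrite addrC ler_norm.
have cV : continuous V.
  apply: (@within_continuous_clamp a (fine \o total_variation 0 ^~ h)).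
    exact: ltW.
  exact: total_variation_continuous.
have chc : continuous (fun x => h (c x)) by apply: within_continuous_clamp => //; exact: ltW.
have cG : continuous G by move=> x; apply: cvgB; [exact: cV|exact: chc].
have acV : ac_on a V.
  apply: eq_ac_on (ac_on_total_variation ach a0) => x; rewrite in_itv/= => x01.
  by rewrite /V cE.
have acG : ac_on a G.
  apply: ac_onB acV _; apply: eq_ac_on ach => x; rewrite in_itv/= => x01.
  by rewrite cE.
have [fV [intV fVE]] := nondecreasing_ac_FTC a0 ndV cV acV.
have [fG [intG fGE]] := nondecreasing_ac_FTC a0 ndG cG acG.
pose f x := fV x - fG x.
have intf : mu.-integrable setT (EFin \o f).
  rewrite (_ : _ \o _ = (EFin \o fV) \- (EFin \o fG))%E; first exact: integrableB.
  by apply/funext => x /=; rewrite EFinB.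
have hE x : 0 <= x -> x <= a -> h x - h 0 = \int[mu]_(t in `]0, x]) f t.
  move=> x0 xa; rewrite RintegralB//; last 2 first.
  - exact: integrableS intV.
  - exact: integrableS intG.
  have c0 : c 0 = 0 by rewrite cE// lexx ltW.
  have cx : c x = x by rewrite cE// x0.
  by rewrite -fVE// -fGE// /G c0 cx; ring.
exists f; split => //.
have locf : locally_integrable setT f.
  by apply: open_integrable_locally => //; exact: openT.
have intf' (y : R) : mu.-integrable [set` Interval (BRight 0) (BRight y)] (EFin \o f).
  by apply: integrableS intf.
have := FTC1 intf' locf.
apply: filterS; first exact: (ae_filter_ringOfSetsType mu).
move=> x Hx /andP[x0 xa].
have [dF FE] := Hx x0.
have dF' : is_derive x 1 (fun y => \int[mu]_(t in `]0, y]) f t) (f x).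
  by apply: DeriveDef; rewrite -?derive1E.
apply: near_eq_is_derive (is_derive_cstD (h 0) dF').
near=> y; have y0 : 0 <= y by apply/ltW; near: y; exact: lt_nbhsr.
have ya : y <= a by apply/ltW; near: y; exact: lt_nbhsl.
by rewrite -hE// addrC subrK.
Unshelve. all: by end_near. Qed.

End absolutely_continuous.

(** * Smooth bounded functions of a matrix *)

Section continuous_arith.
Context {R : realType} {V : topologicalType}.
Implicit Types f g : V -> R.

Lemma continuous_funD f g : continuous f -> continuous g ->
  continuous (fun x => f x + g x).
Proof. by move=> cf cg x; apply: cvgD; [exact: cf|exact: cg]. Qed.

Lemma continuous_funM f g : continuous f -> continuous g ->
  continuous (fun x => f x * g x).
Proof. by move=> cf cg x; apply: cvgM; [exact: cf|exact: cg]. Qed.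

Lemma continuous_funC (c : R) : continuous (fun _ : V => c).
Proof. by move=> x; exact: cvg_cst. Qed.

Lemma cvg_mx (F : set_system V) (FF : Filter F) m n (g : V -> 'M[R]_(m, n))
    (A : 'M[R]_(m, n)) :
  (forall i j, g x i j @[x --> F] --> A i j) -> g x @[x --> F] --> A.
Proof.
move=> cg; apply/cvgrPdist_le => e e0; near=> y.
rewrite /Num.Def.normr/= mx_normrE (bigmax_le _ (ltW e0))//= => i _.
rewrite !mxE; move: i; near: y; apply: filter_forall => /= i.
exact: ((cvgrPdist_le _ _).1 (cg i.1 i.2)).
Unshelve. all: by end_near. Qed.

Lemma continuous_mx m n (g : V -> 'M[R]_(m, n)) :
  (forall i j, continuous (fun x => g x i j)) -> continuous g.
Proof. by move=> cg x; apply: cvg_mx => i j; exact: cg. Qed.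

End continuous_arith.

Section directional_derivatives.
Context {R : realType} {V : normedModType R}.
Implicit Types (f g : V -> R) (x v : V).

Lemma is_derive_cvgP f x v (l : R) : is_derive x v f l <->
  (fun h : R => h^-1 * (f (h *: v + x) - f x)) @ 0^' --> l.
Proof.
split=> [[df <-]|cl]; first exact: df.
by apply: DeriveDef; [apply/cvg_ex; exists l|exact/cvg_lim].
Qed.

End directional_derivatives.

Section directional_derivatives_line.
Context {R : realType} {V : normedModType R}.
Implicit Types (f g : V -> R) (x v : V).

Lemma is_derive_lineP f x v (t l : R) :
  is_derive (t *: v + x) v f l <->
  is_derive t 1 (fun h : R => f (h *: v + x)) l.
Proof.
rewrite [X in X <-> _]is_derive_cvgP [X in _ <-> X]is_derive_cvgP.
rewrite (_ : (fun h : R => h^-1 * (f (h *: v + _) - _)) =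
  (fun h : R => h^-1 * (f ((h *: 1 + t) *: v + x) - f (t *: v + x))))//.
by apply/funext => h; rewrite addrA -scalerDl [_%:A]mulr1.
Qed.

Lemma is_derive_line0P f x v (l : R) : is_derive x v f l <->
  is_derive (0 : R) 1 (fun h : R => f (h *: v + x)) l.
Proof. by rewrite -is_derive_lineP scale0r add0r. Qed.

Lemma is_derive_comp1 (phi : R -> R) f x v (a b : R) :
  is_derive (f x) 1 phi a -> is_derive x v f b ->
  is_derive x v (fun y => phi (f y)) (a * b).
Proof.
move=> dphi /is_derive_line0P df; apply/is_derive_line0P.
apply: (@is_derive1_comp _ phi (fun h : R => f (h *: v + x))) => //.
by rewrite scale0r add0r.
Qed.

Lemma is_derive_mvt f (df : V -> R) v : (forall y, is_derive y v f (df y)) ->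
  forall y (t : R), exists2 xi : R, `|xi| <= `|t| &
    f (t *: v + y) - f y = t * df (xi *: v + y).
Proof.
move=> dfv y t; pose g (h : R) := f (h *: v + y).
have dg (h : R) : is_derive h 1 g (df (h *: v + y)) by apply/is_derive_lineP.
have cg : continuous g.
  by move=> h; apply/differentiable_continuous/derivable1_diffP; have [] := dg h.
have g0 : g 0 = f y by rewrite /g scale0r add0r.
rewrite -g0 -/(g t); have [t0|t0] := leP 0 t.
  have [|c] := @MVT_segment _ g (fun h => df (h *: v + y)) 0 t t0 (fun h _ => dg h).
    exact: continuous_subspaceT.
  rewrite in_itv/= subr0 => /andP[c0 ct] ->; exists c; last by rewrite mulrC.
  by rewrite !ger0_norm.
have [|c] := @MVT_segment _ g (fun h => df (h *: v + y)) t 0 (ltW t0) (fun h _ => dg h).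
  exact: continuous_subspaceT.
rewrite in_itv/= => /andP[tc c0] E; exists c.
  by rewrite ler0_norm// ltr0_norm// lerN2.
by rewrite -opprB E sub0r mulrN opprK mulrC.
Qed.

(** The increment along c v + w is split at the intermediate point x + h w. The mean value theorem
    handles the part along v, and continuity of [df] at x moves the derivative back to x. *)
Lemma is_derive_split f (df : V -> R) v x w (c l : R) :
  (forall y, is_derive y v f (df y)) -> {for x, continuous df} ->
  is_derive x w f l -> is_derive x (c *: v + w) f (c * df x + l).
Proof.
move=> dfv cdf /is_derive_cvgP dw; apply/is_derive_cvgP.
pose q (h : R) := h^-1 * (f (h *: (c *: v) + (h *: w + x)) - f (h *: w + x)).
rewrite (_ : (fun _ => _) = fun h : R => q h + h^-1 * (f (h *: w + x) - f x)); last first.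
  by apply/funext => h; rewrite /q -mulrDr addrA subrK scalerDr addrA.
apply: cvgD => //; apply/cvgrPdist_lt => e e0.
have [r /= r0 Hr] : nbhs_ball x [set y | `|df x - df y| < e / (`|c| + 1)].
  apply/nbhs_ballP; move/cvgrPdist_lt : cdf; apply.
  by rewrite divr_gt0.
(* The mean value point lies within |h| K of x; the summand 1 keeps K positive. *)
pose K := `|c| * `|v| + `|w| + 1.
have K0 : 0 < K by rewrite /K ltr_wpDl// addr_ge0// mulr_ge0.
near=> h.
have h0 : h != 0 by near: h; exact: nbhs_dnbhs_neq.
have hK : `|h| * K < r.
  rewrite -ltr_pdivlMr//; near: h.
  by apply: dnbhs0_lt; rewrite divr_gt0.
rewrite /q scalerA; have [xi xih ->] := is_derive_mvt dfv (h *: w + x) (h * c).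
rewrite mulrA mulrA mulVf// mul1r -mulrBr normrM.
have : ball x r (xi *: v + (h *: w + x)).
  rewrite -ball_normE /= addrA opprD addrA addrAC subrr add0r normrN.
  apply: le_lt_trans hK; rewrite (le_trans (ler_normD _ _))// !normrZ /K !mulrDr.
  rewrite -addrA lerD//.
    by rewrite mulrA ler_wpM2r// -normrM.
  by rewrite lerDl mulr1.
move=> /Hr /= Hdf.
apply: le_lt_trans (_ : (`|c| + 1) * `|df x - df (xi *: v + (h *: w + x))| < _).
  by rewrite ler_wpM2r// lerDl.
by rewrite mulrC -ltr_pdivlMr.
Unshelve. all: by end_near. Qed.

Lemma is_derive_linear_comb f (I : Type) (e : I -> V) (df : I -> V -> R) :
  (forall i y, is_derive y (e i) f (df i y)) -> (forall i, continuous (df i)) ->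
  forall (s : seq I) (c : I -> R) x,
  is_derive x (\sum_(i <- s) c i *: e i) f (\sum_(i <- s) c i * df i x).
Proof.
move=> dfe cdf s c x; elim: s => [|i s ih].
  by rewrite !big_nil; exact: is_derive0.
by rewrite !big_cons; apply: is_derive_split ih => //; exact: cdf.
Qed.

End directional_derivatives_line.

Section smooth.
Context {R : realType} (d : nat).

Section fixed_n.
Variable n : nat.
Local Notation Mn := ('M[R]_(n, d)).
Implicit Types (f g : Mn -> R) (x v : Mn).

Definition partial f (ik : 'I_n * 'I_d) x : R := 'D_(delta_mx ik.1 ik.2) f x.

Definition bounded f := exists C : R, forall x, `|f x| <= C.

Definition has_partials f :=
  forall x (ik : 'I_n * 'I_d), derivable f x (delta_mx ik.1 ik.2).

(** Recursion on the order of differentiation, in place of the words of derivatives in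
    [smooth_bounded]: closure under sums and products becomes an induction on [k], since the
    derivative of a product is a sum of products of lower order. *)
Fixpoint CbS k f : Prop := [/\ continuous f, bounded f & if k is k'.+1 then
  has_partials f /\ forall ik, CbS k' (partial f ik) else True].

Definition smooth_cb f := forall k, CbS k f.

Lemma CbS_continuous k f : CbS k f -> continuous f. Proof. by case: k => [|k] []. Qed.

Lemma CbS_bounded k f : CbS k f -> bounded f. Proof. by case: k => [|k] []. Qed.

Lemma CbS_le k f : CbS k.+1 f -> CbS k f.
Proof.
elim: k f => [|k ih] f [cf bf [df pf]]; first by split.
by split=> //; split => // ik; exact: ih.
Qed.

Lemma iter_partial_rcons f s ik :
  iter_partial f (rcons s ik) = iter_partial (partial f ik) s.
Proof. by rewrite /iter_partial foldr_rcons. Qed.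

(** The last letter of a word is the derivative applied to [f] itself, hence the induction from the
    right end of the word. *)
Lemma smooth_boundedP f : smooth_bounded f <-> smooth_cb f.
Proof.
split=> [sf k|sf s].
  elim: k f sf => [|k ih] f sf; have [cf df bf] := sf [::]; split => //.
  split => // ik; apply: ih => s.
  by have := sf (rcons s ik); rewrite iter_partial_rcons.
elim/last_ind: s f sf => [|s ik ih] f sf.
  by split; have [cf bf [df _]] := sf 1%N.
rewrite iter_partial_rcons; apply: ih => k.
by have [_ _ [_ H]] := sf k.+1; exact: H.
Qed.

Lemma smooth_cb_partial f ik : smooth_cb f -> smooth_cb (partial f ik).
Proof. by move=> sf k; have [_ _ [_ H]] := sf k.+1; exact: H. Qed.

Lemma smooth_cb_derive f x ik : smooth_cb f ->
  is_derive x (delta_mx ik.1 ik.2) f (partial f ik x).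
Proof. by move=> sf; have [_ _ [df _]] := sf 1%N; exact/derivableP. Qed.

(* The chain rule along lines: continuity of the partial derivatives gives
   all directional derivatives. *)
Lemma smooth_cb_is_derive f x v : smooth_cb f ->
  is_derive x v f (\sum_i \sum_k v i k * partial f (i, k) x).
Proof.
move=> sf; rewrite [v in is_derive _ v _ _]matrix_sum_delta !pair_big/=.
have := @is_derive_linear_comb _ _ f ('I_n * 'I_d)%type
  (fun ik => delta_mx ik.1 ik.2) (partial f) _ _
  (index_enum ('I_n * 'I_d)%type) (fun ik => v ik.1 ik.2) x.
apply.
  by move=> ik y; exact: smooth_cb_derive.
by move=> ik; exact: CbS_continuous (smooth_cb_partial ik sf 0%N).
Qed.

Lemma bounded_cst (c : R) : bounded (cst c).
Proof. by exists `|c|. Qed.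

Lemma boundedD f g : bounded f -> bounded g -> bounded (fun x => f x + g x).
Proof.
move=> [C fC] [D gD]; exists (C + D) => x.
by rewrite (le_trans (ler_normD _ _))// lerD.
Qed.

Lemma boundedM f g : bounded f -> bounded g -> bounded (fun x => f x * g x).
Proof.
by move=> [C fC] [D gD]; exists (C * D) => x; rewrite normrM ler_pM.
Qed.

Lemma CbS_cst k (c : R) : CbS k (fun=> c).
Proof.
have pc ik : partial (fun=> c) ik = fun=> 0.
  by apply/funext => x; exact: derive_cst.
have ccst (a : R) : continuous (fun _ : Mn => a) by exact: continuous_funC.
elim: k c pc => [|k ih] c pc; split => //; [exact: bounded_cst|exact: bounded_cst|].
split; first by move=> x ik; exact: derivable_cst.
move=> ik; rewrite pc; apply: ih => jl.
by apply/funext => x; exact: derive_cst.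
Qed.

Lemma CbSD k f g : CbS k f -> CbS k g -> CbS k (fun x => f x + g x).
Proof.
elim: k f g => [|k ih] f g Cf Cg; move: (Cf) (Cg) => [cf bf +] [cg bg +].
  move=> _ _; split => //; last exact: boundedD.
  exact: continuous_funD.
move=> [df pf] [dg pg]; split; [|exact: boundedD|split].
- exact: continuous_funD.
- by move=> x ik; exact: derivableD.
- move=> ik; rewrite (_ : partial _ ik = fun x => partial f ik x + partial g ik x).
    exact: (ih _ _ (pf ik) (pg ik)).
  by apply/funext => x; rewrite /partial deriveD.
Qed.

Lemma CbSM k f g : CbS k f -> CbS k g -> CbS k (fun x => f x * g x).
Proof.
elim: k f g => [|k ih] f g Cf Cg; move: (Cf) (Cg) => [cf bf +] [cg bg +].
  move=> _ _; split => //; last exact: boundedM.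
  exact: continuous_funM.
move=> [df pf] [dg pg]; split; [|exact: boundedM|split].
- exact: continuous_funM.
- by move=> x ik; exact: derivableM.
- move=> ik; rewrite (_ : partial _ ik =
      fun x => f x * partial g ik x + g x * partial f ik x).
    by apply: CbSD; apply: ih; [exact: CbS_le|exact: pg|exact: CbS_le|exact: pf].
  by apply/funext => x; rewrite /partial deriveM.
Qed.

Lemma smooth_cb_cst (c : R) : smooth_cb (fun=> c).
Proof. by move=> k; exact: CbS_cst. Qed.

Lemma smooth_cbD f g : smooth_cb f -> smooth_cb g -> smooth_cb (fun x => f x + g x).
Proof. by move=> sf sg k; exact: CbSD. Qed.

Lemma smooth_cbM f g : smooth_cb f -> smooth_cb g -> smooth_cb (fun x => f x * g x).
Proof. by move=> sf sg k; exact: CbSM. Qed.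

Lemma CbS_sum k (I : Type) (s : seq I) (P : pred I) (f : I -> Mn -> R) :
  (forall i, CbS k (f i)) -> CbS k (fun x => \sum_(i <- s | P i) f i x).
Proof.
move=> Cf; elim: s => [|i s ih].
  by under eq_fun do rewrite big_nil; exact: CbS_cst.
under eq_fun do rewrite big_cons; case: (P i) => //; exact: CbSD.
Qed.

End fixed_n.

(** The selection [s] may repeat or omit rows. This is how a cylinder function is rewritten over
    another family of times. *)
Lemma smooth_cb_rowsub n m (s : 'I_m -> 'I_n) (f : 'M[R]_(m, d) -> R) :
  smooth_cb f -> smooth_cb (fun x : 'M[R]_(n, d) => f (rowsub s x)).
Proof.
move=> sf k.
have lin (h : R) (v x : 'M[R]_(n, d)) :
    rowsub s (h *: v + x) = h *: rowsub s v + rowsub s x.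
  by apply/matrixP => i j; rewrite !mxE.
have crs : continuous (fun x : 'M[R]_(n, d) => rowsub s x).
  apply: continuous_mx => i j.
  under eq_fun do rewrite mxE; exact: coord_continuous.
elim: k f sf => [|k ih] f sf; split => //.
- by move=> x; apply: continuous_comp; [exact: crs|exact: CbS_continuous (sf 0%N) _].
- by have [C fC] := CbS_bounded (sf 0%N); exists C => x.
- by move=> x; apply: continuous_comp; [exact: crs|exact: CbS_continuous (sf 0%N) _].
- by have [C fC] := CbS_bounded (sf 0%N); exists C => x.
have dF x ik : is_derive x (delta_mx ik.1 ik.2) (fun x : 'M[R]_(n, d) => f (rowsub s x))
    (\sum_i \sum_l rowsub s (delta_mx ik.1 ik.2) i l * partial f (i, l) (rowsub s x)).
  apply/is_derive_line0P; under eq_fun do rewrite lin.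
  exact: ((@is_derive_line0P _ _ f _ _ _).1 (smooth_cb_is_derive _ _ sf)).
split; first by move=> x ik; have [] := dF x ik.
move=> ik; rewrite (_ : partial _ ik = fun x => \sum_i \sum_l
    rowsub s (delta_mx ik.1 ik.2) i l * partial f (i, l) (rowsub s x)); last first.
  by apply/funext => x; have [] := dF x ik.
apply: CbS_sum => i; apply: CbS_sum => l; apply: CbSM; first exact: CbS_cst.
by apply: ih; exact: smooth_cb_partial.
Qed.

Lemma is_derive_affine_entry n (i : 'I_n) (k : 'I_d) (a b : R) x v :
  is_derive x v (fun x : 'M[R]_(n, d) => a * x i k + b) (a * v i k).
Proof.
apply/is_derive_cvgP.
have E : \forall h \near (0 : R)^', a * v i k =
    h^-1 * (a * (h *: v + x) i k + b - (a * x i k + b)).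
  near=> h; have h0 : h != 0 by near: h; exact: nbhs_dnbhs_neq.
  by rewrite !mxE; field.
by apply: cvg_trans (near_eq_cvg E) _; exact: cvg_cst.
Unshelve. all: by end_near. Qed.

(** An entry is unbounded, hence not in [smooth_cb]. These three properties are what the composition
    with [soft_clamp] asks for; the result approximates indicators of half-lines. *)
Lemma smooth_affine_entry n (i : 'I_n) (k : 'I_d) (a b : R) :
  let f (x : 'M[R]_(n, d)) := a * x i k + b in
  [/\ continuous f, has_partials f & forall jl, smooth_cb (partial f jl)].
Proof.
move=> f; split.
- apply: continuous_funD; last exact: continuous_funC.
  apply: continuous_funM; first exact: continuous_funC.
  exact: coord_continuous.
- by move=> x jl; have [] := is_derive_affine_entry i k a b x (delta_mx jl.1 jl.2).
- move=> jl; rewrite (_ : partial _ jl = fun=> a * (delta_mx jl.1 jl.2 : 'M[R]_(n, d)) i k).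
    exact: smooth_cb_cst.
  by apply/funext => x; have [] := is_derive_affine_entry i k a b x (delta_mx jl.1 jl.2).
Qed.

End smooth.

(* A smooth version of [y |-> min (max y 0) 1 = (|y| - |y - 1| + 1) / 2]. *)
Section smooth_clamp.
Context {R : realType}.
Variable e : R.
Hypothesis e_gt0 : 0 < e.
Implicit Types y c : R.

Definition soft_abs y := Num.sqrt (y ^+ 2 + e ^+ 2).
Definition soft_sign y := y / soft_abs y.
Definition soft_clamp y := (soft_abs y - soft_abs (y - 1) + 1) / 2.
Definition soft_clamp' y := (soft_sign y - soft_sign (y - 1)) / 2.

Let q_gt0 y : 0 < y ^+ 2 + e ^+ 2.
Proof. by rewrite ltr_wpDl ?sqr_ge0// exprn_gt0. Qed.

Lemma soft_abs_gt0 y : 0 < soft_abs y. Proof. by rewrite sqrtr_gt0. Qed.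

Lemma soft_abs_sqr y : soft_abs y ^+ 2 = y ^+ 2 + e ^+ 2.
Proof. by rewrite sqr_sqrtr// ltW. Qed.

Lemma soft_abs_bounds y : `|y| <= soft_abs y <= `|y| + e.
Proof.
have yE : `|y| = Num.sqrt (y ^+ 2) by rewrite sqrtr_sqr.
rewrite {1}yE ler_wsqrtr ?lerDl ?sqr_ge0//=.
rewrite -(@ler_pXn2r _ 2) ?nnegrE ?addr_ge0 ?sqrtr_ge0 ?(ltW e_gt0)//.
rewrite soft_abs_sqr sqrrD real_normK ?num_real// lerD2r lerDl.
by rewrite mulrn_wge0// mulr_ge0// ltW.
Qed.

Lemma soft_sign_le1 y : `|soft_sign y| <= 1.
Proof.
rewrite /soft_sign normrM normfV (ger0_norm (ltW (soft_abs_gt0 y))).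
by rewrite ler_pdivrMr ?soft_abs_gt0// mul1r; have /andP[] := soft_abs_bounds y.
Qed.

Lemma soft_clamp'_le1 y : `|soft_clamp' y| <= 1.
Proof.
rewrite /soft_clamp' normrM [X in _ * X]ger0_norm ?invr_ge0//.
rewrite ler_pdivrMr// mul1r (le_trans (ler_normB _ _))//.
by rewrite (_ : 2 = 1 + 1)// lerD// soft_sign_le1.
Qed.

Lemma clampE y : Num.min (Num.max y 0) 1 = (`|y| - `|y - 1| + 1) / 2.
Proof.
have [y0|y0] := leP 0 y; last first.
  rewrite min_l// ltr0_norm// ltr0_norm; last by rewrite subr_lt0 (lt_trans y0).
  by field.
have [y1|y1] := leP y 1.
  by rewrite ger0_norm// ler0_norm ?subr_le0//; field.
by rewrite ger0_norm// gtr0_norm ?subr_gt0//; field.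
Qed.

(** Each soft absolute value exceeds the true one by an error between 0 and [e], and the two errors
    enter with opposite signs. *)
Lemma soft_clamp_approx y :
  `|soft_clamp y - Num.min (Num.max y 0) 1| <= e.
Proof.
rewrite clampE /soft_clamp.
have /andP[a1 a2] := soft_abs_bounds y; have /andP[b1 b2] := soft_abs_bounds (y - 1).
by rewrite ler_norml; apply/andP; split; lra.
Qed.

Lemma soft_clamp_le y : `|soft_clamp y| <= 1 + e.
Proof.
have -> : soft_clamp y = (soft_clamp y - Num.min (Num.max y 0) 1) +
  Num.min (Num.max y 0) 1 by rewrite subrK.
rewrite (le_trans (ler_normD _ _))// addrC lerD// ?soft_clamp_approx//.
rewrite ger0_norm ?ge_min ?lexx ?orbT//.
by rewrite le_min ler01 le_max lexx orbT.
Qed.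

Lemma is_derive_soft_abs y : is_derive y 1 soft_abs (soft_sign y).
Proof.
have d1 : is_derive y 1 (fun y : R => y ^+ 2 + e ^+ 2) (2 * y).
  apply: is_derive_eq; rewrite /GRing.scale/= ?mulr1 ?addr0 ?expr1.
  by ring.
have := @is_derive1_comp _ Num.sqrt (fun y => y ^+ 2 + e ^+ 2) y _ _ (is_derive1_sqrt (q_gt0 y)) d1.
rewrite (_ : _ * _ = soft_sign y)// /soft_sign -/(soft_abs y).
by field; rewrite gt_eqF// soft_abs_gt0.
Qed.

Lemma is_derive_soft_sign y :
  is_derive y 1 soft_sign ((soft_abs y)^-1 * (1 - soft_sign y ^+ 2)).
Proof.
have n0 : soft_abs y != 0 by rewrite gt_eqF// soft_abs_gt0.
have := is_deriveM (is_derive_id y 1) (is_deriveV n0 (is_derive_soft_abs y)).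
rewrite (_ : _ + _ = (soft_abs y)^-1 * (1 - soft_sign y ^+ 2))//.
by rewrite /soft_sign /GRing.scale/=; field.
Qed.

Lemma is_derive_soft_clamp y : is_derive y 1 soft_clamp (soft_clamp' y).
Proof.
have d1 := is_derive_soft_abs y.
have ds : is_derive y 1 (fun y : R => y - 1) 1.
  by apply: is_derive_eq; rewrite subr0.
have d2 := @is_derive1_comp _ soft_abs (fun y => y - 1) y _ _ (is_derive_soft_abs (y - 1)) ds.
have := is_deriveZ (2^-1) (is_deriveD (is_deriveB d1 d2) (is_derive_cst (1 : R) y 1)).
rewrite (_ : _ *: _ = soft_clamp' y); last first.
  by rewrite /soft_clamp' /GRing.scale/=; field.
by apply: near_eq_is_derive; near=> z; rewrite /= /soft_clamp /GRing.scale/= mulrC.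
Unshelve. all: by end_near. Qed.

End smooth_clamp.

Section smooth_clamp_comp.
Context {R : realType} (d n : nat).
Variable e : R.
Hypothesis e_gt0 : 0 < e.
Local Notation Mn := ('M[R]_(n, d)).
Variable f : Mn -> R.
Hypotheses (cf : continuous f) (df : has_partials f)
  (pf : forall ik, smooth_cb (partial f ik)).

Let dfc x ik (c : R) :
  is_derive x (delta_mx ik.1 ik.2) (fun y => f y - c) (partial f ik x).
Proof.
have dfx := @df x ik; have := is_deriveB (derivableP dfx) (is_derive_cst c x (delta_mx ik.1 ik.2)).
by rewrite subr0.
Qed.

Let cfc c : continuous (fun x => f x - c).
Proof. by apply: continuous_funD => //; exact: continuous_funC. Qed.

Let g c x := (soft_abs e (f x - c))^-1.
Let h c x := soft_sign e (f x - c).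

Let dcont (u u' : R -> R) c : (forall y : R, is_derive y 1 u (u' y)) ->
  continuous (fun x => u (f x - c)).
Proof.
move=> du x; apply: (@continuous_comp _ _ _ (fun x => f x - c) u).
  exact: cfc.
by apply/differentiable_continuous/derivable1_diffP; have [] := du (f x - c).
Qed.

Let dV y : is_derive (y : R) 1 (fun y => (soft_abs e y)^-1)
  (- soft_sign e y * (soft_abs e y)^-1 * (soft_abs e y)^-1).
Proof.
have n0 : soft_abs e y != 0 by rewrite gt_eqF// soft_abs_gt0.
have := is_deriveV n0 (is_derive_soft_abs e_gt0 y).
rewrite (_ : _ *: _ = - soft_sign e y * (soft_abs e y)^-1 * (soft_abs e y)^-1)//.
by rewrite /GRing.scale/=; field.
Qed.

(** The derivatives of [g c] and [h c] are polynomials in [g c] and [h c] times a partial derivative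
    of [f], so one induction on the order treats both functions together. *)
Let smooth_gh c k : CbS k (g c) /\ CbS k (h c).
Proof.
have cg : continuous (g c) by exact: dcont dV.
have ch : continuous (h c) by exact: dcont (is_derive_soft_sign e_gt0).
have bg : bounded (g c).
  exists e^-1 => x; rewrite /g normfV (ger0_norm (ltW (soft_abs_gt0 e_gt0 _))).
  rewrite lef_pV2 ?posrE ?soft_abs_gt0// -[leLHS](ger0_norm (ltW e_gt0)).
  by rewrite -sqrtr_sqr ler_wsqrtr// lerDr sqr_ge0.
have bh : bounded (h c) by exists 1 => x; exact: soft_sign_le1.
elim: k => [|k [ihg ihh]]; first by split.
have dg x ik : is_derive x (delta_mx ik.1 ik.2) (g c)
    (- 1 * h c x * g c x * g c x * partial f ik x).
  have := @is_derive_comp1 _ _ (fun y => (soft_abs e y)^-1) _ x _ _ _ (dV (f x - c)) (dfc x ik c).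
  by rewrite mulN1r.
have dh x ik : is_derive x (delta_mx ik.1 ik.2) (h c)
    (g c x * (1 + -1 * (h c x * h c x)) * partial f ik x).
  have := @is_derive_comp1 _ _ (soft_sign e) _ x _ _ _ (is_derive_soft_sign e_gt0 (f x - c)) (dfc x ik c).
  by rewrite mulN1r expr2.
have C1 : CbS k (fun _ : Mn => 1) by exact: CbS_cst.
have CN1 : CbS k (fun _ : Mn => -1 : R) by exact: CbS_cst.
split; [split; [exact: cg|exact: bg|split]|split; [exact: ch|exact: bh|split]].
- by move=> x ik; have [] := dg x ik.
- move=> ik; rewrite (_ : partial _ ik = fun x => - 1 * h c x * g c x * g c x * partial f ik x).
    apply: CbSM; last exact: pf.
    by apply: CbSM => //; apply: CbSM => //; exact: CbSM.
  by apply/funext => x; have [] := dg x ik.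
- by move=> x ik; have [] := dh x ik.
- move=> ik; rewrite (_ : partial _ ik =
      fun x => g c x * (1 + -1 * (h c x * h c x)) * partial f ik x).
    apply: CbSM; last exact: pf.
    by apply: CbSM => //; apply: CbSD => //; apply: CbSM => //; exact: CbSM.
  by apply/funext => x; have [] := dh x ik.
Qed.

Lemma is_derive_soft_clamp_comp x ik :
  is_derive x (delta_mx ik.1 ik.2) (fun y => soft_clamp e (f y))
    (soft_clamp' e (f x) * partial f ik x).
Proof. by apply: is_derive_comp1; [exact: is_derive_soft_clamp|exact/derivableP]. Qed.

Lemma smooth_cb_soft_clamp : smooth_cb (fun x => soft_clamp e (f x)).
Proof.
have cF : continuous (fun x => soft_clamp e (f x)).
  have := dcont (c := 0) (is_derive_soft_clamp e_gt0).
  by under eq_fun do rewrite subr0.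
have bF : bounded (fun x => soft_clamp e (f x)).
  by exists (1 + e) => x; exact: soft_clamp_le.
case=> [|k]; split => //; split.
  by move=> x ik; have [] := is_derive_soft_clamp_comp x ik.
move=> ik; rewrite (_ : partial _ ik =
    fun x => (h 0 x + -1 * h 1 x) * 2^-1 * partial f ik x); last first.
  apply/funext => x; have [_] := is_derive_soft_clamp_comp x ik.
  by rewrite /partial => ->; rewrite /soft_clamp' mulN1r /h subr0.
have CN1 a : CbS k (fun _ : Mn => a : R) by exact: CbS_cst.
apply: CbSM; last exact: pf.
apply: CbSM => //; apply: CbSD; first by have [] := smooth_gh 0 k.
by apply: CbSM => //; have [] := smooth_gh 1 k.
Qed.

End smooth_clamp_comp.

(** * Gaussian integration by parts *)

Section normal_integrals.
Context {R : realType}.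
Variable s : R.
Hypothesis s_gt0 : 0 < s.
Local Notation mu := (@lebesgue_measure R).
Local Notation p := (normal_pdf 0 s).
Local Notation N := (normal_prob 0 s).

Let s_neq0 : s != 0. Proof. by rewrite gt_eqF. Qed.

(** The Radon-Nikodym derivative agrees almost everywhere with the density [p], as both have the
    same integral over every measurable set. *)
Lemma ge0_integral_normal_prob (f : R -> \bar R) : measurable_fun setT f ->
  (forall x, 0 <= f x)%E ->
  (\int[N]_x f x = \int[mu]_x (f x * (p x)%:E))%E.
Proof.
move=> mf f0; have dom := normal_prob_dominates 0 s.
have mp : measurable_fun setT (fun x => (p x)%:E).
  by apply/measurable_EFinP; exact: measurable_normal_pdf.
have intRN := Radon_Nikodym_SigmaFinite.f_integrable dom.
rewrite -(Radon_Nikodym_SigmaFinite.change_of_variables dom f0)//.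
apply: ae_eq_integral => //.
- by apply: emeasurable_funM => //; exact: measurable_int intRN.
- exact: emeasurable_funM.
- apply: ae_eqe_mul2l; apply: integral_ae_eq => //= E _ mE.
  by rewrite -(Radon_Nikodym_SigmaFinite.f_integral dom).
Qed.

Lemma integrable_normal_prob (f : R -> R) : measurable_fun setT f ->
  N.-integrable setT (EFin \o f) ->
  mu.-integrable setT (fun x => (f x * p x)%:E).
Proof.
move=> mf /integrableP[_ intf]; have mp := measurable_normal_pdf 0 s.
apply/integrableP; split; first by apply/measurable_EFinP; exact: measurable_funM.
move: intf; rewrite ge0_integral_normal_prob//; last first.
  by apply/measurable_EFinP; exact: measurableT_comp.
rewrite [X in (X < _)%E -> _](_ : _ = \int[mu]_x `|(f x * p x)%:E|)%E//.
by apply: eq_integral => x _ /=; rewrite -EFinM normrM (ger0_norm (normal_pdf_ge0 _ _ _)).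
Qed.

Lemma Rintegral_normal_prob (f : R -> R) : measurable_fun setT f ->
  N.-integrable setT (EFin \o f) ->
  \int[N]_x f x = \int[mu]_x (f x * p x).
Proof.
move=> mf intf; have mp := measurable_normal_pdf 0 s.
rewrite /Rintegral; congr fine.
rewrite integralE [RHS]integralE.
rewrite ge0_integral_normal_prob//; last first.
  by apply: measurable_funepos; exact/measurable_EFinP.
rewrite ge0_integral_normal_prob//; last first.
  by apply: measurable_funeneg; exact/measurable_EFinP.
congr (_ - _)%E; apply: eq_integral => x _.
  rewrite !funeposE /= !EFinM muleC maxeMr ?lee_fin ?normal_pdf_ge0//.
  by rewrite mule0 muleC.
rewrite !funenegE /= muleC maxeMr ?lee_fin ?normal_pdf_ge0//.
by rewrite mule0 -EFinM mulrN mulrC.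
Qed.

(** Half of the exponent absorbs the square: x^2 exp(- x^2 / (4 s^2)) is at most 4 s^2, and the
    other half is the Gaussian exponent of variance 2 s^2. The ratio of the peaks is sqrt 2 <= 2,
    whence the factor 8. Only the proportionality to s^2 matters later. *)
Let normal_pdf_sqr_le (x : R) :
  x ^+ 2 * p x <= 8 * s ^+ 2 * normal_pdf 0 (s * Num.sqrt 2) x.
Proof.
pose t := s * Num.sqrt 2.
have t0 : t != 0 by rewrite mulf_neq0// gt_eqF// sqrtr_gt0.
have t2 : t ^+ 2 = s ^+ 2 * 2 by rewrite exprMn sqr_sqrtr.
rewrite -/t !normal_pdfE//.
have pk : normal_peak s = Num.sqrt 2 * normal_peak t.
  rewrite /normal_peak t2.
  have -> : s ^+ 2 * 2 * pi *+ 2 = 2 * (s ^+ 2 * pi *+ 2) by ring.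
  by rewrite [in RHS]sqrtrM// invfM mulrA divff ?mul1r// gt_eqF// sqrtr_gt0.
rewrite pk /normal_fun !subr0 t2.
have -> : - x ^+ 2 / (s ^+ 2 *+ 2) = - x ^+ 2 / (s ^+ 2 * 2 *+ 2) - x ^+ 2 / (s ^+ 2 * 4).
  move: (x ^+ 2) (s ^+ 2) (expf_neq0 2 s_neq0) => u v v0; field; exact: v0.
set A := expR (_ / _); rewrite expRD.
have e1 : x ^+ 2 * expR (- (x ^+ 2 / (s ^+ 2 * 4))) <= 4 * s ^+ 2.
  rewrite expRN ler_pdivrMr ?expR_gt0//.
  rewrite (le_trans _ (ler_wpM2l _ (expR_ge1Dx _)))//; last first.
    by rewrite mulr_ge0// sqr_ge0.
  rewrite mulrDr mulr1 -subr_ge0.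
  rewrite [X in 0 <= X](_ : _ = 4 * s ^+ 2); first by rewrite mulr_ge0 ?sqr_ge0.
  move: (x ^+ 2) (s ^+ 2) (expf_neq0 2 s_neq0) => u v v0; field; exact: v0.
have q2 : Num.sqrt 2 <= 2 :> R.
  rewrite -(@ler_pXn2r _ 2) ?nnegrE ?sqrtr_ge0// sqr_sqrtr//.
  by rewrite -natrX ler_nat.
rewrite [leLHS](_ : _ = (x ^+ 2 * expR (- (x ^+ 2 / (s ^+ 2 * 4)))) * Num.sqrt 2
   * (normal_peak t * A)); last by rewrite /A; ring.
apply: ler_wpM2r; first by rewrite mulr_ge0 ?normal_peak_ge0 ?expR_ge0.
rewrite (_ : 8 * s ^+ 2 = 4 * s ^+ 2 * 2); last by ring.
apply: ler_pM => //; first by rewrite mulr_ge0 ?sqr_ge0 ?expR_ge0.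
Qed.

Lemma integral_normal_prob_sqr :
  (\int[N]_x (x ^+ 2)%:E <= (8 * s ^+ 2)%:E)%E.
Proof.
rewrite ge0_integral_normal_prob//; last 2 first.
- by apply/measurable_EFinP; exact: exprn_measurable.
- by move=> x; rewrite lee_fin sqr_ge0.
pose t := s * Num.sqrt 2.
apply: (@le_trans _ _ (\int[mu]_x ((8 * s ^+ 2)%:E * (normal_pdf 0 t x)%:E)))%E.
  apply: ge0_le_integral.
  - by [].
  - by move=> x _; rewrite -EFinM lee_fin mulr_ge0 ?sqr_ge0 ?normal_pdf_ge0.
  - apply/measurable_EFinP; apply: measurable_funM; first exact: exprn_measurable.
    exact: measurable_normal_pdf.
  - apply/measurable_EFinP; apply: measurable_funM => //.
    exact: measurable_normal_pdf.
  - by move=> x _; rewrite -!EFinM lee_fin; exact: normal_pdf_sqr_le.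
rewrite integralZl//=; last exact: integrable_normal_pdf.
by rewrite integral_normal_pdf mule1.
Qed.

Lemma integrable_normal_prob_sqr : N.-integrable setT (fun x => (x ^+ 2)%:E).
Proof.
apply/integrableP; split; first by apply/measurable_EFinP; exact: exprn_measurable.
under eq_integral do rewrite gee0_abs ?lee_fin ?sqr_ge0//.
exact: le_lt_trans integral_normal_prob_sqr (ltry _).
Qed.

Lemma integrable_normal_prob_id : N.-integrable setT (EFin \o (@idfun R)).
Proof.
have := integrableD measurableT (finite_measure_integrable_cst N 1 measurableT) integrable_normal_prob_sqr.
apply: le_integrable => //.
  by apply/measurable_EFinP; exact: measurable_id.
move=> x _ /=; rewrite lee_fin [leRHS]ger0_norm; last by rewrite addr_ge0 ?sqr_ge0.
rewrite -[x ^+ 2]real_normK ?num_real//; move: (`|x|) => {}x; nra.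
Qed.

Lemma is_derive_normal_pdf (x : R) : is_derive x 1 p (- (x / s ^+ 2) * p x).
Proof.
rewrite normal_pdfE//.
have d1 : is_derive x 1 (fun y : R => - (y - 0) ^+ 2 / (s ^+ 2 *+ 2)) (- (x / s ^+ 2)).
  apply: is_derive_eq.
  rewrite !subr0 /GRing.scale /=; field; exact: s_neq0.
have d2 : is_derive x 1 (fun y : R => expR (- (y - 0) ^+ 2 / (s ^+ 2 *+ 2)))
   (expR (- (x - 0) ^+ 2 / (s ^+ 2 *+ 2)) * (- (x / s ^+ 2))).
  exact: is_derive1_comp.
have := @is_deriveZ R R _ (fun y : R => expR (- (y - 0) ^+ 2 / (s ^+ 2 *+ 2))) (normal_peak s) x 1 _ d2.
rewrite (_ : _ *: _ = - (x / s ^+ 2) * (normal_peak s * normal_fun 0 s x))//.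
by rewrite /normal_fun /GRing.scale/=; ring.
Qed.

Lemma normal_pdf_le (x : R) : x != 0 -> p x <= normal_peak s * (2 * s ^+ 2) / x ^+ 2.
Proof.
move=> x0; rewrite normal_pdfE// -mulrA ler_wpM2l ?normal_peak_ge0//.
rewrite /normal_fun subr0 mulNr expRN -[leRHS]invf_div lef_pV2 ?posrE ?expR_gt0//; last first.
  by rewrite divr_gt0//; [rewrite exprn_even_gt0|rewrite mulr_gt0// exprn_gt0].
rewrite (_ : 2 * s ^+ 2 = s ^+ 2 *+ 2); last by rewrite mulr_natl.
by rewrite (le_trans _ (expR_ge1Dx _))// lerDr.
Qed.

(* Stein's identity: the integrand of the difference is the derivative of
   [- s^2 (phi * pdf)], which vanishes at infinity. *)
Lemma normal_prob_stein (phi dphi : R -> R) (C : R) :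
  (forall x : R, is_derive x 1 phi (dphi x)) -> continuous dphi ->
  (forall x, `|phi x| <= C) -> (forall x, `|dphi x| <= C) ->
  \int[N]_x (x * phi x) = s ^+ 2 * \int[N]_x dphi x.
Proof.
move=> dP cdP bP bdP.
have cP : continuous phi.
  move=> x; apply/differentiable_continuous/derivable1_diffP.
  by have [] := dP x.
have mP : measurable_fun setT phi by exact: continuous_measurable_fun.
have mdP : measurable_fun setT dphi by exact: continuous_measurable_fun.
have C0 : 0 <= C by rewrite (le_trans _ (bP 0)).
have i1 : N.-integrable setT (EFin \o (fun x => x * phi x)).
  have := integrableZl measurableT C integrable_normal_prob_id.
  apply: le_integrable => //.
    by apply/measurable_EFinP; exact: measurable_funM.
  move=> x _ /=; rewrite lee_fin !normrM mulrC ler_wpM2r//.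
  by rewrite (ger0_norm C0).
have i2 : N.-integrable setT (EFin \o dphi).
  have := finite_measure_integrable_cst N C measurableT.
  apply: le_integrable => //; first exact/measurable_EFinP.
  by move=> x _ /=; rewrite lee_fin (ger0_norm C0).
have mxP : measurable_fun setT (fun x : R => x * phi x) by exact: measurable_funM.
rewrite !Rintegral_normal_prob//.
have j1 := integrable_normal_prob mxP i1.
have j2 := integrable_normal_prob mdP i2.
pose psi x := phi x * p x.
pose g x := dphi x * p x - (x * phi x * p x) / s ^+ 2.
have dpsi (x : R) : is_derive x 1 psi (g x).
  have := is_deriveM (dP x) (is_derive_normal_pdf x).
  rewrite (_ : _ + _ = g x)// /g /GRing.scale/=.
  by field; exact: s_neq0.
have cg : continuous g.
  move=> x; apply: cvgB; apply: cvgM.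
  - exact: cdP.
  - exact: continuous_normal_pdf.
  - apply: cvgM; last exact: continuous_normal_pdf.
    by apply: cvgM; [exact: cvg_id|exact: cP].
  - exact: cvg_cst.
have jg : mu.-integrable setT (EFin \o g).
  have := integrableB measurableT j2 (integrableZl measurableT (s ^+ 2)^-1 j1).
  apply: eq_integrable => // x _ /=.
  by rewrite -EFinD /g [X in _ - X]mulrC.
suff g0 : \int[mu]_x g x = 0.
  have : \int[mu]_x (dphi x * p x) - (s ^+ 2)^-1 * \int[mu]_x (x * phi x * p x) = 0.
    rewrite -RintegralZl// -RintegralB//; last exact: (integrableZl measurableT _ j1).
    by rewrite -[RHS]g0; apply: eq_Rintegral => x _; rewrite /g [X in _ - X = _]mulrC.
  move=> /eqP; rewrite subr_eq0 => /eqP ->.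
  by rewrite mulrA divff ?mul1r// expf_neq0.
pose I n := `[- n.+1%:R, n.+1%:R]%classic : set R.
have e1 n : (\int[mu]_(x in I n) (g x)%:E = (psi n.+1%:R - psi (- n.+1%:R))%:E)%E.
  rewrite (@continuous_FTC2 _ g psi) ?EFinB//.
  - by rewrite -subr_gt0 opprK addr_gt0.
  - exact: continuous_subspaceT.
  - have cpsi : continuous psi.
      move=> x; apply/differentiable_continuous/derivable1_diffP.
      by have [] := dpsi x.
    split; first by move=> x _; have [] := dpsi x.
    + by apply: cvg_at_right_filter; exact: cpsi.
    + by apply: cvg_at_left_filter; exact: cpsi.
  - by move=> x _; rewrite derive1E; have [] := dpsi x.
have l1 : (fun n => \int[mu]_(x in I n) (g x)%:E)%E @ \oo --> (\int[mu]_x (g x)%:E)%E.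
  rewrite (_ : (fun _ => _) = fun n => (\int[mu]_x ((g x)%:E * (\1_(I n) x)%:E))%E); last first.
    apply/funext => n; rewrite integral_mkcond; apply: eq_integral => x _.
    by rewrite epatch_indic.
  have [] := @dominated_convergence _ _ _ mu setT measurableT
    (fun n x => (g x)%:E * (\1_(I n) x)%:E)%E (EFin \o g) (abse \o (EFin \o g)) => //.
  - move=> n; apply: emeasurable_funM; first exact: measurable_int jg.
    by apply/measurable_EFinP; apply: measurable_indic; exact: measurable_itv.
  - exact: measurable_int jg.
  - apply: aeW => x _; apply: cvg_near_cst.
    exists (Num.truncn `|x|) => // n /= xn; rewrite indicE mem_set ?mule1//.
    rewrite /I /= in_itv/= -ler_norml (le_trans (ltW (truncnS_gt _)))// ler_nat.
    by rewrite ltnS.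
  - exact: integrable_abse.
  - apply: aeW => x n _ /=; rewrite lee_fin normrM.
    by rewrite ler_piMr// indicE; case: (_ \in _); rewrite ?normr1 ?normr0.
have l2 : (fun n => (psi n.+1%:R - psi (- n.+1%:R))%:E) @ \oo --> (0 : \bar R)%E.
  apply: cvg_EFin; first exact: nearW.
  rewrite -[X in _ --> X](subrr (0 : R)).
  pose K := C * (normal_peak s * (2 * s ^+ 2)).
  have K0 : 0 <= K.
    rewrite /K mulr_ge0// mulr_ge0 ?normal_peak_ge0//.
    by rewrite mulr_ge0// sqr_ge0.
  have psib (x : R) n : `|x| = n.+1%:R -> `|psi x| <= K * n.+1%:R^-1.
    move=> xn; have x0 : x != 0 by rewrite -normr_gt0 xn.
    rewrite /psi normrM (ger0_norm (normal_pdf_ge0 _ _ _)).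
    rewrite (le_trans (ler_pM _ _ (bP x) (normal_pdf_le x0)))// ?normal_pdf_ge0//.
    rewrite mulrA -/K ler_wpM2l//.
    rewrite -[X in X^-1 <= _]real_normK ?num_real// xn lef_pV2 ?posrE ?exprn_gt0//.
    by rewrite -[leLHS]expr1 ler_weXn2l// ler1n.
  have lim (e : nat -> R) : (forall n, `|e n| = n.+1%:R) -> psi (e n) @[n --> \oo] --> (0 : R).
    move=> en; apply/cvgr0Pnorm_le => eps eps0.
    have : K * n.+1%:R^-1 @[n --> \oo] --> K * 0.
      by apply: cvgM; [exact: cvg_cst|exact: cvg_harmonic].
    rewrite mulr0 => /cvgr0Pnorm_le/(_ _ eps0); apply: filterS => n.
    by apply: le_trans; rewrite (le_trans (psib _ _ (en n)))// ler_norm.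
  by apply: cvgB; apply: lim => n; rewrite ?normrN ger0_norm.
rewrite /Rintegral.
have -> : (\int[mu]_x (g x)%:E = 0)%E.
  apply: cvg_unique l1 _ => //.
  by rewrite (_ : (fun _ => _) = fun n => (psi n.+1%:R - psi (- n.+1%:R))%:E)//; apply/funext.
by [].
Qed.

End normal_integrals.

(** * Measurability of continuous functions of random matrices *)

Section measurable_countable_range.
Context {dT} {T : measurableType dT} (C : countType).

Lemma measurable_preimage_countable (Z : T -> C) (A : set C) :
  (forall c, measurable (Z @^-1` [set c])) -> measurable (Z @^-1` A).
Proof.
move=> mZ; rewrite (_ : _ @^-1` _ = \bigcup_n
    (if unpickle n is Some c then
       (if c \in A then Z @^-1` [set c] else set0) else set0)).
  apply: bigcupT_measurable => n.
  by case: unpickle => // c; case: ifP.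
apply/seteqP; split => [t /= At|t [n _]].
  by exists (pickle (Z t)) => //; rewrite pickleK mem_set.
by case: unpickle => // c; case: ifPn => // /set_mem Ac /= ->.
Qed.

End measurable_countable_range.

Section measurable_forall.
Context {dT} {T : measurableType dT}.

Lemma measurable_forall_fin (I : finType) (P : I -> T -> Prop) :
  (forall i, measurable [set t | P i t]) -> measurable [set t | forall i, P i t].
Proof.
move=> mP; rewrite (_ : [set _ | _] = \bigcap_(i in [set: I]) [set t | P i t]).
  by apply: fin_bigcap_measurable => //; exact: finite_finset.
by apply/seteqP; split => t /= H; [move=> i _|move=> i]; exact: H.
Qed.

End measurable_forall.

Section measurable_matrix.
Context {R : realType} {dT} {T : measurableType dT} (n m : nat).

Let disc k (x : R) : R := (Num.floor (x * k.+1%:R))%:~R / k.+1%:R.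

Let disc_cvg x : disc k x @[k --> \oo] --> x.
Proof.
apply: (@squeeze_cvgr _ _ _ _ (fun k => x - k.+1%:R^-1) (fun=> x)).
- apply: nearW => k; have /andP[f1 f2] := floor_itv (x * k.+1%:R).
  rewrite /disc ler_pdivrMr// f1 andbT ler_pdivlMr// mulrBl mulVf ?gt_eqF//.
  by rewrite lerBlDr ltW// (lt_le_trans f2)// intrD.
- rewrite -[X in _ --> X]subr0; apply: cvgB; first exact: cvg_cst.
  exact: cvg_harmonic.
- exact: cvg_cst.
Qed.

(** The entries are rounded down to multiples of 1 / (k + 1). The rounded matrix has countably many
    values, each taken on a measurable set, and continuity of [f] gives convergence as [k] grows. *)
Lemma measurable_continuous_mx (f : 'M[R]_(n, m) -> R) (X : T -> 'M[R]_(n, m)) :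
  continuous f -> (forall i j, measurable_fun setT (fun t => X t i j)) ->
  measurable_fun setT (fun t => f (X t)).
Proof.
move=> cf mX.
apply: (@measurable_fun_cvg _ _ _ setT
    (fun k t => f (\matrix_(i, j) disc k (X t i j)))); last first.
  move=> t _.
  apply: (cvg_comp (fun k => \matrix_(i, j) disc k (X t i j)) f); last exact: cf.
  apply: (@cvg_mx R) => i j; under eq_fun do rewrite mxE; exact: disc_cvg.
move=> k _ B mB; rewrite setTI.
pose Z t : 'M[int]_(n, m) := \matrix_(i, j) Num.floor (X t i j * k.+1%:R).
have -> : (fun t => f (\matrix_(i, j) disc k (X t i j))) @^-1` B =
    Z @^-1` [set z | B (f (\matrix_(i, j) ((z i j)%:~R / k.+1%:R)))].
  by apply/seteqP; split => t /=;
    rewrite (_ : \matrix_(i, j) disc k (X t i j) =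
      \matrix_(i, j) ((Z t i j)%:~R / k.+1%:R))//;
    apply/matrixP => i j; rewrite !mxE.
apply: measurable_preimage_countable => z.
rewrite (_ : _ @^-1` _ =
    [set t | forall ij : 'I_n * 'I_m, Num.floor (X t ij.1 ij.2 * k.+1%:R) = z ij.1 ij.2]).
  apply: measurable_forall_fin => -[i j] /=.
  rewrite (_ : [set _ | _] = (fun t => X t i j) @^-1`
      `[(z i j)%:~R / k.+1%:R, (z i j + 1)%:~R / k.+1%:R[%classic).
    by rewrite -[X in measurable X]setTI; exact: mX.
  apply/seteqP; split => t /=; rewrite in_itv/= ler_pdivrMr// ltr_pdivlMr//.
    by move=> <-; exact: floor_itv.
  exact: floor_def.
apply/seteqP; split => t /= H; first by move=> [i j]; rewrite -H mxE.
by apply/matrixP => i j; rewrite mxE (H (i, j)).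
Qed.

End measurable_matrix.

(** * Integrating out one of finitely many independent variables *)

Section independence.
Context {R : realType} {dO} {Om : measurableType dO} (P : probability Om R).
Variables (I : finType) (X : I -> Om -> R) (i0 : I).
Hypotheses (mX : forall i, measurable_fun setT (X i)) (iX : mutually_independent P X).

(* The events generated by the variables other than [X i0] *)
Definition other_rect : set (set Om) := [set C | exists2 B : I -> set R,
  forall i, measurable (B i) & C = [set om | forall i, i != i0 -> B i (X i om)]].

Definition other_type := g_sigma_algebraType other_rect.
HB.instance Definition _ := Measurable.on other_type.

Let other_rect_measurable : other_rect `<=` measurable.
Proof.
move=> _ [B mB ->].
apply: (@measurable_forall_fin _ _ I (fun i om => i != i0 -> B i (X i om))) => i; case: (eqVneq i i0) => ii0.
  by rewrite (_ : [set _ | _] = setT)//; apply/seteqP.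
rewrite (_ : [set _ | _] = X i @^-1` B i).
  by rewrite -[X in measurable X]setTI; exact: mX.
by apply/seteqP; split => om /=; [exact|].
Qed.

Let other_rect_setI : setI_closed other_rect.
Proof.
move=> _ _ [B mB ->] [C mC ->]; exists (fun i => B i `&` C i).
  by move=> i; exact: measurableI.
apply/seteqP; split => om /=.
  by move=> [HB HC] i ii0; split; [exact: HB|exact: HC].
by move=> H; split => i ii0; have [] := H i ii0.
Qed.

Let other_rectT : other_rect setT.
Proof. by exists (fun=> setT) => //; apply/seteqP. Qed.

Let prob_rect A C : measurable A -> other_rect C ->
  P (X i0 @^-1` A `&` C) = (P (X i0 @^-1` A) * P C)%E.
Proof.
move=> mA [B mB ->].
pose B' D i := if i == i0 then D else B i.
have mB' D : measurable D -> forall i, measurable (B' D i).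
  by move=> mD i; rewrite /B'; case: ifP.
have E D : measurable D -> P (X i0 @^-1` D `&`
      [set om | forall i, i != i0 -> B i (X i om)]) =
    (P (X i0 @^-1` D) * \prod_(i | i != i0) P [set om | B i (X i om)])%E.
  move=> mD; have := iX (mB' _ mD); rewrite (bigD1 i0)//= {2}/B' eqxx.
  under eq_bigr => i ii0 do rewrite /B' (negbTE ii0).
  move=> <-; congr (P _); apply/seteqP; split => om /=.
    move=> [DX BX] i; rewrite /B'; case: eqVneq => [->//|]; exact: BX.
  move=> H; split; first by have := H i0; rewrite /B' eqxx.
  by move=> i ii0; have := H i; rewrite /B' (negbTE ii0).
(* Taking the whole line for the event of [X i0] identifies the remaining product with the
   probability of the rectangle. *)
rewrite E//; congr (_ * _)%E; have := E setT measurableT.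
by rewrite preimage_setT setTI probability_setT mul1e.
Qed.

(** For fixed [A], both sides are finite measures in [C] that agree on the pi-system
    [other_rect]. *)
Lemma prob_other A C : measurable A -> <<s other_rect >> C ->
  P (X i0 @^-1` A `&` C) = (P (X i0 @^-1` A) * P C)%E.
Proof.
move=> mA sC.
have mXA : measurable (X i0 @^-1` A).
  by rewrite -[X in measurable X]setTI; exact: mX.
have PA : P (X i0 @^-1` A) \is a fin_num by exact: fin_num_measure.
have PA0 : 0 <= fine (P (X i0 @^-1` A)) by rewrite fine_ge0.
pose m1 : {measure set Om -> \bar R} := mrestr P mXA.
pose m2 : {measure set Om -> \bar R} := mscale (NngNum PA0) P.
have : m1 C = m2 C.
  apply: (@g_sigma_algebra_measure_unique _ _ _ _ other_rect_measurable (fun=> setT)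
    (fun=> other_rectT)) => //.
  - by apply/seteqP; split => // x _; exists 0%N.
  - move=> D GD; rewrite /m1 /m2 /= /mrestr /mscale /= fineK// setIC.
    exact: prob_rect.
  - by move=> _; rewrite /m1 /= /mrestr setTI -ge0_fin_numE.
by rewrite /m1 /m2 /= /mrestr /mscale /= fineK// setIC.
Qed.

Let idG (om : Om) : other_type := om.

Let mid : measurable_fun setT idG.
Proof.
apply: (@measurability _ _ Om other_type setT idG other_rect) => //.
by move=> _ [B GB <-]; rewrite setTI; exact: other_rect_measurable.
Qed.

(** The second component keeps the whole outcome, seen only through the sigma-algebra of the other
    variables. Any function of these variables is then a function of that component, and the law of
    [J] is a product measure. *)
Let J (om : Om) : measurableTypeR R * other_type := (X i0 om, idG om).

Let mJ : measurable_fun setT J.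
Proof. exact: (@measurable_fun_pair _ _ _ Om (measurableTypeR R) other_type _ _ (mX i0) mid). Qed.

Let PG := distribution P (mfun_Sub (mem_set mid)).
Let PJ := distribution P (mfun_Sub (mem_set mJ)).

Variable N : probability (measurableTypeR R) R.
Hypothesis XN : forall B : set R, measurable B -> P (X i0 @^-1` B) = N B.

Let PJE A : measurable A -> (N \x PG)%E A = PJ A.
Proof.
move=> mA; apply: (@product_measure_unique _ _ _ _ _ N PG PJ) => // B C mB mC.
transitivity (P (X i0 @^-1` B) * PG C)%E; first exact: prob_other.
by congr (_ * _)%E; exact: XN.
Qed.

Lemma integral_indep (f : measurableTypeR R * other_type -> R) : measurable_fun setT f ->
  P.-integrable setT (fun om => (f (X i0 om, om : other_type))%:E) ->
  (forall om, N.-integrable setT (fun x => (f (x, om))%:E)) ->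
  \int[P]_om f (X i0 om, om : other_type) = \int[PG]_om \int[N]_x f (x, om).
Proof.
move=> mf intf intfN; rewrite /Rintegral; congr fine.
have mEf : measurable_fun setT (EFin \o f) by exact/measurable_EFinP.
have E1 : (\int[P]_om (f (X i0 om, om : other_type))%:E = \int[PJ]_z (f z)%:E)%E.
  by rewrite (@integral_pushforward _ _ _ _ _ J mJ P setT (EFin \o f)).
have intJ : PJ.-integrable setT (EFin \o f).
  exact: (@integrable_pushforward _ _ _ _ _ J mJ P setT (EFin \o f)).
have int2 : (N \x PG)%E.-integrable setT (EFin \o f).
  apply/integrableP; split => //; move/integrableP : intJ => [_].
  rewrite (@eq_measure_integral _ _ _ setT (N \x PG)%E)// => A mA _.
  exact/esym/PJE.
rewrite E1 (@eq_measure_integral _ _ _ setT (N \x PG)%E); last first.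
  by move=> A mA _; exact/esym/PJE.
rewrite -integral21_prod_meas1//; apply: eq_integral => om _.
by rewrite /fubini_G fineK//; apply: integrable_fin_num.
Qed.

Lemma measurable_other i : i != i0 -> measurable_fun setT (X i : other_type -> R).
Proof.
move=> ii0 _ B mB; rewrite setTI; apply: sub_sigma_algebra.
exists (fun j => if j == i then B else setT); first by move=> j; case: ifP.
apply/seteqP; split => om /=; first by move=> Bi j ji0; case: eqP => // ->.
by move=> /(_ i ii0); rewrite eqxx.
Qed.

(** Transfers to [P] an identity that holds when [X i0] is integrated against its law [N] with the
    other variables frozen. *)
Lemma Rintegral_indep_eq (f g : measurableTypeR R * other_type -> R) :
  measurable_fun setT f -> measurable_fun setT g ->
  P.-integrable setT (fun om => (f (X i0 om, om : other_type))%:E) ->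
  P.-integrable setT (fun om => (g (X i0 om, om : other_type))%:E) ->
  (forall om, N.-integrable setT (fun x => (f (x, om))%:E)) ->
  (forall om, N.-integrable setT (fun x => (g (x, om))%:E)) ->
  (forall om, \int[N]_x f (x, om) = \int[N]_x g (x, om)) ->
  \int[P]_om f (X i0 om, om : other_type) = \int[P]_om g (X i0 om, om : other_type).
Proof.
move=> mf mg intf intg iNf iNg fg; rewrite (integral_indep mf intf iNf) (integral_indep mg intg iNg).
by congr Rintegral; apply/funext.
Qed.

End independence.

(** * Stein's identity for one Gaussian variable among independent ones *)

Section stein_independent.
Context {R : realType} {dO} {Om : measurableType dO} (P : probability Om R).
Variables (I : finType) (X : I -> Om -> R) (i0 : I) (s : R).
Hypotheses (mX : forall i, measurable_fun setT (X i)) (iX : mutually_independent P X).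
Hypotheses (s_gt0 : 0 < s)
  (XN : forall B : set R, measurable B -> P (X i0 @^-1` B) = normal_prob 0 s B).
Local Notation N := (normal_prob 0 s).
Local Notation OT := (other_type X i0).

Let ge0_law (f : R -> \bar R) : measurable_fun setT f -> (forall x, 0 <= f x)%E ->
  (\int[P]_om f (X i0 om) = \int[N]_x f x)%E.
Proof.
move=> mf f0.
pose X0 : {mfun Om >-> measurableTypeR R} :=
  @mfun_Sub _ _ Om (measurableTypeR R) (X i0) (mem_set (mX i0)).
transitivity (\int[distribution P X0]_x f x)%E.
  apply/esym; apply: (@ge0_integral_pushforward _ _ Om (measurableTypeR R) R X0 (mX i0) P setT f) => //.
by apply: eq_measure_integral => A mA _; exact: XN.
Qed.

Lemma gaussian_sqr_le : (\int[P]_om (X i0 om ^+ 2)%:E <= (8 * s ^+ 2)%:E)%E.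
Proof.
rewrite (ge0_law (f := fun x => (x ^+ 2)%:E)); first exact: integral_normal_prob_sqr.
  by apply/measurable_EFinP; exact: exprn_measurable.
by move=> x; rewrite lee_fin sqr_ge0.
Qed.

Lemma gaussian_sqr_integrable : P.-integrable setT (fun om => (X i0 om ^+ 2)%:E).
Proof.
apply/integrableP; split.
  by apply/measurable_EFinP; apply: measurable_funX; exact: mX.
under eq_integral do rewrite gee0_abs ?lee_fin ?sqr_ge0//.
exact: le_lt_trans gaussian_sqr_le (ltry _).
Qed.

Lemma gaussian_integrable : P.-integrable setT (EFin \o X i0).
Proof.
have := integrableD measurableT (finite_measure_integrable_cst P 1 measurableT)
  gaussian_sqr_integrable.
apply: le_integrable => //; first exact/measurable_EFinP.
move=> x _ /=; rewrite lee_fin [leRHS]ger0_norm; last by rewrite addr_ge0 ?sqr_ge0.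
rewrite -[X i0 x ^+ 2]real_normK ?num_real//; move: (`|X i0 x|) => {}x; nra.
Qed.

Lemma gaussian_orthogonal (Z : Om -> R) : measurable_fun setT (Z : OT -> R) ->
  P.-integrable setT (fun om => (X i0 om * Z om)%:E) ->
  \int[P]_om (X i0 om * Z om) = 0.
Proof.
move=> mZ iZ.
have m1 : measurable_fun [set: measurableTypeR R * OT]
    (fun z : measurableTypeR R * OT => z.1 * Z z.2).
  apply: measurable_funM; first exact: measurable_fst.
  by apply: measurableT_comp mZ _; exact: measurable_snd.
have iN om : N.-integrable setT (fun x => (x * Z om)%:E).
  have := integrableZr measurableT (Z om) (integrable_normal_prob_id s_gt0).
  exact: eq_integrable.
rewrite (Rintegral_indep_eq mX iX XN (f := fun z => z.1 * Z z.2) (g := fun=> 0))//.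
- by rewrite /Rintegral integral0.
- exact: integrable0.
- by move=> om; exact: integrable0.
- move=> om /=; rewrite /Rintegral integral0 -/(Rintegral _ _ _).
  rewrite RintegralZr//; last exact: integrable_normal_prob_id.
  (* Stein's identity for the constant function 1 says that the mean is 0. *)
  have := @normal_prob_stein R s s_gt0 (fun=> 1) (fun=> 0) 1.
  under eq_Rintegral do rewrite mulr1.
  move=> ->; rewrite ?/Rintegral ?integral0 ?mulr0 ?mul0r//.
  + exact: continuous_funC.
  + by move=> _; rewrite normr1.
  + by move=> _; rewrite normr0.
Qed.

(** With [Y] frozen, this is the one-dimensional Stein identity for x |-> phi (x u + Y), whose
    derivative is the derivative of [phi] along [u]. *)
Lemma gaussian_ibp (n d : nat) (phi : 'M[R]_(n, d) -> R) (Y : Om -> 'M[R]_(n, d))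
    (u : 'M[R]_(n, d)) : smooth_cb phi ->
  (forall i k, measurable_fun setT (fun om : OT => Y om i k)) ->
  \int[P]_om (X i0 om * phi (X i0 om *: u + Y om)) =
  s ^+ 2 * \int[P]_om \sum_i \sum_k u i k * partial phi (i, k) (X i0 om *: u + Y om).
Proof.
move=> sphi mY.
pose dphi x := \sum_i \sum_k u i k * partial phi (i, k) x.
have sdphi : CbS 0 dphi.
  apply: CbS_sum => i; apply: CbS_sum => k; apply: CbSM; first exact: CbS_cst.
  exact: smooth_cb_partial sphi 0%N.
have [C phiC] := CbS_bounded (sphi 0%N).
have [D dphiD] := CbS_bounded sdphi.
have cphi := CbS_continuous (sphi 0%N); have cdphi := CbS_continuous sdphi.
pose L (z : measurableTypeR R * OT) := z.1 *: u + Y z.2.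
have mL (f : 'M[R]_(n, d) -> R) : continuous f ->
    measurable_fun [set: measurableTypeR R * OT] (fun z => f (L z)).
  move=> cf; apply: measurable_continuous_mx cf _ => i k.
  rewrite /L; under eq_fun do rewrite !mxE.
  apply: measurable_funD; last by apply: measurableT_comp (mY i k) _; exact: measurable_snd.
  by apply: measurable_funM => //; exact: measurable_fst.
have mYP i k : measurable_fun setT (fun om : Om => Y om i k).
  have mid : measurable_fun [set: Om] (fun om : Om => om : OT).
    apply: (@measurability _ _ Om OT setT (fun om => om) (other_rect X i0)) => //.
    move=> _ [_ [B mB ->] <-]; rewrite setTI.
    apply: (@measurable_forall_fin _ _ I (fun i om => i != i0 -> B i (X i om))) => j.
    case: (eqVneq j i0) => ji0; first by rewrite (_ : [set _ | _] = setT)//; apply/seteqP.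
    rewrite (_ : [set _ | _] = X j @^-1` B j).
      by rewrite -[X in measurable X]setTI; exact: mX.
    by apply/seteqP; split => om /=; [exact|].
  exact: (measurableT_comp (mY i k) mid).
have mLP (f : 'M[R]_(n, d) -> R) : continuous f ->
    measurable_fun setT (fun om => f (X i0 om *: u + Y om)).
  move=> cf; apply: measurable_continuous_mx cf _ => i k.
  under eq_fun do rewrite !mxE.
  by apply: measurable_funD => //; exact: measurable_funM.
have mLN (f : 'M[R]_(n, d) -> R) om : continuous f ->
    measurable_fun setT (fun x : R => f (x *: u + Y om)).
  move=> cf; apply: measurable_continuous_mx cf _ => i k.
  under eq_fun do rewrite !mxE.
  by apply: measurable_funD => //; exact: measurable_funM.
have bdd (g : R) (a b : R) : `|b| <= g -> `|a * b| <= `|g * a|.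
  by move=> bg; rewrite !normrM mulrC ler_wpM2r// (le_trans bg)// ler_norm.
have mXphi : measurable_fun setT (fun om => X i0 om * phi (X i0 om *: u + Y om)).
  by apply: measurable_funM; [exact: mX|exact: (mLP _ cphi)].
have msdphi : measurable_fun setT (fun om => s ^+ 2 * dphi (X i0 om *: u + Y om)).
  by apply: measurable_funM; [exact: measurable_cst|exact: (mLP _ cdphi)].
have mxphi om : measurable_fun setT (fun x : R => x * phi (x *: u + Y om)).
  by apply: measurable_funM; [exact: measurable_id|exact: (mLN _ om cphi)].
have mxdphi om : measurable_fun setT (fun x : R => s ^+ 2 * dphi (x *: u + Y om)).
  by apply: measurable_funM; [exact: measurable_cst|exact: (mLN _ om cdphi)].
rewrite -RintegralZl//; last first.
  apply: (le_integrable _ _ _ (finite_measure_integrable_cst P D measurableT)) => //.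
    by apply/measurable_EFinP; exact: (mLP _ cdphi).
  by move=> om _ /=; rewrite lee_fin (le_trans (dphiD _))// ler_norm.
apply: (Rintegral_indep_eq mX iX XN (f := fun z => z.1 * phi (L z))
  (g := fun z => s ^+ 2 * dphi (L z))).
- by apply: measurable_funM; [exact: measurable_fst|exact: mL].
- by apply: measurable_funM => //; exact: mL.
- have := integrableZl measurableT C gaussian_integrable.
  apply: le_integrable => //.
    by apply/measurable_EFinP; exact: mXphi.
  by move=> om _ /=; rewrite lee_fin bdd.
- have := finite_measure_integrable_cst P (D * s ^+ 2) measurableT.
  apply: le_integrable => //.
    by apply/measurable_EFinP; exact: msdphi.
  by move=> om _ /=; rewrite lee_fin bdd.
- move=> om; have := integrableZl measurableT C (integrable_normal_prob_id s_gt0).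
  apply: le_integrable => //.
    by apply/measurable_EFinP; exact: (mxphi om).
  by move=> x _ /=; rewrite lee_fin bdd.
- move=> om; have := finite_measure_integrable_cst N (D * s ^+ 2) measurableT.
  apply: le_integrable => //.
    by apply/measurable_EFinP; exact: (mxdphi om).
  by move=> x _ /=; rewrite lee_fin bdd.
- move=> om; rewrite /L/=.
  have dphi1 (x : R) : is_derive x 1 (fun x => phi (x *: u + Y om)) (dphi (x *: u + Y om)).
    exact: ((@is_derive_lineP _ _ phi (Y om) u x _).1 (smooth_cb_is_derive _ _ sphi)).
  have cdphi1 : continuous (fun x : R => dphi (x *: u + Y om)).
    move=> x; apply: (@continuous_comp _ _ _ (fun x : R => x *: u + Y om) dphi).
      apply: (@cvg_mx R) => i k; under eq_fun do rewrite !mxE; rewrite !mxE.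
      by apply: cvgD; [apply: cvgM; [exact: cvg_id|exact: cvg_cst]|exact: cvg_cst].
    exact: cdphi.
  rewrite (normal_prob_stein s_gt0 dphi1 cdphi1 (C := Num.max C D)).
  + rewrite RintegralZl//.
    have := finite_measure_integrable_cst N D measurableT.
    apply: le_integrable => //; first by apply/measurable_EFinP; exact: (mLN _ om cdphi).
    by move=> x _ /=; rewrite lee_fin (le_trans (dphiD _))// ler_norm.
  + by move=> x; rewrite le_max phiC.
  + by move=> x; rewrite le_max dphiD orbT.
Qed.

End stein_independent.

Section Rintegral_sums.
Context {R : realType} {dT} {T : measurableType dT} (m : {measure set T -> \bar R}).

Lemma integrable_sumR (I : Type) (s : seq I) (f : I -> T -> R) :
  (forall i, m.-integrable setT (EFin \o f i)) ->
  m.-integrable setT (EFin \o (fun x => \sum_(i <- s) f i x)).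
Proof.
move=> intf; have := integrable_sum measurableT s (P := xpredT) (fun i _ => intf i).
by apply: eq_integrable => // x _ /=; rewrite sumEFin.
Qed.

Lemma Rintegral_sumR (I : Type) (s : seq I) (f : I -> T -> R) :
  (forall i, m.-integrable setT (EFin \o f i)) ->
  \int[m]_x (\sum_(i <- s) f i x) = \sum_(i <- s) \int[m]_x f i x.
Proof.
move=> intf; elim: s => [|i s ih].
  rewrite big_nil; under eq_Rintegral do rewrite big_nil.
  by rewrite /Rintegral integral0.
rewrite big_cons -ih -RintegralD//; last exact: integrable_sumR.
by apply: eq_Rintegral => x _; rewrite big_cons.
Qed.

Lemma integrableZlR (c : R) (f : T -> R) : m.-integrable setT (EFin \o f) ->
  m.-integrable setT (EFin \o (fun x => c * f x)).
Proof. by move=> /(integrableZl measurableT c). Qed.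

Lemma integrable_mulR (f g : T -> R) : measurable_fun setT f -> measurable_fun setT g ->
  m.-integrable setT (fun x => (f x ^+ 2)%:E) ->
  m.-integrable setT (fun x => (g x ^+ 2)%:E) ->
  m.-integrable setT (EFin \o (fun x => f x * g x)).
Proof.
move=> mf mg intf intg; have := integrableD measurableT intf intg.
apply: le_integrable => //; first by apply/measurable_EFinP; exact: measurable_funM.
move=> x _ /=; rewrite lee_fin [leRHS]ger0_norm; last by rewrite addr_ge0 ?sqr_ge0.
rewrite normrM -[f x ^+ 2]real_normK ?num_real// -[g x ^+ 2]real_normK ?num_real//.
move: (`|f x|) (`|g x|) => a b; nra.
Qed.

(** Integrates (dl |f| - |g|)^2 >= 0. The free parameter [dl] plays the role of Cauchy-Schwarz: it
    is chosen small once one factor is known to be bounded, and the other factor must then be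
    small. *)
Lemma Rintegral_young (f g : T -> R) (dl : R) : 0 < dl ->
  measurable_fun setT f -> measurable_fun setT g ->
  m.-integrable setT (fun x => (f x ^+ 2)%:E) ->
  m.-integrable setT (fun x => (g x ^+ 2)%:E) ->
  `|\int[m]_x (f x * g x)| <=
    dl / 2 * \int[m]_x (f x ^+ 2) + (2 * dl)^-1 * \int[m]_x (g x ^+ 2).
Proof.
move=> dl0 mf mg intf intg.
have ifg := integrable_mulR mf mg intf intg.
rewrite (le_trans (le_normr_Rintegral _ ifg))//.
rewrite -!RintegralZl// -RintegralD//; [|exact: integrableZlR|exact: integrableZlR].
apply: le_Rintegral => //.
- exact: (integrable_norm ifg).
- have := integrableD measurableT (integrableZlR (dl / 2) intf) (integrableZlR (2 * dl)^-1 intg).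
  by apply: eq_integrable.
move=> x _; rewrite normrM.
rewrite -[f x ^+ 2]real_normK ?num_real// -[g x ^+ 2]real_normK ?num_real//.
move: (`|f x|) (`|g x|) => a b.
rewrite -subr_ge0.
rewrite (_ : _ - _ = (dl * a - b) ^+ 2 / (2 * dl)).
  by rewrite divr_ge0 ?sqr_ge0// mulr_ge0// ltW.
by field; rewrite gt_eqF.
Qed.

End Rintegral_sums.

(** * Integration by parts along Brownian paths *)

Section brownian_ibp.
Context {R : realType} (d : nat) (M : \bar R) (mu : probability (wpath d M) R).
Hypothesis bm : brownian_motion mu (fun w : wpath d M => w).
Variables (n : nat) (phi : 'M[R]_(n, d) -> R) (r : 'I_n -> R).
Variables (beta : R -> R) (c a : R) (k : 'I_d).
Hypotheses (sphi : smooth_cb phi) (r_ge0 : forall i, 0 <= r i) (a_ge0 : 0 <= a)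
  (beta0 : beta 0 = 0)
  (beta_lip : forall x y, 0 <= x -> x <= y ->
    `|beta y - beta x| <= c * (Num.min y a - Num.min x a)).

(** Beyond [M] a path is extended by 0, so an invalid time gives a row that is identically 0 and
    takes no part in the differentiation. *)
Let valid i := `[< time_dom M (r i) >].
Let X (w : wpath d M) : 'M[R]_(n, d) := \matrix_(i < n) w (r i).
Let b i := if valid i then beta (r i) else 0.

(* [s] lists the distinct times; the increments over its intervals are the
   independent Gaussian coordinates *)
Let s := sort <=%R (undup (0 :: [seq r i | i <- enum 'I_n & valid i])).
Let rho j := nth 0 s j.
Let N := (size s).-1.
Let pr i := index (r i) s.

Let s_0 : 0 \in s. Proof. by rewrite mem_sort mem_undup inE eqxx. Qed.

Let mem_s x : x \in s -> x = 0 \/ exists2 i, valid i & x = r i.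
Proof.
rewrite mem_sort mem_undup inE => /predU1P[->|]; first by left.
by move=> /mapP[i]; rewrite mem_filter => /andP[vi _] ->; right; exists i.
Qed.

Let s_r i : valid i -> r i \in s.
Proof.
move=> vi; rewrite mem_sort mem_undup inE; apply/orP; right.
by apply/mapP; exists i => //; rewrite mem_filter vi mem_enum.
Qed.

Let s_sorted : sorted <%R s.
Proof. by rewrite sort_lt_sorted undup_uniq. Qed.

Let size_s : size s = N.+1.
Proof. by rewrite /N prednK// (leq_ltn_trans (leq0n (index 0 s)))// index_mem. Qed.

Let rho_mem j : (j <= N)%N -> rho j \in s.
Proof. by move=> jN; apply: mem_nth; rewrite size_s ltnS. Qed.

Let rho_ge0 j : (j <= N)%N -> 0 <= rho j.
Proof. by move=> /rho_mem/mem_s[->//|[i _ ->]]. Qed.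

Let rho_lt j : (j < N)%N -> rho j < rho j.+1.
Proof.
move=> jN; apply: (sorted_ltn_nth lt_trans 0 s_sorted) => //;
  by rewrite inE size_s ltnS // ltnW.
Qed.

Let rho_00 : rho 0 = 0.
Proof.
have [//|i0] := eqVneq (index 0 s) 0%N => [e|]; first by rewrite /rho -e nth_index.
have : rho 0 < nth 0 s (index 0 s).
  apply: (sorted_ltn_nth lt_trans 0 s_sorted); rewrite ?inE ?size_s ?ltnS//.
    by rewrite -ltnS -size_s index_mem.
  by rewrite lt0n.
by rewrite nth_index// => /lt_geF; rewrite rho_ge0.
Qed.

Let pr_le i : valid i -> (pr i <= N)%N.
Proof. by move=> /s_r; rewrite -index_mem size_s ltnS. Qed.

Let rho_pr i : valid i -> rho (pr i) = r i.
Proof. by move=> /s_r; exact: nth_index. Qed.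

Hypothesis dom0 : time_dom M 0.

Let part : partition_of M N rho.
Proof.
split=> // j /rho_mem/mem_s[->//|[i /asboolP vi ->]]//.
Qed.

Let xi (ml : 'I_N * 'I_d) (w : wpath d M) : R :=
  w (rho ml.1.+1) ord0 ml.2 - w (rho ml.1) ord0 ml.2.

Let mxi ml : measurable_fun setT (xi ml).
Proof. by apply: measurable_funB; exact: measurable_wcoord. Qed.

Let ixi : mutually_independent mu xi := bm_indep_incr bm part.

Let Dl (m : 'I_N) := rho m.+1 - rho m.

Let Dl_gt0 m : 0 < Dl m. Proof. by rewrite subr_gt0 rho_lt. Qed.

Let sd m := Num.sqrt (Dl m).
Let sd_gt0 m : 0 < sd m. Proof. by rewrite sqrtr_gt0. Qed.
Let sd_sqr m : sd m ^+ 2 = Dl m. Proof. by rewrite sqr_sqrtr// ltW. Qed.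

Let xiN ml (B : set R) : measurable B ->
  mu (xi ml @^-1` B) = normal_prob 0 (sd ml.1) B.
Proof.
move=> mB; apply: (bm_gauss_incr bm) => //.
- by case: part => H _; apply: H; rewrite ltnW.
- by case: part => H _; apply: H.
- exact: rho_lt.
Qed.

Let w_r (w : wpath d M) i l : valid i ->
  w (r i) ord0 l = \sum_(m < N | (m < pr i)%N) xi (m, l) w.
Proof.
move=> vi; have rpi := rho_pr vi.
rewrite -(@big_ord_widen _ _ _ _ N (fun m => w (rho m.+1) ord0 l - w (rho m) ord0 l) (pr_le vi)).
rewrite -(big_mkord xpredT (fun m => w (rho m.+1) ord0 l - w (rho m) ord0 l)).
rewrite (telescope_sumr (fun m => w (rho m) ord0 l))// rpi rho_00.
by have [-> _ _] := wpathP w; rewrite mxE subr0.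
Qed.

Let b_sum i : b i = \sum_(m < N | valid i && (m < pr i)%N) (beta (rho m.+1) - beta (rho m)).
Proof.
rewrite /b; case: ifPn => vi; last by rewrite big_pred0.
rewrite -(@big_ord_widen _ _ _ _ N (fun m => beta (rho m.+1) - beta (rho m)) (pr_le vi)).
rewrite -(big_mkord xpredT (fun m => beta (rho m.+1) - beta (rho m))).
by rewrite (telescope_sumr (fun m => beta (rho m)))// rho_pr// rho_00 beta0 subr0.
Qed.

(** The direction in which the increment of coordinate [k] over the [m]-th interval moves the matrix
    [X]: the rows whose time comes after that interval. The remainder [Y m] involves only the other
    increments. *)
Let u (m : 'I_N) : 'M[R]_(n, d) :=
  \matrix_(i, l) ([&& valid i, (m < pr i)%N & l == k])%:R.

Let Y m w := X w - xi (m, k) w *: u m.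

Let XE m w : X w = xi (m, k) w *: u m + Y m w.
Proof. by rewrite /Y addrC subrK. Qed.

Let Y_entry m w i l : Y m w i l =
  if valid i then \sum_(m' < N | (m' < pr i)%N && ((m', l) != (m, k))) xi (m', l) w
  else 0.
Proof.
rewrite !mxE; case: ifPn => vi /=; last first.
  rewrite mulr0 subr0; have [_ _ ->] := wpathP w; first by rewrite mxE.
  by move=> /asboolP; apply/negP.
rewrite (w_r _ _ vi); case: (boolP ((m < pr i)%N && (l == k))) => [/andP[mi /eqP ->]|].
  rewrite mulr1 (bigD1 m)//= addrAC subrr add0r.
  by apply: eq_bigl => m'; rewrite xpair_eqE eqxx andbT.
move=> H; rewrite mulr0 subr0; apply: eq_bigl => m'.
rewrite xpair_eqE; case: (boolP (m' < pr i)%N) => //= m'i.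
by apply/esym; apply: contra H => /andP[/eqP <- ->]; rewrite m'i.
Qed.

Let mY m i l : measurable_fun setT
  (fun w : other_type xi (m, k) => Y m w i l).
Proof.
rewrite (funext (fun w => Y_entry m w i l)).
case: (valid i); last exact: measurable_cst.
under eq_fun do rewrite big_mkcond/=.
apply: measurable_sum => m'.
case: (boolP ((m' < pr i)%N && ((m', l) != (m, k)))) => [/andP[_ H]|_];
  last exact: measurable_cst.
exact: measurable_other.
Qed.

Let mX (f : 'M[R]_(n, d) -> R) : continuous f -> measurable_fun setT (fun w => f (X w)).
Proof.
move=> cf; apply: (measurable_continuous_mx cf) => i l.
by under eq_fun do rewrite mxE; exact: measurable_wcoord.
Qed.

Let G i w := partial phi (i, k) (X w).

Let bounded_int (f : 'M[R]_(n, d) -> R) : continuous f -> bounded f ->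
  mu.-integrable setT (EFin \o (fun w => f (X w))).
Proof.
move=> cf [C fC]; have := finite_measure_integrable_cst mu C measurableT.
apply: le_integrable => //; first by apply/measurable_EFinP; exact: (mX cf).
by move=> w _ /=; rewrite lee_fin (le_trans (fC _))// ler_norm.
Qed.

Let iG i : mu.-integrable setT (EFin \o G i).
Proof.
have sp := smooth_cb_partial (i, k) sphi 0%N.
exact: bounded_int (CbS_continuous sp) (CbS_bounded sp).
Qed.

Let cphi := CbS_continuous (sphi 0%N).

Let iphi2 : mu.-integrable setT (fun w => (phi (X w) ^+ 2)%:E).
Proof.
apply: (bounded_int (f := fun x => phi x ^+ 2)).
  by move=> x; apply: (continuous_funM cphi cphi).
exact: (boundedM (CbS_bounded (sphi 0%N)) (CbS_bounded (sphi 0%N))).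
Qed.

Let xi_sqr ml : (\int[mu]_w (xi ml w ^+ 2)%:E <= (8 * Dl ml.1)%:E)%E.
Proof. by rewrite -sd_sqr; apply: gaussian_sqr_le mxi (sd_gt0 _) (@xiN ml). Qed.

Let ixi2 ml : mu.-integrable setT (fun w => (xi ml w ^+ 2)%:E).
Proof. exact: gaussian_sqr_integrable mxi (sd_gt0 ml.1) (@xiN ml). Qed.

Let stein m : \int[mu]_w (xi (m, k) w * phi (X w)) =
  Dl m * \int[mu]_w \sum_(i < n) (valid i && (m < pr i)%N)%:R * G i w.
Proof.
have := gaussian_ibp mxi ixi (sd_gt0 m) (@xiN (m, k)) (u m) sphi (@mY m).
rewrite sd_sqr.
under eq_Rintegral do rewrite -XE.
move=> ->; congr (_ * _); apply: eq_Rintegral => w _; apply: eq_bigr => i _.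
rewrite -XE (bigD1 k)//= big1 ?addr0; last first.
  by move=> l /negbTE lk; rewrite mxE lk !andbF mul0r.
by rewrite mxE eqxx andbT.
Qed.

(** The mean slope of [beta] on the [m]-th interval. Thus [J] below is a discrete Wiener integral of
    the derivative of [beta]. *)
Let cf (m : 'I_N) := (beta (rho m.+1) - beta (rho m)) / Dl m.

Let J w := \sum_(m < N) cf m * xi (m, k) w.

Let mJ : measurable_fun setT J.
Proof.
by apply: measurable_sum => m; apply: measurable_funM => //; exact: mxi.
Qed.

Let Da (m : 'I_N) := Num.min (rho m.+1) a - Num.min (rho m) a.

(** The map x |-> min x a is 1-Lipschitz, so Da <= Dl and one factor Da^2 / Dl is at most Da. The 8
    is the constant of the Gaussian second moment bound. *)
Let cf_le m : cf m ^+ 2 * (8 * Dl m) <= 8 * c ^+ 2 * Da m.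
Proof.
have H : `|beta (rho m.+1) - beta (rho m)| <= c * Da m.
  by apply: beta_lip; [exact/rho_ge0/ltnW|exact/ltW/rho_lt].
have Da0 : 0 <= Da m by rewrite subr_ge0 le_min2//; exact/ltW/rho_lt.
have DaDl : Da m <= Dl m.
  rewrite /Da /Dl /Num.min; have := rho_lt (ltn_ord m).
  by case: ifP => ?; case: ifP => ?; lra.
have D0 := Dl_gt0 m; rewrite /cf expr_div_n.
have H2 : (beta (rho m.+1) - beta (rho m)) ^+ 2 <= c ^+ 2 * Da m ^+ 2.
  rewrite -exprMn -[leLHS]real_normK ?num_real// lerXn2r// nnegrE//.
  exact: le_trans H.
rewrite (_ : _ * _ = 8 * (beta (rho m.+1) - beta (rho m)) ^+ 2 / Dl m); last first.
  by field; rewrite gt_eqF.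
rewrite ler_pdivrMr// (_ : 8 * c ^+ 2 * _ * _ = 8 * (c ^+ 2 * (Da m * Dl m))); last by ring.
rewrite ler_pM2l//; apply: le_trans H2 _.
by apply: ler_wpM2l; [exact: sqr_ge0|rewrite expr2 ler_wpM2l].
Qed.

Let ixx ml ml' : mu.-integrable setT (EFin \o (fun w => xi ml w * xi ml' w)).
Proof. exact: integrable_mulR (mxi _) (mxi _) (ixi2 _) (ixi2 _). Qed.

Let J2E w : J w ^+ 2 = \sum_(m < N) \sum_(m' < N)
  (cf m * cf m') * (xi (m, k) w * xi (m', k) w).
Proof.
rewrite expr2 /J mulr_suml; apply: eq_bigr => m _; rewrite mulr_sumr.
by apply: eq_bigr => m' _; ring.
Qed.

Let iJ2 : mu.-integrable setT (fun w => (J w ^+ 2)%:E).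
Proof.
have : mu.-integrable setT (EFin \o (fun w => \sum_(m < N) \sum_(m' < N)
    (cf m * cf m') * (xi (m, k) w * xi (m', k) w))).
  by apply: integrable_sumR => m; apply: integrable_sumR => m'; exact: integrableZlR.
by apply: eq_integrable => // w _; rewrite /= J2E.
Qed.

(** Distinct increments are orthogonal, so only the diagonal remains, and the bounds by [Da m]
    telescope to the minimum of the last time and [a]. The result depends neither on the times nor
    on their number. *)
Let J2_le : \int[mu]_w (J w ^+ 2) <= 8 * c ^+ 2 * a.
Proof.
under eq_Rintegral do rewrite J2E.
rewrite Rintegral_sumR; last first.
  by move=> m; apply: integrable_sumR => m'; exact: integrableZlR.
apply: (@le_trans _ _ (\sum_(m < N) 8 * c ^+ 2 * Da m)).
  apply: ler_sum => m _; rewrite Rintegral_sumR; last by move=> m'; exact: integrableZlR.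
  rewrite (bigD1 m)//= big1 ?addr0; last first.
    move=> m' m'm; rewrite RintegralZl//.
    rewrite (gaussian_orthogonal mxi ixi (sd_gt0 m) (@xiN (m, k)) (Z := xi (m', k))) ?mulr0//.
      by apply: measurable_other; rewrite xpair_eqE (negbTE m'm).
    exact: ixx.
  rewrite RintegralZl// -expr2 mulrAC.
  rewrite mulrC; under eq_Rintegral do rewrite -expr2.
  rewrite mulrA -expr2; apply: le_trans (cf_le m); apply: ler_wpM2l; first exact: sqr_ge0.
  rewrite -lee_fin /Rintegral fineK; first exact: (xi_sqr (m, k)).
  exact: integrable_fin_num (ixi2 _).
rewrite -mulr_sumr; apply: ler_wpM2l; first by rewrite mulr_ge0// sqr_ge0.
rewrite -(big_mkord xpredT (fun m => Num.min (rho m.+1) a - Num.min (rho m) a)).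
rewrite (telescope_sumr (fun m => Num.min (rho m) a))// rho_00.
by rewrite (min_l a_ge0) subr0 ge_min lexx orbT.
Qed.

(** Each [b i] is the sum of the increments of [beta] up to [r i]. After exchanging the sums, every
    interval contributes Stein's identity with coefficient [cf m], since [cf m * Dl m] is the
    increment of [beta]. *)
Let ibp_sum : \int[mu]_w (\sum_(i < n) b i * G i w) = \int[mu]_w (J w * phi (X w)).
Proof.
have ixphi m : mu.-integrable setT (EFin \o (fun w => xi (m, k) w * phi (X w))).
  exact: integrable_mulR (mxi _) (mX cphi) (ixi2 _) iphi2.
transitivity (\sum_(m < N) cf m * \int[mu]_w (xi (m, k) w * phi (X w))); last first.
  under eq_bigr do rewrite -RintegralZl//.
  rewrite -Rintegral_sumR; last by move=> m; exact: integrableZlR.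
  by apply: eq_Rintegral => w _; rewrite /J mulr_suml; apply: eq_bigr => m _; ring.
under [RHS]eq_bigr => m _.
  rewrite stein mulrA /cf divfK ?gt_eqF// -RintegralZl//; last first.
    by apply: integrable_sumR => i; exact: integrableZlR.
  over.
rewrite -Rintegral_sumR; last first.
  move=> m; apply: integrableZlR; apply: integrable_sumR => i; exact: integrableZlR.
apply: eq_Rintegral => w _.
under [RHS]eq_bigr do rewrite mulr_sumr.
rewrite exchange_big/=; apply: eq_bigr => i _.
rewrite b_sum mulr_suml big_mkcond/=; apply: eq_bigr => m _.
by case: ifP => _; rewrite ?mul1r ?mul0r ?mulr0.
Qed.

Lemma brownian_ibp_dom dl : 0 < dl ->
  `|\int[mu]_w (\sum_(i < n) b i * G i w)| <=
    dl * (4 * c ^+ 2 * a) + (2 * dl)^-1 * \int[mu]_w (phi (X w) ^+ 2).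
Proof.
move=> dl0; rewrite ibp_sum.
rewrite (le_trans (Rintegral_young dl0 mJ (mX cphi) iJ2 iphi2))// lerD2r.
rewrite (_ : dl * (4 * c ^+ 2 * a) = dl / 2 * (8 * c ^+ 2 * a)); last by field.
have d2 : 0 <= dl / 2 by rewrite divr_ge0// ltW.
exact: (ler_wpM2l d2 J2_le).
Qed.

End brownian_ibp.

(** The function [beta] enters only through [c] and [a], and the times [r] only through the last
    integral. This makes the estimate uniform over the cylinder functions and over the time changes
    with bounded values. *)
Lemma brownian_ibp {R : realType} (d : nat) (M : \bar R) (mu : probability (wpath d M) R)
    (n : nat) (phi : 'M[R]_(n, d) -> R) (r : 'I_n -> R)
    (beta : R -> R) (c a : R) (k : 'I_d) (dl : R) :
  brownian_motion mu (fun w : wpath d M => w) ->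
  smooth_cb phi -> (forall i, 0 <= r i) -> 0 <= a -> beta 0 = 0 ->
  (forall x y, 0 <= x -> x <= y ->
    `|beta y - beta x| <= c * (Num.min y a - Num.min x a)) ->
  0 < dl ->
  `|\int[mu]_w (\sum_(i < n) (if `[< time_dom M (r i) >] then beta (r i) else 0) *
      partial phi (i, k) (\matrix_(i < n) (w : wpath d M) (r i)))| <=
    dl * (4 * c ^+ 2 * a) +
    (2 * dl)^-1 * \int[mu]_w (phi (\matrix_(i < n) (w : wpath d M) (r i)) ^+ 2).
Proof.
move=> bm sphi r0 a0 b0 blip dl0.
have [d0|d0] := pselect (time_dom M (0 : R)).
  exact: (brownian_ibp_dom bm k sphi r0 a0 b0 blip d0 dl0).
(* If 0 is outside the time domain then so is every [r i], and the integrand vanishes. *)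
rewrite (_ : \int[mu]_w _ = 0); last first.
  rewrite /Rintegral (eq_integral (cst 0%E)) ?integral0// => w _.
  rewrite big1// => i _; case: asboolP; rewrite ?mul0r// => -[r0i riM].
  by exfalso; apply: d0; split => //; apply: le_trans riM; rewrite lee_fin.
rewrite normr0 addr_ge0//.
  by rewrite mulr_ge0 ?(ltW dl0)// mulr_ge0// mulr_ge0// sqr_ge0.
rewrite mulr_ge0 ?invr_ge0 ?mulr_ge0 ?(ltW dl0)//.
by apply: Rintegral_ge0 => w _; exact: sqr_ge0.
Qed.

Lemma brownian_motion_distribution {R : realType} {dO} {Om : measurableType dO}
    (P : probability Om R) (d : nat) (M : \bar R) (W : {RV P >-> wpath d M}) :
  brownian_motion P W -> brownian_motion (distribution P W) (fun w : wpath d M => w).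
Proof. by move=> [h1 h2]; split; [exact: h1|exact: h2]. Qed.

(** * Square-integrable functions *)

Import HBNNSimple.

Section integral_ae.
Context {R : realType} {dT} {T : measurableType dT} (m : {measure set T -> \bar R}).
Local Open Scope ereal_scope.

(** The integral is a supremum over simple functions. One below [f], multiplied by the indicator of
    the complement of [N], lies below [g] and keeps its integral. *)
Let ge0_integral_le_ae (f g : T -> \bar R) (N : set T) :
  (forall x, 0 <= f x) -> (forall x, 0 <= g x) -> measurable N -> m N = 0 ->
  (forall x, ~ N x -> f x = g x) -> \int[m]_x f x <= \int[m]_x g x.
Proof.
move=> f0 g0 mN N0 fg; rewrite [leLHS]ge0_integralTE// [leRHS]ge0_integralTE//.
apply: ge_ereal_sup => _ [h hf <-].
have mNC := measurableC mN.
pose h' := mul_nnsfun h (indic_nnsfun R mNC).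
rewrite (_ : sintegral m h = sintegral m h').
  apply: ereal_sup_ubound; exists h' => //= x.
  rewrite /mul_fun /= mindicE; case: (boolP (x \in ~` N)) => [|_].
    by rewrite inE mulr1 => /fg <-; exact: hf.
  by rewrite mulr0; exact: g0.
rewrite -!integralT_nnsfun (@ae_eq_integral _ _ _ m setT (EFin \o h'))//.
- exact/measurable_EFinP.
- by apply/measurable_EFinP; exact: measurable_funP.
exists N; split=> // x /= hx; apply: contrapT => Nx; apply: hx => _.
by rewrite /mul_fun /= mindicE mem_set//= mulr1.
Qed.

(* Unlike [ae_eq_integral], this does not ask for measurability, which derivatives
   of paths lack *)
Lemma integral_ae_congr (D : set T) (f g : T -> \bar R) :
  {ae m, forall x, D x -> f x = g x} -> \int[m]_(x in D) f x = \int[m]_(x in D) g x.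
Proof.
move=> [N [mN N0 fgN]]; rewrite integral_mkcond [RHS]integral_mkcond.
have E x : ~ N x -> (f \_ D) x = (g \_ D) x.
  move=> Nx; rewrite !patchE; case: ifPn => // /[!inE] Dx.
  by apply: contrapT => H; apply/Nx/fgN => /= /(_ Dx).
rewrite integralE [RHS]integralE; congr (_ - _); apply/eqP; rewrite eq_le.
  by apply/andP; split; apply: (ge0_integral_le_ae _ _ mN) => // x Nx;
    rewrite !funeposE E.
by apply/andP; split; apply: (ge0_integral_le_ae _ _ mN) => // x Nx;
  rewrite !funenegE E.
Qed.

(** The limit [g] is exchanged almost everywhere for the lower limit of the sequence, to which
    Fatou's lemma applies. *)
Lemma fatou_le (f : nat -> T -> R) (g : T -> R) (C : \bar R) :
  (forall n, measurable_fun setT (f n)) -> (forall n x, (0 <= f n x)%R) ->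
  {ae m, forall x, f n x @[n --> \oo] --> g x} ->
  (forall n, \int[m]_x (f n x)%:E <= C) -> \int[m]_x (g x)%:E <= C.
Proof.
move=> mf f0 fg fC.
rewrite (@integral_ae_congr setT _ (fun x => limn_einf (fun n => (f n x)%:E))); last first.
  move: fg; apply: filterS => x fgx _;
  have /cvg_limn_einf_sup[-> _]// : (f n x)%:E @[n --> \oo] --> (g x)%:E.
  by apply: cvg_EFin; [exact: nearW|exact: fgx].
apply: (le_trans (fatou m measurableT _ _)).
- by move=> n; exact/measurable_EFinP.
- by move=> n x _; rewrite lee_fin.
rewrite limn_einf_lim; apply: lime_le; first exact: is_cvg_einfs.
apply: nearW => n; apply: le_trans (fC n).
by apply: ereal_inf_lbound; exists n => /=.
Qed.

End integral_ae.

Section square_integrable.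
Context {R : realType} {dT} {T : measurableType dT} (m : probability T R).
Implicit Types (u v w : T -> R).

Definition sq_integrable u : Prop :=
  measurable_fun setT u /\ m.-integrable setT (fun x => (u x ^+ 2)%:E).

(** The square of the norm is real and quadratic in [u], which keeps most estimates free of extended
    reals and of square roots. *)
Definition sq_norm u : R := \int[m]_x (u x ^+ 2).

Lemma sq_norm_ge0 u : 0 <= sq_norm u.
Proof. by apply: Rintegral_ge0 => x _; exact: sqr_ge0. Qed.

Lemma sq_normE u : sq_integrable u -> (\int[m]_x (u x ^+ 2)%:E)%E = (sq_norm u)%:E.
Proof. by move=> [_ iu]; rewrite /sq_norm /Rintegral fineK// integrable_fin_num. Qed.

Lemma L2_normE u : L2_norm m u = ((\int[m]_x (u x ^+ 2)%:E) `^ (2^-1))%E.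
Proof.
rewrite /L2_norm unlock; congr (_ `^ _)%E; apply: eq_integral => x _ /=.
by rewrite powR_mulrn// real_normK// num_real.
Qed.

Lemma L2P u : u \in Lfun m 2%:E <-> sq_integrable u.
Proof.
split=> [u2|[mu iu]].
  split; last exact: Lfun2_integrable_sqr u2.
  by move: u2; rewrite inE => /andP[]; rewrite inE.
rewrite inE; apply/andP; split; rewrite inE//=.
have := L2_normE u; rewrite /L2_norm /finite_norm => ->.
by rewrite sq_normE//= ltry.
Qed.

Lemma L2_norm_sqrt u : sq_integrable u -> L2_norm m u = (Num.sqrt (sq_norm u))%:E.
Proof.
by move=> su; rewrite L2_normE sq_normE//= powR12_sqrt// sq_norm_ge0.
Qed.

Lemma L2_norm_lt u (e : R) : 0 < e -> sq_integrable u ->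
  (L2_norm m u < e%:E)%E = (sq_norm u < e ^+ 2).
Proof.
move=> e0 su; rewrite L2_norm_sqrt// lte_fin -[X in _ < X](@ger0_norm _ e) ?(ltW e0)//.
rewrite -[X in X < _](@ger0_norm _ (Num.sqrt _)) ?sqrtr_ge0//.
by rewrite -ltr_sqr ?nnegrE// !real_normK ?num_real// sqr_sqrtr// sq_norm_ge0.
Qed.

Lemma bounded_sq_integrable u (C : R) : measurable_fun setT u ->
  (forall x, `|u x| <= C) -> sq_integrable u.
Proof.
move=> mu uC; split=> //.
have := finite_measure_integrable_cst m (C ^+ 2) measurableT.
apply: le_integrable => //; first by apply/measurable_EFinP; exact: measurable_funX.
move=> x _ /=; rewrite lee_fin !ger0_norm ?sqr_ge0//.
by rewrite -[u x ^+ 2]real_normK ?num_real// lerXn2r ?nnegrE// (le_trans _ (uC x)).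
Qed.

Lemma sq_integrable_cst (c : R) : sq_integrable (cst c).
Proof. exact: (@bounded_sq_integrable _ `|c|). Qed.

Lemma sq_integrable_mul u v : sq_integrable u -> sq_integrable v ->
  m.-integrable setT (EFin \o (fun x => u x * v x)).
Proof. by move=> [? ?] [? ?]; exact: integrable_mulR. Qed.

Lemma sq_integrableP (c : R) u v : sq_integrable u -> sq_integrable v ->
  sq_integrable (fun x => c * u x + v x).
Proof.
move=> su sv; have [mu iu] := su; have [mv iv] := sv; split.
  by apply: measurable_funD => //; exact: measurable_funM.
have H : m.-integrable setT (EFin \o (fun x =>
    \sum_(i < 3) [:: c ^+ 2 * u x ^+ 2; 2 * c * (u x * v x); v x ^+ 2]`_i)).
  apply: integrable_sumR => -[[|[|[|//]]]] i /=; first exact: integrableZlR.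
    by apply: integrableZlR; exact: sq_integrable_mul.
  exact: iv.
move: H; apply: eq_integrable => // x _ /=; congr EFin.
by rewrite !big_ord_recl big_ord0 /=; ring.
Qed.

Lemma sq_norm_linear (c : R) u v : sq_integrable u -> sq_integrable v ->
  sq_norm (fun x => c * u x + v x) =
  c ^+ 2 * sq_norm u + 2 * c * L2_inner m u v + sq_norm v.
Proof.
move=> su sv; have iuv := sq_integrable_mul su sv; case: (su) (sv) => mu iu [mv iv].
rewrite /sq_norm /L2_inner -!RintegralZl//.
rewrite -RintegralD//; [|exact: integrableZlR|exact: integrableZlR].
rewrite -RintegralD//; last first.
  have := integrableD measurableT (integrableZlR (c ^+ 2) iu) (integrableZlR (2 * c) iuv).
  by apply: eq_integrable.
by apply: eq_Rintegral => x _; ring.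
Qed.

Lemma sq_integrableB u v : sq_integrable u -> sq_integrable v -> sq_integrable (u \- v).
Proof.
move=> su sv; have := sq_integrableP (-1) sv su.
by congr sq_integrable; apply/funext => x /=; ring.
Qed.

Lemma sq_integrableZ (c : R) u : sq_integrable u -> sq_integrable (fun x => c * u x).
Proof.
move=> su; have := sq_integrableP (c - 1) su su.
by congr sq_integrable; apply/funext => x /=; ring.
Qed.

Lemma sq_norm_le u v : sq_integrable u -> sq_integrable v ->
  (forall x, `|u x| <= `|v x|) -> sq_norm u <= sq_norm v.
Proof.
move=> [_ iu] [_ iv] uv; apply: le_Rintegral => // x _.
rewrite -[u x ^+ 2]real_normK ?num_real// -[v x ^+ 2]real_normK ?num_real//.
by rewrite lerXn2r ?nnegrE.
Qed.

Lemma sq_norm_cst (c : R) : sq_norm (cst c) = c ^+ 2.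
Proof.
have := @sq_normE (cst c).
rewrite (_ : (\int[m]_x _)%E = (c ^+ 2)%:E); last first.
  by rewrite (eq_integral (cst (c ^+ 2)%:E))//= integral_cst//= probability_setT mule1.
move=> H; apply/esym/EFin_inj; apply: H.
exact: sq_integrable_cst.
Qed.

Lemma sq_normDle u v : sq_integrable u -> sq_integrable v ->
  sq_norm (fun x => u x + v x) <= 2 * sq_norm u + 2 * sq_norm v.
Proof.
move=> su sv; have e1 := sq_norm_linear 1 su sv; have e2 := sq_norm_linear (-1) su sv.
have := sq_norm_ge0 (fun x => -1 * u x + v x); rewrite e2.
rewrite (_ : (fun x => u x + v x) = (fun x => 1 * u x + v x)); last first.
  by apply/funext => x; rewrite mul1r.
rewrite e1; lra.
Qed.

Lemma sq_normBle u v w : sq_integrable u -> sq_integrable v -> sq_integrable w ->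
  sq_norm (u \- w) <= 2 * sq_norm (u \- v) + 2 * sq_norm (v \- w).
Proof.
move=> su sv sw.
have := sq_normDle (sq_integrableB su sv) (sq_integrableB sv sw).
by apply: le_trans; rewrite le_eqVlt; apply/orP; left; apply/eqP; congr sq_norm;
  apply/funext => x /=; ring.
Qed.

Lemma L2_cvgP (a : nat -> T -> R) u : (forall n, sq_integrable (a n)) -> sq_integrable u ->
  L2_cvg m a u <-> sq_norm (a n \- u) @[n --> \oo] --> (0 : R).
Proof.
move=> sa su; have sau n := sq_integrableB (sa n) su.
split=> [/fine_cvgP[_ /cvgrPdist_lt H]|/cvgrPdist_lt H].
  apply/cvgrPdist_lt => e e0.
  have se : 0 < Num.sqrt e by rewrite sqrtr_gt0.
  near=> n; have : `|0 - Num.sqrt (sq_norm (a n \- u))| < Num.sqrt e.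
    have : `|0 - fine (L2_norm m (a n \- u))| < Num.sqrt e by near: n; exact: H.
    by rewrite L2_norm_sqrt.
  rewrite !sub0r !normrN !ger0_norm ?sq_norm_ge0// ltr_sqrt//.
rewrite /L2_cvg; apply/fine_cvgP; split.
  by apply: nearW => n; rewrite L2_norm_sqrt.
apply/cvgrPdist_lt => e e0; near=> n.
have : `|0 - sq_norm (a n \- u)| < e ^+ 2 by near: n; apply: H; rewrite exprn_gt0.
rewrite /= L2_norm_sqrt//= !sub0r !normrN !ger0_norm ?sq_norm_ge0// => h.
by rewrite -[ltRHS]ger0_norm ?(ltW e0)// -sqrtr_sqr ltr_sqrt// exprn_gt0.
Unshelve. all: by end_near. Qed.

Definition sq_cauchy (a : nat -> T -> R) := forall e : R, 0 < e -> exists N : nat,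
  forall j k, (N <= j)%N -> (N <= k)%N -> sq_norm (a j \- a k) < e.

Lemma L2_cauchyP (a : nat -> T -> R) : (forall n, sq_integrable (a n)) ->
  L2_cauchy m a <-> sq_cauchy a.
Proof.
move=> sa; split=> H e e0.
  have se : 0 < Num.sqrt e by rewrite sqrtr_gt0.
  have [N HN] := H _ se; exists N => j k Nj Nk; have := HN j k Nj Nk.
  by rewrite L2_norm_lt ?sqr_sqrtr ?(ltW e0)//; exact: sq_integrableB.
have [N HN] := H _ (exprn_gt0 2 e0); exists N => j k Nj Nk.
by rewrite L2_norm_lt//; [exact: HN|exact: sq_integrableB].
Qed.

Lemma sq_norm_abs_le u : sq_integrable u ->
  (\int[m]_x (`|u x|%:E) <= (Num.sqrt (sq_norm u))%:E)%E.
Proof.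
move=> su; have [mu iu] := su; set s := Num.sqrt _.
have i1 : m.-integrable setT (EFin \o u).
  have s1 : sq_integrable (cst 1) by exact: sq_integrable_cst.
  have := sq_integrable_mul su s1; apply: eq_integrable => // x _ /=.
  by rewrite mulr1.
have in1 : m.-integrable setT (EFin \o (Num.norm \o u)) by exact: integrable_norm i1.
have sn : sq_integrable (Num.norm \o u).
  split; first exact: measurableT_comp.
  by move: iu; apply: eq_integrable => // x _ /=; rewrite real_normK// num_real.
have s1 : sq_integrable (cst 1) by exact: sq_integrable_cst.
set I := \int[m]_x `|u x|.
rewrite (_ : (\int[m]_x _)%E = I%:E); last first.
  by rewrite /I /Rintegral fineK//; exact: integrable_fin_num in1.
have I0 : 0 <= I by apply: Rintegral_ge0.
(* variance of |u| is nonnegative *)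
have := sq_norm_ge0 (fun x => (- I) * cst 1 x + (Num.norm \o u) x).
rewrite sq_norm_linear// sq_norm_cst /L2_inner.
under eq_Rintegral do rewrite /= mul1r.
rewrite -/I expr1n mulr1 (_ : sq_norm (Num.norm \o u) = sq_norm u); last first.
  by apply: eq_Rintegral => x _ /=; rewrite real_normK// num_real.
move=> H; rewrite lee_fin -[I]ger0_norm// -sqrtr_sqr ler_wsqrtr//; nra.
Qed.

(** Riesz-Fischer: along a fast subsequence the increments are summable in L^1, hence absolutely
    summable almost everywhere, and Fatou's lemma turns the pointwise limit into a limit in norm. *)
Lemma sq_complete (a : nat -> T -> R) : (forall n, sq_integrable (a n)) ->
  sq_cauchy a -> exists2 u, sq_integrable u & sq_norm (a n \- u) @[n --> \oo] --> (0 : R).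
Proof.
move=> sa ca.
pose e k : R := ((2 ^ k.+1)%:R)^-1.
have e_gt0 k : 0 < e k by rewrite invr_gt0 ltr0n expn_gt0.
have /choice[N HN] k := ca (e k ^+ 2) (exprn_gt0 2 (e_gt0 k)).
(* The sum makes [nk k] at least every [N i] with i <= k, and the summand [k] makes it tend to
   infinity. *)
pose nk k := (k + \sum_(i < k.+1) N i)%N.
have Nnk k j : (k <= j)%N -> (N k <= nk j)%N.
  move=> kj; rewrite /nk (bigD1 (inord k))//= inordK ?ltnS//.
  by rewrite addnCA leq_addr.
pose D k x := a (nk k.+1) x - a (nk k) x.
have sD k : sq_integrable (D k) by exact: sq_integrableB.
have De k : (\int[m]_x `|D k x|%:E <= (1 / (2 ^ k.+1)%:R)%:E)%E.
  apply: le_trans (sq_norm_abs_le (sD k)) _; rewrite lee_fin div1r.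
  rewrite -[leRHS]ger0_norm ?(ltW (e_gt0 k))// -sqrtr_sqr ler_wsqrtr// ltW//.
  by apply: HN; exact: Nnk.
have mD k : measurable_fun setT (fun x => `|D k x|%:E).
  by apply/measurable_EFinP; apply: measurableT_comp => //; case: (sD k).
pose F x := (\sum_(0 <= k <oo) `|D k x|%:E)%E.
have iF : m.-integrable setT F.
  apply/integrableP; split.
    by apply: ge0_emeasurable_sum => // k x _ _; rewrite lee_fin.
  rewrite (_ : (\int[m]_x `|F x|)%E = (\int[m]_x F x)%E); last first.
    by apply: eq_integral => x _; rewrite gee0_abs// nneseries_ge0// => *; rewrite lee_fin.
  rewrite integral_nneseries//.
  apply: (@le_lt_trans _ _ (1%R)%:E); last exact: ltry.
  apply: (le_trans _ (epsilon_trick0 xpredT ler01)).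
  by apply: lee_nneseries => // k _ _; apply: integral_ge0 => x _; rewrite lee_fin.
have [Z [mZ Z0 FZ]] := integrable_ae measurableT iF.
have cvgZ x : ~ Z x -> cvgn (fun k => a (nk k) x).
  move=> Zx; have Ffin : F x \is a fin_num.
    by apply: contrapT => h; apply/Zx/FZ => /= /(_ I).
  have : cvgn (series (fun k => D k x)).
    apply: normed_cvg; apply: nondecreasing_is_cvgn.
      by apply/nondecreasing_seqP => n; rewrite /= /series /= big_nat_recr//= lerDl.
    exists (fine (F x)) => _ [n _ <-]; rewrite -lee_fin fineK// /series/= -sumEFin.
    by apply: nneseries_lim_ge => *; rewrite lee_fin.
  rewrite (_ : series _ = fun n => a (nk n) x - a (nk 0%N) x); last first.
    by apply/funext => n; rewrite /series/= (telescope_sumr (fun k => a (nk k) x)).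
  move=> h; rewrite (_ : (fun k => _) = fun k => (a (nk k) x - a (nk 0%N) x) + a (nk 0%N) x).
    by apply: is_cvgD => //; exact: is_cvg_cst.
  by apply/funext => k; rewrite subrK.
(* On the exceptional null set the sequence is set to 0, so that it converges everywhere and its
   limit is measurable. *)
pose v k x := a (nk k) x * \1_(~` Z) x.
have cv x : cvgn (v ^~ x).
  have [Zx|/cvgZ h] := pselect (Z x).
    rewrite (_ : v^~ x = fun=> 0); first exact: is_cvg_cst.
    by apply/funext => k; rewrite /v indicE memNset ?mulr0//= => /(_ Zx).
  by apply: is_cvgM => //; exact: is_cvg_cst.
pose u x := limn (v ^~ x).
have mu : measurable_fun setT u.
  apply: (@measurable_fun_cvg _ _ _ _ v) => [k|x _]; last exact: cv.
  apply: measurable_funM; first by case: (sa (nk k)).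
  by apply: measurable_indic; exact: measurableC.
have uE x : ~ Z x -> a (nk k) x @[k --> \oo] --> u x.
  move=> Zx; have := cv x; rewrite /u (_ : v^~ x = fun k => a (nk k) x)//.
  by apply/funext => k; rewrite /v indicE mem_set ?mulr1.
have key ep : 0 < ep -> exists n0, forall j, (n0 <= j)%N ->
    (\int[m]_x ((a j x - u x) ^+ 2)%:E <= ep%:E)%E.
  move=> ep0; have [n0 Hn0] := ca _ ep0; exists n0 => j n0j.
  apply: (@fatou_le _ _ _ m (fun k x => (a j x - a (nk (n0 + k)%N) x) ^+ 2)).
  - move=> k; apply: measurable_funX; apply: measurable_funB; first by case: (sa j).
    by case: (sa (nk (n0 + k)%N)).
  - by move=> k x; exact: sqr_ge0.
  - exists Z; split=> // x /=; apply: contra_notP => /uE ux.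
    have uxn : a (nk (n0 + k)%N) x @[k --> \oo] --> u x.
      by rewrite -(cvg_shiftn n0) in ux; under eq_fun do rewrite addnC.
    by rewrite expr2; under eq_fun do rewrite expr2; apply: cvgM; apply: cvgB => //;
      exact: cvg_cst.
  - move=> k; rewrite (sq_normE (sq_integrableB (sa j) (sa _))) lee_fin ltW//.
    by apply: Hn0 => //; rewrite /nk -addnA leq_addr.
have sau ep j : (\int[m]_x ((a j x - u x) ^+ 2)%:E <= ep%:E)%E -> sq_integrable (a j \- u).
  move=> h; have mau : measurable_fun setT (a j \- u).
    by apply: measurable_funB => //; case: (sa j).
  split=> //; apply/integrableP; split.
    by apply/measurable_EFinP; exact: measurable_funX.
  apply: le_lt_trans (ltry ep); apply: le_trans h.
  by under eq_integral => x _ do rewrite /= ger0_norm ?sqr_ge0//.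
have su : sq_integrable u.
  have [n0 Hn0] := key 1 ltr01; have := sq_integrableB (sa n0) (sau _ _ (Hn0 n0 (leqnn _))).
  by congr sq_integrable; apply/funext => x /=; ring.
exists u => //; apply/cvgrPdist_lt => ep ep0.
have ep2 : 0 < ep / 2 by rewrite divr_gt0.
have [n0 Hn0] := key (ep / 2) ep2.
near=> n; rewrite sub0r normrN ger0_norm ?sq_norm_ge0//.
apply: (@le_lt_trans _ _ (ep / 2)); last by rewrite ltr_pdivrMr// ltr_pMr// ltr1n.
rewrite -lee_fin -sq_normE; last exact: sq_integrableB.
by apply: Hn0; near: n; exact: nbhs_infty_ge.
Unshelve. all: by end_near. Qed.

End square_integrable.

(** * Closures of nonnegative forms *)

(** Fixes the parameter of Young's inequality once a bound [B] on the energies is known: each of the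
    two terms gets e / 2. Dividing by B + 1 also covers B = 0. *)
Lemma young_small {R : realType} (B e : R) : 0 <= B -> 0 < e -> exists dl : R,
  [/\ 0 < dl, 0 < dl * e / 2 & forall x y, x < dl * e / 2 -> y < dl * e / 2 ->
    dl * B + (2 * dl)^-1 * (x + y) < e].
Proof.
move=> B0 e0; pose dl := e / (2 * (B + 1)).
have B1 : 0 < B + 1 by rewrite ltr_wpDl.
have dl0 : 0 < dl by rewrite divr_gt0// mulr_gt0.
exists dl; split=> //; first by rewrite divr_gt0// mulr_gt0.
move=> x y hx hy.
have h1 : (2 * dl)^-1 * (x + y) < e / 2.
  rewrite mulrC ltr_pdivrMr; last exact: mulr_gt0.
  have -> : e / 2 * (2 * dl) = dl * e / 2 + dl * e / 2 by field.
  exact: ltrD.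
have h2 : dl * B <= e / 2.
  rewrite (_ : dl * B = e / 2 * (B / (B + 1))); last by rewrite /dl; field; rewrite gt_eqF.
  by rewrite ler_piMr ?divr_ge0 ?(ltW e0)// ler_pdivrMr// mul1r lerDl.
have := ler_ltD h2 h1.
by rewrite (_ : e / 2 + e / 2 = e)//; field.
Qed.

Section nonneg_forms.
Context {R : realType} {dX} {X : measurableType dX}.
Variables (D : set (X -> R)) (E : (X -> R) -> (X -> R) -> R).
Implicit Types (u v w : X -> R) (a b : nat -> X -> R).

Record nonneg_form : Prop := NonnegForm {
  nf_dom : forall (c : R) u v, D u -> D v -> D (fun x => c * u x + v x);
  nf_linear : forall (c : R) u v w, D u -> D v -> D w ->
    E (fun x => c * u x + v x) w = c * E u w + E v w;
  nf_sym : forall u v, D u -> D v -> E u v = E v u;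
  nf_ge0 : forall u, D u -> 0 <= E u u }.

Hypothesis H : nonneg_form.

Let subE u v : u \- v = (fun x => -1 * v x + u x).
Proof. by apply/funext => x /=; rewrite mulN1r addrC. Qed.

Lemma nf_domB u v : D u -> D v -> D (u \- v).
Proof. by move=> Du Dv; rewrite subE; exact: nf_dom. Qed.

Lemma nf_domD u v : D u -> D v -> D (fun x => u x + v x).
Proof.
move=> Du Dv; rewrite (_ : (fun x => _) = fun x => 1 * u x + v x); first exact: nf_dom.
by apply/funext => x; rewrite mul1r.
Qed.

Lemma nf_linearr (c : R) u v w : D u -> D v -> D w ->
  E w (fun x => c * u x + v x) = c * E w u + E w v.
Proof.
move=> Du Dv Dw; rewrite (nf_sym H)//; last exact: (nf_dom H).
by rewrite (nf_linear H)// (nf_sym H Du)// (nf_sym H Dv).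
Qed.

Lemma nf_subl u v w : D u -> D v -> D w -> E (u \- v) w = E u w - E v w.
Proof. by move=> Du Dv Dw; rewrite subE (nf_linear H)// mulN1r addrC. Qed.

Lemma nf_subr u v w : D u -> D v -> D w -> E w (u \- v) = E w u - E w v.
Proof. by move=> Du Dv Dw; rewrite subE nf_linearr// mulN1r addrC. Qed.

Lemma nf_quad (c : R) u v : D u -> D v ->
  E (fun x => c * u x + v x) (fun x => c * u x + v x) =
  c ^+ 2 * E u u + 2 * c * E u v + E v v.
Proof.
move=> Du Dv; have Dw := nf_dom H c Du Dv.
by rewrite (nf_linear H)// !nf_linearr// (nf_sym H Dv Du); ring.
Qed.

(** Nonnegativity of the form at dl u + v and at - dl u + v. *)
Lemma nf_young dl u v : 0 < dl -> D u -> D v ->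
  `|E u v| <= dl / 2 * E u u + (2 * dl)^-1 * E v v.
Proof.
move=> dl0 Du Dv; have d0 : dl != 0 by rewrite gt_eqF.
have h1 := nf_ge0 H (nf_dom H dl Du Dv); have h2 := nf_ge0 H (nf_dom H (- dl) Du Dv).
rewrite !nf_quad// in h1 h2.
have e1 : dl / 2 * E u u + (2 * dl)^-1 * E v v =
    (2 * dl)^-1 * (dl ^+ 2 * E u u + E v v) by field.
have e2 : E u v = (2 * dl)^-1 * (2 * dl * E u v) by field.
have i0 : 0 < (2 * dl)^-1 by rewrite invr_gt0 mulr_gt0.
rewrite e1 {1}e2 normrM gtr0_norm// ler_pM2l// ler_norml; apply/andP; split; nra.
Qed.

Lemma nf_subE u v : D u -> D v -> E (u \- v) (u \- v) = E u u - 2 * E u v + E v v.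
Proof. by move=> Du Dv; rewrite subE nf_quad// (nf_sym H Dv Du); ring. Qed.

Lemma nf_subC u v : D u -> D v -> E (u \- v) (u \- v) = E (v \- u) (v \- u).
Proof. by move=> Du Dv; rewrite !nf_subE// (nf_sym H Dv Du); ring. Qed.

Lemma nf_subxx u : D u -> E (u \- u) (u \- u) = 0.
Proof. by move=> Du; rewrite nf_subE//; ring. Qed.

Lemma nf_parallelogram u v : D u -> D v ->
  E (u \- v) (u \- v) + E (fun x => u x + v x) (fun x => u x + v x) =
  2 * E u u + 2 * E v v.
Proof.
move=> Du Dv; rewrite nf_subE//.
rewrite (_ : (fun x => u x + v x) = fun x => 1 * u x + v x).
  by rewrite nf_quad//; ring.
by apply/funext => x; rewrite mul1r.
Qed.

Lemma nf_add_le u v : D u -> D v ->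
  E (fun x => u x + v x) (fun x => u x + v x) <= 2 * E u u + 2 * E v v.
Proof.
by move=> Du Dv; rewrite -nf_parallelogram// lerDr (nf_ge0 H)//; exact: nf_domB.
Qed.

Lemma nf_triangle u v w : D u -> D v -> D w ->
  E (u \- w) (u \- w) <= 2 * E (u \- v) (u \- v) + 2 * E (v \- w) (v \- w).
Proof.
move=> Du Dv Dw; have := nf_add_le (nf_domB Du Dv) (nf_domB Dv Dw).
by rewrite (_ : (fun x => _) = u \- w)//; apply/funext => x /=; ring.
Qed.

Lemma nf_diff_le u u' v v' dl B : 0 < dl -> D u -> D u' -> D v -> D v' ->
  E u' u' <= B -> E v v <= B ->
  `|E u v - E u' v'| <= dl * B +
    (2 * dl)^-1 * (E (u \- u') (u \- u') + E (v \- v') (v \- v')).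
Proof.
move=> dl0 Du Du' Dv Dv' uB vB.
have h1 := nf_young dl0 Dv (nf_domB Du Du').
have h2 := nf_young dl0 Du' (nf_domB Dv Dv').
rewrite (nf_sym H)// in h1; last exact: nf_domB.
rewrite nf_subl// in h1; rewrite nf_subr// in h2.
have -> : E u v - E u' v' = (E u v - E u' v) + (E u' v - E u' v') by ring.
apply: (le_trans (ler_normD _ _)).
have d2 : 0 <= dl / 2 by rewrite divr_ge0// ltW.
have g1 := ler_wpM2l d2 uB; have g2 := ler_wpM2l d2 vB.
rewrite mulrDr; have -> : dl * B = dl / 2 * B + dl / 2 * B by field.
apply: le_trans (lerD h1 h2) _.
have -> (x y z t : R) : x + y + (z + t) = (x + z) + (y + t) by ring.
by rewrite lerD2r lerD.
Qed.

Lemma nf_cauchy_bounded a : (forall n, D (a n)) -> form_cauchy E a ->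
  exists B : R, 0 <= B /\ forall n, E (a n) (a n) <= B.
Proof.
move=> Da ca; have [N HN] := ca 1 ltr01.
have s0 : 0 <= \sum_(i < N) E (a i) (a i) by apply: sumr_ge0 => i _; exact: nf_ge0.
have e0 := nf_ge0 H (Da N).
exists (2 + 2 * E (a N) (a N) + \sum_(i < N) E (a i) (a i)); split; first by lra.
move=> n; have [nN|Nn] := ltnP n N.
  rewrite (bigD1 (Ordinal nN))//=.
  have : 0 <= \sum_(i < N | i != Ordinal nN) E (a i) (a i).
    by apply: sumr_ge0 => i _; exact: nf_ge0.
  lra.
have := HN n N Nn (leqnn N).
have := nf_add_le (nf_domB (Da n) (Da N)) (Da N).
rewrite (_ : (fun x => _) = a n); last by apply/funext => x /=; ring.
lra.
Qed.

Lemma nf_cvg_diff a a' b b' : (forall n, D (a n)) -> (forall n, D (a' n)) ->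
  (forall n, D (b n)) -> (forall n, D (b' n)) ->
  form_cauchy E a' -> form_cauchy E b ->
  E (a n \- a' n) (a n \- a' n) @[n --> \oo] --> (0 : R) ->
  E (b n \- b' n) (b n \- b' n) @[n --> \oo] --> (0 : R) ->
  E (a n) (b n) - E (a' n) (b' n) @[n --> \oo] --> (0 : R).
Proof.
move=> Da Da' Db Db' ca' cb /cvgrPdist_lt ha /cvgrPdist_lt hb.
have [B1 [B10 hB1]] := nf_cauchy_bounded Da' ca'.
have [B2 [B20 hB2]] := nf_cauchy_bounded Db cb.
apply/cvgrPdist_lt => e e0; pose B := B1 + B2.
have B0 : 0 <= B by rewrite addr_ge0.
have [dl [dl0 ed0 dle]] := young_small B0 e0.
near=> n; rewrite sub0r normrN.
have h1 : E (a n \- a' n) (a n \- a' n) < dl * e / 2.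
  have : `|0 - E (a n \- a' n) (a n \- a' n)| < dl * e / 2 by near: n; exact: ha.
  by rewrite sub0r normrN; apply: le_lt_trans; exact: ler_norm.
have h2 : E (b n \- b' n) (b n \- b' n) < dl * e / 2.
  have : `|0 - E (b n \- b' n) (b n \- b' n)| < dl * e / 2 by near: n; exact: hb.
  by rewrite sub0r normrN; apply: le_lt_trans; exact: ler_norm.
apply: le_lt_trans (dle _ _ h1 h2); apply: nf_diff_le => //.
- by rewrite (le_trans (hB1 n))// lerDl.
- by rewrite (le_trans (hB2 n))// lerDr.
Unshelve. all: by end_near. Qed.

Lemma nf_cauchy_cvg a b : (forall n, D (a n)) -> (forall n, D (b n)) ->
  form_cauchy E a -> form_cauchy E b -> cvgn (fun n => E (a n) (b n)).
Proof.
move=> Da Db ca cb.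
have [B1 [B10 hB1]] := nf_cauchy_bounded Da ca.
have [B2 [B20 hB2]] := nf_cauchy_bounded Db cb.
apply/cauchy_cvgP/cauchy_exP => e e0; pose B := B1 + B2.
have B0 : 0 <= B by rewrite addr_ge0.
have [dl [dl0 ed0 dle]] := young_small B0 e0.
have [N1 HN1] := ca _ ed0; have [N2 HN2] := cb _ ed0.
pose N := maxn N1 N2; exists (E (a N) (b N)).
suff : \forall n \near \oo, `|E (a N) (b N) - E (a n) (b n)| < e by [].
near=> n; have Nn : (N <= n)%N by near: n; exact: nbhs_infty_ge.
have [N1N N2N] : (N1 <= N)%N /\ (N2 <= N)%N by rewrite leq_maxl leq_maxr.
have h1 := HN1 N n N1N (leq_trans N1N Nn).
have h2 := HN2 N n N2N (leq_trans N2N Nn).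
apply: le_lt_trans (dle _ _ h1 h2); apply: nf_diff_le => //.
- by rewrite (le_trans (hB1 n))// lerDl.
- by rewrite (le_trans (hB2 N))// lerDr.
Unshelve. all: by end_near. Qed.

Lemma form_cauchyD (c : R) a b : (forall n, D (a n)) -> (forall n, D (b n)) ->
  form_cauchy E a -> form_cauchy E b ->
  form_cauchy E (fun n x => c * a n x + b n x).
Proof.
(* By the parallelogram identity the energy of c u + v is at most 2 c^2 E(u, u) + 2 E(v, v), hence
   at most e / 2. *)
move=> Da Db ca cb e e0; pose dl := e / (4 * (c ^+ 2 + 1)).
have c0 : 0 < c ^+ 2 + 1 by rewrite ltr_wpDl ?sqr_ge0.
have dl0 : 0 < dl by rewrite divr_gt0// mulr_gt0.
have [N1 HN1] := ca _ dl0; have [N2 HN2] := cb _ dl0.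
exists (maxn N1 N2) => j k; rewrite !geq_max => /andP[j1 j2] /andP[k1 k2].
have h1 := HN1 j k j1 k1; have h2 := HN2 j k j2 k2.
pose u := a j \- a k; pose v := b j \- b k.
have Du : D u by exact: nf_domB.
have Dv : D v by exact: nf_domB.
rewrite (_ : _ \- _ = fun x => c * u x + v x); last first.
  by apply/funext => x; rewrite /u /v /=; ring.
rewrite nf_quad//.
have := nf_ge0 H (nf_dom H (- c) Du Dv); rewrite nf_quad//.
have e1 : dl * (c ^+ 2 + 1) = e / 4.
  by rewrite /dl; field; rewrite gt_eqF.
have u0 := nf_ge0 H Du; have v0 := nf_ge0 H Dv.
rewrite -/u in h1; rewrite -/v in h2; nra.
Qed.

End nonneg_forms.

Lemma clamp_lipschitz {R : realType} (p q : R) :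
  `|Num.min (Num.max p 0) 1 - Num.min (Num.max q 0) 1| <= `|p - q|.
Proof.
have h1 := ler_norm (p - q); have h2 := ler_norm (q - p); rewrite distrC in h2.
rewrite ler_norml /Num.min /Num.max; move: h1 h2; move: (`|p - q| : R) => t.
by case: (ltP p 0); case: (ltP q 0); rewrite ?ltr01; try (case: (ltP p 1)); try (case: (ltP q 1)); lra.
Qed.

(** * The closure of a closable form with a Markovian core *)

Section closure.
Context {R : realType} {dX} {X : measurableType dX} (m : probability X R).
Variables (C : set (X -> R)) (E : (X -> R) -> (X -> R) -> R).
Implicit Types (u v w : X -> R) (a b : nat -> X -> R).
Hypotheses (C_sq : forall u, C u -> sq_integrable m u) (HE : nonneg_form C E)
  (E_closable : closable m C E).

Let D := closure_dom m C E.
Let Eb := closure_form m C E.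

Definition form_approx u a := [/\ sq_integrable m u, forall n, C (a n),
  form_cauchy E a & sq_norm m (a n \- u) @[n --> \oo] --> (0 : R)].

Let approxE u a : sq_integrable m u -> approximates m C E u a <-> form_approx u a.
Proof.
move=> su; split=> [[Ca ca au]|[_ Ca ca au]]; split=> //.
  by apply/L2_cvgP => // n; exact: C_sq.
by apply/L2_cvgP => // n; exact: C_sq.
Qed.

Lemma closure_domP u : D u <-> exists a, form_approx u a.
Proof.
split=> [[/L2P su [a ua]]|[a ua]]; first by exists a; apply/approxE.
have [su _ _ _] := ua; split; first exact/L2P.
by exists a; apply/approxE.
Qed.

Let cvg0_le (x y : nat -> R) (c : R) : (forall n, 0 <= x n) ->
  (forall n, x n <= c * y n) -> y n @[n --> \oo] --> (0 : R) -> x n @[n --> \oo] --> (0 : R).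
Proof.
move=> x0 xy y0; apply: (@squeeze_cvgr _ _ _ _ (fun=> 0) (fun n => c * y n)).
- by apply: nearW => n; rewrite x0 xy.
- exact: cvg_cst.
- by rewrite -(mulr0 c); apply: cvgM => //; exact: cvg_cst.
Qed.

Let CB u v : C u -> C v -> C (u \- v).
Proof. exact: (nf_domB HE). Qed.

Let cvg_eq (x y : nat -> R) (l : R) : (forall n, x n = y n) ->
  y n @[n --> \oo] --> l -> x n @[n --> \oo] --> l.
Proof. by move=> /funext ->. Qed.

Let cvg_dist (x : nat -> R) (l : R) : x n @[n --> \oo] --> l -> forall e : R, 0 < e ->
  exists N, forall n, (N <= n)%N -> `|l - x n| < e.
Proof. by move=> /cvgrPdist_lt h e e0; have [N _ HN] := h _ e0; exists N. Qed.

Let cvg0_lt (x : nat -> R) : (forall n, 0 <= x n) -> x n @[n --> \oo] --> (0 : R) ->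
  forall e : R, 0 < e -> exists N, forall n, (N <= n)%N -> x n < e.
Proof.
move=> x0 /cvg_dist h e e0; have [N HN] := h _ e0; exists N => n /HN.
by rewrite sub0r normrN ger0_norm.
Qed.

Let cvgR_unique (x : nat -> R) (l l' : R) :
  x n @[n --> \oo] --> l -> x n @[n --> \oo] --> l' -> l = l'.
Proof. by move=> h h'; apply: (cvg_unique _ h h'); exact: Rhausdorff. Qed.

Lemma form_approx_lin (c : R) u v a b : form_approx u a -> form_approx v b ->
  form_approx (fun x => c * u x + v x) (fun n x => c * a n x + b n x).
Proof.
move=> [su Ca ca ua] [sv Cb cb vb]; split.
- exact: sq_integrableP.
- by move=> n; exact: (nf_dom HE).
- exact: (form_cauchyD HE).
have su' n := sq_integrableB (C_sq (Ca n)) su.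
have sv' n := sq_integrableB (C_sq (Cb n)) sv.
have scu n := sq_integrableZ c (su' n).
apply: (cvg0_le (c := 2) (y := fun n => c ^+ 2 * sq_norm m (a n \- u) + sq_norm m (b n \- v))).
- by move=> n; exact: sq_norm_ge0.
- move=> n; have := sq_normDle (scu n) (sv' n).
  have -> : sq_norm m (fun x => c * (a n \- u) x) = c ^+ 2 * sq_norm m (a n \- u).
    rewrite /sq_norm -RintegralZl//; last by case: (su' n).
    by apply: eq_Rintegral => x _; rewrite exprMn.
  rewrite -mulrDr; apply: le_trans; rewrite le_eqVlt; apply/orP; left; apply/eqP.
  by apply: eq_Rintegral => x _ /=; ring.
- rewrite -(addr0 (0 : R)); apply: cvgD => //.
  by rewrite -(mulr0 (c ^+ 2)); apply: cvgM => //; exact: cvg_cst.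
Qed.

Let subE u v : u \- v = (fun x => -1 * v x + u x).
Proof. by apply/funext => x /=; rewrite mulN1r addrC. Qed.

Lemma form_approxB u v a b : form_approx u a -> form_approx v b ->
  form_approx (u \- v) (fun n => a n \- b n).
Proof.
move=> ua vb; have := form_approx_lin (-1) vb ua.
by rewrite -subE (_ : (fun n => _) = (fun n => a n \- b n))//; apply/funext => n; rewrite subE.
Qed.

(** Closability enters here: the difference of two approximating sequences is E-Cauchy and tends to
    0 in L^2. *)
Lemma form_approx_diff u a a' : form_approx u a -> form_approx u a' ->
  E (a n \- a' n) (a n \- a' n) @[n --> \oo] --> (0 : R).
Proof.
move=> ua ua'; have [su Caa caa h] := form_approxB ua ua'.
apply: (E_closable (a := fun n => a n \- a' n)) => //.
have s0 : sq_integrable m (cst 0) by exact: sq_integrable_cst.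
apply/(L2_cvgP _ s0) => [n|]; first exact: C_sq.
by have -> : cst 0 = u \- u by apply/funext => x /=; rewrite subrr.
Qed.

(** [closure_form] is computed along chosen sequences; any other approximating sequences give the
    same limit, because a form is continuous along E-Cauchy sequences. *)
Lemma closure_form_cvg u v a b : form_approx u a -> form_approx v b ->
  E (a n) (b n) @[n --> \oo] --> Eb u v.
Proof.
move=> ua vb; have [su Ca ca _] := ua; have [sv Cb cb _] := vb.
have hu : form_approx u (approx_seq m C E u).
  apply/approxE => //; apply: (xgetPex (fun=> cst 0) (P := [set a | approximates m C E u a])).
  by exists a; apply/approxE.
have hv : form_approx v (approx_seq m C E v).
  apply/approxE => //; apply: (xgetPex (fun=> cst 0) (P := [set a | approximates m C E v a])).
  by exists b; apply/approxE.
have [_ Cu cu _] := hu; have [_ Cv cv _] := hv.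
have h1 := nf_cvg_diff HE Ca Cu Cb Cv cu cb (form_approx_diff ua hu) (form_approx_diff vb hv).
have h2 := nf_cauchy_cvg HE Cu Cv cu cv.
have h3 : (E (a n) (b n) - E (approx_seq m C E u n) (approx_seq m C E v n)) +
    E (approx_seq m C E u n) (approx_seq m C E v n) @[n --> \oo] --> 0 + Eb u v.
  exact: cvgD.
by rewrite -[Eb u v]add0r; apply: cvg_eq h3 => n; rewrite subrK.
Qed.

Lemma form_approx_core u : C u -> form_approx u (fun=> u).
Proof.
move=> Cu; split=> //; first exact: C_sq.
- by move=> e e0; exists 0%N => j k _ _; rewrite (nf_subxx HE).
- rewrite (_ : (fun n => _) = fun=> 0); first exact: cvg_cst.
  apply/funext => n; rewrite /sq_norm (_ : \int[m]_x _ = \int[m]_x 0); last first.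
    by apply: eq_Rintegral => x _ /=; rewrite subrr expr0n.
  by rewrite /Rintegral integral0.
Qed.

Lemma closure_dom_core u : C u -> D u.
Proof. by move=> Cu; apply/closure_domP; exists (fun=> u); exact: form_approx_core. Qed.

Lemma closure_form_core u v : C u -> C v -> Eb u v = E u v.
Proof.
move=> Cu Cv; have := closure_form_cvg (form_approx_core Cu) (form_approx_core Cv).
by move=> /(cvg_lim (@Rhausdorff R)) <-; rewrite lim_cst//; exact: Rhausdorff.
Qed.

Lemma closure_nonneg_form : nonneg_form D Eb.
Proof.
split.
- move=> c u v /closure_domP[a ua] /closure_domP[b vb]; apply/closure_domP.
  by exists (fun n x => c * a n x + b n x); exact: form_approx_lin.
- move=> c u v w /closure_domP[a ua] /closure_domP[b vb] /closure_domP[d wd].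
  have h1 := closure_form_cvg (form_approx_lin c ua vb) wd.
  have h2 := closure_form_cvg ua wd; have h3 := closure_form_cvg vb wd.
  have h4 : c * E (a n) (d n) + E (b n) (d n) @[n --> \oo] --> c * Eb u w + Eb v w.
    by apply: cvgD => //; apply: cvgM => //; exact: cvg_cst.
  apply: (cvgR_unique h1); apply: cvg_eq h4 => n.
  by case: ua vb wd => _ Ca _ _ [_ Cb _ _] [_ Cd _ _]; rewrite (nf_linear HE).
- move=> u v /closure_domP[a ua] /closure_domP[b vb].
  apply: (cvgR_unique (closure_form_cvg ua vb)).
  apply: cvg_eq (closure_form_cvg vb ua) => n.
  by case: ua vb => _ Ca _ _ [_ Cb _ _]; rewrite (nf_sym HE).
- move=> u /closure_domP[a ua]; apply: (cvgr_to_ge (closure_form_cvg ua ua)).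
  by apply: nearW => n; apply: (nf_ge0 HE); case: ua.
Qed.

Lemma form_approx_ae u v a : u = v %[ae m] -> sq_integrable m v ->
  form_approx u a -> form_approx v a.
Proof.
move=> uv sv [su Ca ca ua]; split=> //; apply: cvg_eq ua => n; rewrite /sq_norm /Rintegral; congr fine.
apply: integral_ae_congr; move: uv; apply: filterS => x uvx _ /=.
by rewrite uvx.
Qed.

Let hs (n : nat) : R := n.+1%:R^-1.

Let hs_gt0 n : 0 < hs n. Proof. by rewrite invr_gt0. Qed.

Let hs_le n k : (n <= k)%N -> hs k <= hs n.
Proof. by move=> nk; rewrite lef_pV2 ?posrE// ler_nat ltnS. Qed.

(** A late member [a k] of an approximating sequence will do: the energy of a k - u is the limit in
    n of the energies of a k - a n. *)
Lemma closure_form_approx u (e : R) : D u -> 0 < e ->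
  exists c, [/\ C c, sq_norm m (c \- u) < e & Eb (c \- u) (c \- u) < e].
Proof.
move=> /closure_domP[a ua] e0; have [su Ca ca /cvgrPdist_lt au] := ua.
have e2 : 0 < e / 2 by rewrite divr_gt0.
have [N HN] := ca _ e2.
have [k [Nk kq]] : exists k, (N <= k)%N /\ sq_norm m (a k \- u) < e.
  have [k _ Hk] := au _ e0; exists (maxn N k); split; first exact: leq_maxl.
  have := Hk (maxn N k) (leq_maxr _ _); rewrite /= sub0r normrN.
  by apply: le_lt_trans; exact: ler_norm.
exists (a k); split=> //.
have h := form_approxB (form_approx_core (Ca k)) ua.
apply: (@le_lt_trans _ _ (e / 2)).
  apply: (cvgr_to_le (closure_form_cvg h h)); near=> n; apply/ltW/HN => //.
  by near: n; exact: nbhs_infty_ge.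
by rewrite ltr_pdivrMr// ltr_pMr// ltr1n.
Unshelve. all: by end_near. Qed.

(** Lower semicontinuity through near-minimisers. [al n] is the infimum of the energies of core
    functions at squared distance at most [hs n] from [v], and [c n] almost attains it. The midpoint
    of [c n] and [c k] competes for [al n], so the parallelogram identity bounds the energy of c n -
    c k by 2 (al k - al n) + 4 hs n. As [al] increases and is bounded by [K], the sequence [c] is
    E-Cauchy. *)
Lemma closure_form_lsc v (K : R) : sq_integrable m v ->
  (forall e : R, 0 < e -> exists c, [/\ C c, sq_norm m (c \- v) <= e & E c c <= K + e]) ->
  D v /\ Eb v v <= K.
Proof.
move=> sv H.
pose T n := [set c | C c /\ sq_norm m (c \- v) <= hs n].
pose ET n := [set E c c | c in T n].
have ET0 n : has_inf (ET n).
  split.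
    have [c [Cc qc _]] := H (hs n) (hs_gt0 n).
    by exists (E c c), c.
  by exists 0 => _ [c [Cc _] <-]; exact: (nf_ge0 HE).
pose al n := inf (ET n).
have alK n : al n <= K.
  apply/ler_addgt0Pl => e e0.
  pose e' := Num.min e (hs n).
  have e'0 : 0 < e' by rewrite lt_min e0 hs_gt0.
  have [c [Cc qc Kc]] := H _ e'0.
  apply: (@le_trans _ _ (E c c)).
    apply: ge_inf; first by case: (ET0 n).
    by exists c => //; split=> //; rewrite (le_trans qc)// ge_min lexx orbT.
  by rewrite (le_trans Kc)// addrC lerD2r ge_min lexx.
have /choice[c Hc] n : exists c, T n c /\ E c c < al n + hs n.
  have [_ [c Tc <-] h] := inf_adherent (hs_gt0 n) (ET0 n).
  by exists c.
have Tle n k : (n <= k)%N -> T n (c k).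
  move=> nk; have [[Cc qc] _] := Hc k; split=> //; rewrite (le_trans qc)//.
  exact: hs_le.
have al_homo n k : (n <= k)%N -> al n <= al k.
  move=> nk; apply: lb_le_inf; first by case: (ET0 k).
  move=> _ [d [Cd qd] <-]; apply: ge_inf; first by case: (ET0 n).
  exists d => //; split=> //; rewrite (le_trans qd)//.
  exact: hs_le.
have Cc n : C (c n) by case: (Hc n) => -[].
have midE n k : (n <= k)%N ->
    E (c n \- c k) (c n \- c k) <= 2 * (al k - al n) + 4 * hs n.
  move=> nk; have [[_ q1] e1] := Hc n; have [[_ q2] e2] := Hc k.
  have q2' := (Tle n k nk).2.
  (* The midpoint is written with the extra term c n - c n = 0, to fit the shape c u + v of the
     domain axiom. *)
  have Cmid := nf_dom HE (2^-1) (nf_domD HE (Cc n) (Cc k)) (nf_domB HE (Cc n) (Cc n)).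
  set mid := (fun x => _) in Cmid.
  have midq : sq_norm m (mid \- v) <= hs n.
    have s1 := sq_integrableZ 2^-1 (sq_integrableB (C_sq (Cc n)) sv).
    have s2 := sq_integrableZ 2^-1 (sq_integrableB (C_sq (Cc k)) sv).
    have qZ d : C d -> sq_norm m (fun x => 2^-1 * (d \- v) x) = 4^-1 * sq_norm m (d \- v).
      move=> Cd; have [? ?] := sq_integrableB (C_sq Cd) sv.
      rewrite /sq_norm -RintegralZl//; apply: eq_Rintegral => x _.
      by field.
    have := sq_normDle s1 s2; rewrite !qZ// => h.
    rewrite (_ : sq_norm m (mid \- v) =
        sq_norm m (fun x => 2^-1 * (c n \- v) x + 2^-1 * (c k \- v) x)); last first.
      by apply: eq_Rintegral => x _; rewrite /mid /=; field.
    have gen (x y z : R) : x <= z -> y <= z -> 2 * (4^-1 * x) + 2 * (4^-1 * y) <= z by lra.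
    by apply: (le_trans h); exact: gen.
  have aln : al n <= E mid mid by apply: ge_inf; [case: (ET0 n)|exists mid].
  have Em : E (fun x => c n x + c k x) (fun x => c n x + c k x) = 4 * E mid mid.
    rewrite (_ : (fun x => c n x + c k x) = fun x => 1 * mid x + mid x); last first.
      by apply/funext => x; rewrite /mid /=; field.
    by rewrite (nf_quad HE)//; ring.
  have := nf_parallelogram HE (Cc n) (Cc k); rewrite Em.
  have e2' : E (c k) (c k) < al k + hs n.
    by apply: lt_le_trans e2 _; rewrite lerD2l; exact: hs_le.
  move: e1 e2' aln; move: (hs n) (al k) (al n) => i x y.
  have gen (A B p q r : R) : p < y + i -> q < x + i -> y <= r ->
      A + 4 * r = 2 * p + 2 * q -> A <= 2 * (x - y) + 4 * i by lra.
  exact: gen.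
have cal : cvgn al.
  by apply: nondecreasing_is_cvgn => //; exists K => _ [n _ <-].
have harm0 n : 0 <= hs n by exact/ltW/hs_gt0.
  have harm : hs n @[n --> \oo] --> (0 : R) by exact: cvg_harmonic.
have ap : form_approx v c.
  split=> //.
    move=> e e0; have e8 : 0 < e / 8 by rewrite divr_gt0.
    have [N1 H1] := cvg_dist cal e8.
    have [N2 H2] := cvg0_lt harm0 harm e8.
    pose N := maxn N1 N2.
    have main j k : (j <= k)%N -> (N <= j)%N -> E (c j \- c k) (c j \- c k) < e.
      move=> jk; rewrite geq_max => /andP[j1 j2]; have := midE j k jk.
      have := H1 j j1; have := H2 j j2; rewrite ger0_norm; last first.
        by rewrite subr_ge0; exact: nondecreasing_cvgn_le.
      have := nondecreasing_cvgn_le al_homo cal k.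
      lra.
    exists N => j k Nj Nk; have [jk|/ltnW kj] := leqP j k; first exact: main.
    by rewrite (nf_subC HE)//; exact: main.
  apply: (cvg0_le (c := 1) (y := fun n => hs n)) => //.
    by move=> n; exact: sq_norm_ge0.
  by move=> n; rewrite mul1r; case: (Hc n) => -[].
split; first by apply/closure_domP; exists c.
have h : hs n + K @[n --> \oo] --> (0 + K : R) by apply: cvgD => //; exact: cvg_cst.
rewrite -[K]add0r; apply: (ler_cvg_to (closure_form_cvg ap ap) h).
apply: nearW => n; have [_ /ltW] := Hc n; rewrite addrC => /le_trans; apply.
by rewrite lerD2l.
Qed.

Let clamp u x := Num.min (Num.max (u x) 0) 1.

Hypotheses (C_dense : forall u (e : R), sq_integrable m u -> 0 < e ->
    exists2 v, C v & sq_norm m (u \- v) < e)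
  (C_markov : forall u (e : R), C u -> 0 < e -> exists v,
    [/\ C v, forall x, `|v x - clamp u x| <= e & E v v <= E u u]).

Let clamp_lip u v x : `|clamp u x - clamp v x| <= `|u x - v x|.
Proof.
exact: clamp_lipschitz.
Qed.

Let sq_clamp u : sq_integrable m u -> sq_integrable m (clamp u).
Proof.
move=> [mu _]; apply: (@bounded_sq_integrable _ _ _ m _ (1)).
  by apply: measurable_minr => //; apply: measurable_maxr.
move=> x; rewrite ger0_norm; first by rewrite /clamp ge_min lexx orbT.
by rewrite le_min ler01 le_max lexx orbT.
Qed.

(** The clamp of a core function [a n] near [u] is uniformly close to core functions of energy at
    most E(a n, a n), and these energies tend to that of [u]; lower semicontinuity concludes. *)
Let closure_markov u : D u -> D (clamp u) /\ Eb (clamp u) (clamp u) <= Eb u u.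
Proof.
move=> /closure_domP[a ua]; have [su Ca ca au] := ua.
apply: closure_form_lsc; first exact: sq_clamp.
move=> e e0; have e4 : 0 < e / 4 by rewrite divr_gt0.
have [N1 H1] := cvg0_lt (fun n => sq_norm_ge0 m (a n \- u)) au e4.
have [N2 H2] := cvg_dist (closure_form_cvg ua ua) e0.
pose n := maxn N1 N2.
have qn := H1 n (leq_maxl _ _); have En := H2 n (leq_maxr _ _).
(* The bound by 1 gives e'^2 <= e' <= e / 4, as it is a squared distance that has to be small. *)
pose e' := Num.min 1 (e / 4).
have e'0 : 0 < e' by rewrite lt_min ltr01.
have [v [Cv vu Ev]] := C_markov (Ca n) e'0.
have sa := C_sq (Ca n); have sv := C_sq Cv; have sca := sq_clamp sa.
exists v; split=> //; last first.
  by apply: le_trans Ev _; have := ler_norm (E (a n) (a n) - Eb u u); rewrite distrC; lra.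
apply: le_trans (sq_normBle sv sca (sq_clamp su)) _.
have h1 : sq_norm m (v \- clamp (a n)) <= e'.
  apply: (@le_trans _ _ (sq_norm m (cst e'))).
    apply: sq_norm_le; first exact: sq_integrableB.
      exact: sq_integrable_cst.
    by move=> x /=; rewrite (ger0_norm (ltW e'0)).
  by rewrite sq_norm_cst expr2 ler_piMr ?(ltW e'0)// ge_min lexx.
have h2 : sq_norm m (clamp (a n) \- clamp u) <= sq_norm m (a n \- u).
  apply: sq_norm_le; [exact: sq_integrableB sca (sq_clamp su)|exact: sq_integrableB|].
  by move=> x; exact: clamp_lip.
have h3 : e' <= e / 4 by rewrite ge_min lexx orbT.
lra.
Qed.

Lemma closure_dirichlet_form : dirichlet_form m D Eb.
Proof.
have HD := closure_nonneg_form.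
split.
- by move=> u /closure_domP[a [su _ _ _]]; exact/L2P.
- move=> u v w /closure_domP[a ua] /L2P sv uv /closure_domP[b wb].
  have va := form_approx_ae uv sv ua.
  split; first by apply/closure_domP; exists a.
  exact: (cvgR_unique (closure_form_cvg ua wb) (closure_form_cvg va wb)).
- move=> u e /L2P su e0.
  have [v Cv qv] := C_dense su (exprn_gt0 2 e0); exists v; first exact: closure_dom_core.
  by rewrite L2_norm_lt//; apply: sq_integrableB => //; exact: C_sq.
- exact: (nf_dom HD).
- exact: (nf_linear HD).
- exact: (nf_sym HD).
- exact: (nf_ge0 HD).
- move=> a Da.
  have sa n : sq_integrable m (a n) by have /closure_domP[b []] := Da n.
  move=> /(L2_cauchyP sa) qa ca.
  have [u su au] := sq_complete sa qa.
  (* Closedness by a diagonal choice: each [a n] is replaced by a core function within [hs n], in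
     L^2 and in energy, and this new sequence approximates the L^2-limit [u]. *)
  have /choice[c Hc] n : exists c, [/\ C c, sq_norm m (c \- a n) < hs n &
      Eb (c \- a n) (c \- a n) < hs n].
    by apply: closure_form_approx => //; exact: hs_gt0.
  have Cc n : C (c n) by case: (Hc n).
  have harm0 n : 0 <= hs n by exact/ltW/hs_gt0.
  have harm : hs n @[n --> \oo] --> (0 : R) by exact: cvg_harmonic.
  have Dc n := closure_dom_core (Cc n).
  have ap : form_approx u c.
    split=> //.
      (* Two triangle inequalities cost 2 + 4 + 4 shares of e / 16. *)
      move=> e e0; have e16 : 0 < e / 16 by rewrite divr_gt0.
      have [N1 H1] := ca _ e16.
      have [N2 H2] := cvg0_lt harm0 harm e16.
      exists (maxn N1 N2) => j k; rewrite !geq_max => /andP[j1 j2] /andP[k1 k2].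
      rewrite -closure_form_core; [|exact: CB|exact: CB].
      have t1 := nf_triangle HD (Dc j) (Da j) (Dc k).
      have t2 := nf_triangle HD (Da j) (Da k) (Dc k).
      have t3 := H1 j k j1 k1; have [_ _ t4] := Hc j; have [_ _ t5] := Hc k.
      rewrite (nf_subC HD (Da k) (Dc k)) in t2.
      have {}t4 := lt_trans t4 (H2 j j2); have {}t5 := lt_trans t5 (H2 k k2).
      lra.
    apply: (cvg0_le (c := 2) (y := fun n => hs n + sq_norm m (a n \- u))).
    - by move=> n; exact: sq_norm_ge0.
    - move=> n; have := sq_normBle (C_sq (Cc n)) (sa n) su.
      have [_ t _] := Hc n; lra.
    - by rewrite -(addr0 (0 : R)); exact: cvgD.
  have Du : D u by apply/closure_domP; exists c.
  exists u; split=> //; first exact/(L2_cvgP sa su).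
  have cu : Eb (c n \- u) (c n \- u) @[n --> \oo] --> (0 : R).
    apply/cvgrPdist_lt => e e0; have e2 : 0 < e / 2 by rewrite divr_gt0.
    have [_ _ cc _] := ap; have [N HN] := cc _ e2.
    near=> n; rewrite sub0r normrN ger0_norm; last exact/(nf_ge0 HD)/(nf_domB HD).
    have h := form_approxB (form_approx_core (Cc n)) ap.
    apply: (@le_lt_trans _ _ (e / 2)); last by rewrite ltr_pdivrMr// ltr_pMr// ltr1n.
    have Nn : (N <= n)%N by near: n; exact: nbhs_infty_ge.
    apply: (cvgr_to_le (closure_form_cvg h h)); exists N => // j Nj /=.
    exact/ltW/HN.
  apply: (cvg0_le (c := 2) (y := fun n => hs n + Eb (c n \- u) (c n \- u))).
  - by move=> n; exact/(nf_ge0 HD)/(nf_domB HD).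
  - move=> n; have := nf_triangle HD (Da n) (Dc n) Du.
    rewrite (nf_subC HD (Da n) (Dc n)); have [_ _] := Hc n; lra.
  - by rewrite -(addr0 (0 : R)); exact: cvgD.
- move=> u Du; exact: closure_markov.
Unshelve. all: by end_near. Qed.

End closure.

(** * The associated semigroup fixes the constants *)

Section semigroup_one.
Context {R : realType} {dX} {X : measurableType dX} (m : probability X R).

Let one : X -> R := cst 1.

Let L2one : one \in Lfun m 2%:E. Proof. exact/L2P/sq_integrable_cst. Qed.

Let L2_inner_ae (u u' v v' : X -> R) : u = u' %[ae m] -> v = v' %[ae m] ->
  L2_inner m u v = L2_inner m u' v'.
Proof.
move=> uu' vv'; rewrite /L2_inner /Rintegral; congr fine; apply: integral_ae_congr.
by apply: filterS2 uu' vv' => x hu hv _; rewrite hu// hv.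
Qed.

(* With h t = 1 - (Q_t 1, 1), contractivity and the identity
   |Q_t 1 - 1|^2 = 2 h t - h (2 t) give 0 <= h (2 t) <= 2 h t, so that h t / t is
   at most its limit E(1, 1) at 0. *)
Lemma semigroup_one (D : set (X -> R)) (E : (X -> R) -> (X -> R) -> R)
    (Q : R -> (X -> R) -> X -> R) : D one -> E one one = 0 ->
  semigroup_of m D E Q -> forall t, 0 <= t -> Q t one = one %[ae m].
Proof.
move=> D1 E1 sg.
have sQ t : 0 <= t -> sq_integrable m (Q t one).
  by move=> t0; apply/L2P/(sg_L2 sg).
have s1 : sq_integrable m one by exact: sq_integrable_cst.
have n1 : sq_norm m one = 1 by rewrite sq_norm_cst expr1n.
pose h t := 1 - L2_inner m (Q t one) one.
have h2 s : 0 <= s -> L2_inner m (Q (s + s) one) one = sq_norm m (Q s one).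
  move=> s0; have one_ae : one = one %[ae m] by exact: nearW.
  rewrite (L2_inner_ae (sg_add sg s0 s0 L2one) one_ae).
  rewrite (sg_sym sg s0 (sg_L2 sg s0 L2one) L2one).
  by rewrite /L2_inner /sq_norm; apply: eq_Rintegral => x _; rewrite expr2.
have contr s : 0 <= s -> sq_norm m (Q s one) <= 1.
  move=> s0; have := sg_contr sg s0 L2one.
  rewrite !L2_norm_sqrt//; last exact: sQ.
  by rewrite lee_fin n1 ler_sqrt.
have qdiff s : 0 <= s -> sq_norm m (Q s one \- one) = 2 * h s - h (s + s).
  move=> s0; rewrite (_ : _ \- _ = fun x => (-1) * one x + Q s one x); last first.
    by apply/funext => x /=; rewrite mulN1r addrC.
  rewrite sq_norm_linear//; last exact: sQ.
  rewrite n1 /h h2// sqrrN expr1n.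
  have -> : L2_inner m one (Q s one) = L2_inner m (Q s one) one.
    by apply: eq_Rintegral => x _; rewrite mulrC.
  by ring.
have hge0 s : 0 <= s -> 0 <= h (s + s).
  by move=> s0; rewrite /h h2// subr_ge0 contr.
have hdbl s : 0 <= s -> h (s + s) <= 2 * h s.
  by move=> s0; rewrite -subr_ge0 -qdiff// sq_norm_ge0.
have hpow n s : 0 <= s -> h s <= 2 ^+ n * h (s / 2 ^+ n).
  elim: n s => [|n ih] s s0; first by rewrite expr0 divr1 mul1r.
  apply: (le_trans (ih s s0)).
  have e1 : s / 2 ^+ n = s / 2 ^+ n.+1 + s / 2 ^+ n.+1.
    by rewrite exprS; field; rewrite expf_neq0.
  rewrite e1 [X in _ <= X * _]exprSr -mulrA ler_pM2l ?exprn_gt0//; apply: hdbl.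
  by rewrite divr_ge0// exprn_ge0.
have lim0 e : 0 < e -> exists2 dl : R, 0 < dl & forall s, 0 < s -> s < dl -> h s <= e * s.
  move=> e0; have := sg_form sg D1 D1; rewrite E1 => /cvgrPdist_lt/(_ _ e0).
  move=> [/= dl dl0 Hdl]; exists dl => // s s_gt0 sdl.
  have := Hdl s; rewrite /ball_ /= !sub0r !normrN (gtr0_norm s_gt0) => /(_ sdl s_gt0).
  have -> : L2_inner m (one \- Q s one) one = h s.
    rewrite /L2_inner (_ : \int[m]_x _ = \int[m]_x (one x * one x - Q s one x * one x)).
      rewrite RintegralB//; last first.
        by apply: (sq_integrable_mul (sQ s (ltW s_gt0)) s1).
      by apply: (sq_integrable_mul s1 s1).
      rewrite /h; congr (_ - _); rewrite -n1; apply: eq_Rintegral => x _.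
      by rewrite expr2.
    by apply: eq_Rintegral => x _ /=; rewrite mulrBl.
  move=> hs; apply: ltW; rewrite -ltr_pdivrMr//; apply: le_lt_trans hs.
  exact: ler_norm.
have hle0 t : 0 < t -> h t <= 0.
  move=> t0; apply/ler_addgt0Pl => e e0; rewrite addr0.
  have et : 0 < e / t by rewrite divr_gt0.
  have [dl dl0 Hdl] := lim0 _ et.
  (* Since 2^n > n > t / dl, halving [t] this many times brings it below [dl]. *)
  pose n := (Num.truncn (t / dl)).+1.
  have tn : t / 2 ^+ n < dl.
    rewrite ltr_pdivrMr ?exprn_gt0// mulrC -ltr_pdivrMr//.
    apply: (lt_trans (truncnS_gt _)); rewrite -/n -natrX ltr_nat.
    exact: ltn_expl.
  have tn0 : 0 < t / 2 ^+ n by rewrite divr_gt0// exprn_gt0.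
  apply: (le_trans (hpow n t (ltW t0))).
  have := Hdl _ tn0 tn; rewrite -(ler_pM2l (exprn_gt0 n (ltr0Sn R 1))) => /le_trans; apply.
  rewrite le_eqVlt; apply/orP; left; apply/eqP; field.
  by rewrite expf_neq0// gt_eqF.
move=> t t0; have [->|tn0] := eqVneq t 0; first exact: (sg_0 sg).
have tp : 0 < t by rewrite lt_neqAle eq_sym tn0.
have h0 : h t = 0.
  apply/eqP; rewrite eq_le hle0//=.
  have tt : t = t / 2 + t / 2 by field.
  by rewrite {1}tt hge0// divr_ge0.
have h20 : h (t + t) = 0.
  by apply/eqP; rewrite eq_le hle0 ?addr_gt0//= hge0.
have q0 : sq_norm m (Q t one \- one) = 0 by rewrite qdiff// h0 h20; ring.
have sd := sq_integrableB (sQ t t0) s1.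
have /(ae_eq_integral_abs m measurableT) : (\int[m]_x `|(((Q t one \- one) x) ^+ 2)%:E| = 0)%E.
  rewrite -[RHS](_ : (sq_norm m (Q t one \- one))%:E = 0%E); last by rewrite q0.
  rewrite -sq_normE//; apply: eq_integral => x _.
  by rewrite /= ger0_norm ?sqr_ge0.
move=> H; have : ae_eq m setT (fun x => (((Q t one \- one) x) ^+ 2)%:E) (cst 0%E).
  by apply: H; apply/measurable_EFinP; apply: measurable_funX; case: sd.
apply: filterS => x hx _; have := hx I => /eqP.
by rewrite eqe sqrf_eq0 /= subr_eq0 => /eqP.
Qed.

End semigroup_one.

Section closure_conservative.
Context {R : realType} {dX} {X : measurableType dX} (m : probability X R).
Variables (C : set (X -> R)) (E : (X -> R) -> (X -> R) -> R).
Hypotheses (C_sq : forall u, C u -> sq_integrable m u) (HE : nonneg_form C E)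
  (E_closable : closable m C E) (C1 : C (cst 1)) (E1 : E (cst 1) (cst 1) = 0).

Lemma closure_conservative :
  conservative m (closure_dom m C E) (closure_form m C E).
Proof.
have D1 : closure_dom m C E (cst 1) by exact: closure_dom_core.
have Eb1 : closure_form m C E (cst 1) (cst 1) = 0 by rewrite closure_form_core.
split=> // Q sg t t0; exact: semigroup_one sg _ t0.
Qed.

End closure_conservative.

(** * Gradients of cylinder functions *)

Section primitive.
Context {R : realType}.
Local Notation mu := (@lebesgue_measure R).
Implicit Types (f : R -> R).

Lemma bounded_integrable_itv f (C : R) (i : interval R) :
  measurable_fun setT f -> (mu [set` i] < +oo)%E ->
  (forall t, t \in i -> `|f t| <= C) -> mu.-integrable [set` i] (EFin \o f).
Proof.
move=> mf ifin fC; have mi : measurable [set` i] by exact: measurable_itv.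
apply: (@le_integrable _ _ _ mu [set` i] mi _ (EFin \o cst C)).
- by apply/measurable_EFinP; exact: measurable_funTS.
- move=> t /= it; rewrite lee_fin (le_trans (fC t it))// ler_norm//.
- apply/integrableP; split; first by apply/measurable_EFinP; exact: measurable_cst.
  under eq_integral do rewrite /=.
  by rewrite integral_cst//; apply: lte_mul_pinfty.
Qed.

Lemma lebesgue_itv_lty (a b : R) : (mu `]a, b] < +oo)%E.
Proof. by rewrite lebesgue_measure_itv/=; case: ifP => _; rewrite ?ltry// -EFinB ltry. Qed.

Variable q : R -> R.
Hypotheses (mq : measurable_fun setT q) (q_ge0 : forall t, 0 <= q t)
  (q_bnd : forall a, exists C : R, forall t, t <= a -> q t <= C).

Definition primitive (x : R) : R := \int[mu]_(t in `]0, x]) q t.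

Lemma weight_integrable (a b : R) : mu.-integrable `]a, b] (EFin \o q).
Proof.
have [C qC] := q_bnd b.
apply: (bounded_integrable_itv (C := C)) => //; first exact: lebesgue_itv_lty.
by move=> t; rewrite in_itv/= => /andP[_ tb]; rewrite ger0_norm// qC.
Qed.

Lemma primitive_neg x : x <= 0 -> primitive x = 0.
Proof.
move=> x0; rewrite /primitive set_itv_ge ?Rintegral_set0//.
by rewrite bnd_simp -leNgt.
Qed.

Lemma primitive0 : primitive 0 = 0. Proof. exact: primitive_neg. Qed.

Lemma primitive_ge0 x : 0 <= primitive x.
Proof. by apply: Rintegral_ge0 => t _; exact: q_ge0. Qed.

Lemma primitiveB x y : 0 <= x -> x <= y ->
  primitive y - primitive x = \int[mu]_(t in `]x, y]) q t.
Proof.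
move=> x0 xy; rewrite /primitive Rintegral_itvB//; last exact: weight_integrable.
Qed.

Lemma primitive_lip a : exists C : R, 0 <= C /\ forall x y, x <= y -> y <= a ->
  0 <= primitive y - primitive x <= C * (y - x).
Proof.
have [C qC] := q_bnd a; exists `|C|; split=> // x y xy ya.
have main u v : 0 <= u -> u <= v -> v <= a ->
    0 <= primitive v - primitive u <= `|C| * (v - u).
  move=> u0 uv va; rewrite primitiveB//; apply/andP; split.
    by apply: Rintegral_ge0 => t _; exact: q_ge0.
  apply: (@le_trans _ _ (\int[mu]_(t in `]u, v]) cst `|C| t)).
    apply: le_Rintegral => //; first exact: weight_integrable.
      apply: (bounded_integrable_itv (C := `|C|)) => //; first exact: lebesgue_itv_lty.
      by move=> t _; rewrite /= normr_id.
    move=> t /=; rewrite in_itv/= => /andP[_ tv].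
    by rewrite (le_trans (qC t _)) ?ler_norm// (le_trans tv).
  have -> : \int[mu]_(t in `]u, v]) cst `|C| t = `|C| * fine (mu `]u, v]).
    by rewrite Rintegral_cst.
  rewrite lebesgue_measure_itv/= lte_fin.
  by case: ltP => [_|vu]; rewrite /= ?mulr0// mulr_ge0// subr_ge0.
have [y0|y0] := leP y 0.
  by rewrite !primitive_neg ?subrr ?(le_trans xy)// lexx/= mulr_ge0// subr_ge0.
have [x0|x0] := leP 0 x; first exact: main.
have /andP[h1 h2] := main 0 y (lexx 0) (ltW y0) ya.
rewrite primitive0 in h1 h2; rewrite (primitive_neg (ltW x0)) h1 (le_trans h2)// ler_wpM2l//.
by rewrite lerD2l lerN2 ltW.
Qed.

Lemma primitive_le x y : x <= y -> primitive x <= primitive y.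
Proof.
move=> xy; have [C [_ H]] := primitive_lip y.
by rewrite -subr_ge0; have /andP[] := H x y xy (lexx y).
Qed.

Lemma measurable_primitive : measurable_fun setT primitive.
Proof. by apply: nondecreasing_measurable => // x y; exact: primitive_le. Qed.

Lemma primitive_is_derive (a : R) :
  {ae mu, forall t : R, 0 < t < a -> is_derive t 1 primitive (q t)}.
Proof.
(* The weight may fail to be integrable on the line; cutting it off after [a] leaves its primitive
   unchanged on ]-oo, a]. *)
pose f t := q t * \1_(`]0, a]) t.
have intf : mu.-integrable setT (EFin \o f).
  have := weight_integrable 0 a; rewrite integrable_mkcond//.
  apply: eq_integrable => // t _; rewrite /f /= patchE indicE.
  by case: ifP => _; rewrite ?mulr1 ?mulr0.
have locf : locally_integrable setT f.
  by apply: open_integrable_locally => //; exact: openT.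
have intf' (y : R) : mu.-integrable [set` Interval (BRight 0) (BRight y)] (EFin \o f).
  by apply: integrableS intf.
have := FTC1 intf' locf.
apply: filterS; first exact: (ae_filter_ringOfSetsType mu).
move=> x Hx /andP[x0 xa].
have [dF FE] := Hx x0.
have fx : f x = q x by rewrite /f indicE mem_set ?mulr1//= in_itv/= x0 ltW.
have dF' : is_derive x 1 (fun y => \int[mu]_(t in `]0, y]) f t) (q x).
  by rewrite -fx; apply: DeriveDef; rewrite -?derive1E.
apply: near_eq_is_derive dF'.
near=> y; have ya : y <= a by apply/ltW; near: y; exact: lt_nbhsl.
apply: eq_Rintegral => t; rewrite inE/= in_itv/= => /andP[t0 ty].
by rewrite /f indicE mem_set ?mulr1//= in_itv/= t0 (le_trans ty).
Unshelve. all: by end_near. Qed.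

(** The reproducing kernel at time [a]: its derivative is the weight before [a] and 0 afterwards, so
    its weighted inner product with a path h integrates h' over ]0, a[. *)
Definition stopped a t := primitive (Num.min t a).

(** The increment is measured by that of min x a instead of y - x, so that sums over a partition
    telescope to at most [a]. One constant serves all a <= b. *)
Lemma stopped_lip_min (b : R) : exists C : R, 0 <= C /\ forall a x y : R, a <= b -> x <= y ->
  `|stopped a y - stopped a x| <= C * (Num.min y a - Num.min x a).
Proof.
have [C [C0 H]] := primitive_lip b; exists C; split=> // a x y ab xy.
have mxy : Num.min x a <= Num.min y a by rewrite le_min2.
have yb : Num.min y a <= b by rewrite ge_min ab orbT.
by have /andP[h1 h2] := H _ _ mxy yb; rewrite /stopped ger0_norm.
Qed.

Lemma stopped_lip (a : R) : exists C : R, 0 <= C /\ forall x y,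
  `|stopped a y - stopped a x| <= C * `|y - x|.
Proof.
have [C [C0 H]] := stopped_lip_min a; exists C; split=> // x y.
wlog xy : x y / x <= y.
  by move=> h; have [/h//|/ltW/h] := leP x y; rewrite distrC [`|x - y|]distrC.
apply: (le_trans (H a x y (lexx a) xy)); rewrite ler_wpM2l// ger0_norm ?subr_ge0//.
by rewrite /Num.min; case: ifP => ?; case: ifP => ?; lra.
Qed.

Lemma stopped_is_derive (a : R) : {ae mu, forall t : R, 0 < t ->
  is_derive t 1 (stopped a) (if t < a then q t else 0)}.
Proof.
have ta : {ae mu, forall t : R, t != a}.
  exists [set a]; split; [by []|exact: lebesgue_measure_set1|].
  by move=> t /= /negP; rewrite negbK => /eqP.
have pd := primitive_is_derive a.
apply: filterS2 ta pd; first exact: (ae_filter_ringOfSetsType mu).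
move=> t ta hd t0; case: ltP => [lta|lea].
  apply: near_eq_is_derive (hd _); last by rewrite t0.
  near=> y; rewrite /stopped min_l// ltW//; near: y; exact: lt_nbhsl.
have lta : a < t by rewrite lt_neqAle eq_sym ta.
apply: near_eq_is_derive (is_derive_cst (primitive a) t 1).
near=> y; rewrite /stopped min_r// ltW//; near: y; exact: lt_nbhsr.
Unshelve. all: by end_near. Qed.

End primitive.

Section paths.
Context {R : realType} (d : nat) (M : \bar R).
Local Notation mu := (@lebesgue_measure R).

Lemma abs_continuous_entry (h : R -> 'rV[R]_d) a k :
  abs_continuous h a -> ac_on a (fun t => h t ord0 k).
Proof.
move=> ach e e0; have [dl dl0 H] := ach e e0; exists dl => // s sub nov sum.
pose u (i : 'I_(size s)) := (nth (0, 0) s i).1.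
pose v (i : 'I_(size s)) := (nth (0, 0) s i).2.
have E (F : R * R -> R) : \sum_(I <- s) F I = \sum_(i < size s) F (u i, v i).
  rewrite (big_nth (0, 0)) big_mkord; apply: eq_bigr => i _.
  by rewrite /u /v -surjective_pairing.
rewrite E; apply: ltW; apply: le_lt_trans (H _ u v _ _ _).
- apply: ler_sum => i _ /=; rewrite (_ : _ - _ = (h (v i) - h (u i)) ord0 k); last first.
    by rewrite !mxE.
  rewrite {2}/Num.Def.normr/= mx_normrE.
  exact: (le_bigmax _ (fun ij => `|(h (v i) - h (u i)) ij.1 ij.2|) (ord0, k)).
- move=> i; have /allP/(_ (nth (0, 0) s i)) := sub.
  by rewrite mem_nth// => /(_ isT) /andP[/andP[]].
- apply/trivIsetP => i j _ _ ij.
  have /(pairwiseP (0, 0)) P := nov.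
  wlog lij : i j ij / (i < j)%N.
    move=> W; have : (i != j :> nat) by [].
    rewrite neq_ltn => /orP[ltij|ltji]; first exact: W.
    by rewrite setIC; apply: W => //; rewrite eq_sym.
  have := P i j; rewrite !inE => /(_ (ltn_ord i) (ltn_ord j) lij).
  apply: contraPeq => /set0P[t [/=]]; rewrite !in_itv/= => /andP[a1 a2] /andP[b1 b2].
  rewrite /u /v in a1 a2 b1 b2.
  by apply/negP; rewrite negb_or -!ltNge (lt_trans b1 a2) (lt_trans a1 b2).
- by rewrite -(E (fun I => I.2 - I.1)).
Qed.

Lemma wpath_continuous_entry (h : wpath d M) a k : time_dom M a ->
  {within `[0, a], continuous (fun t => h t ord0 k)}.
Proof.
move=> [_ aM]; have [_ ch _] := wpathP h.
have sub : `[0, a] `<=` time_dom M.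
  move=> t /=; rewrite in_itv/= => /andP[t0 ta]; split=> //.
  by apply: le_trans aM; rewrite lee_fin.
have := continuous_subspaceW sub ch => {}ch x.
apply: (@continuous_comp _ _ _ (fun t : subspace `[0, a] => h t) (fun v : 'rV[R]_d => v ord0 k)).
  exact: ch.
exact: coord_continuous.
Qed.

Lemma derive1_row (h : R -> 'rV[R]_d) (t : R) (v : 'I_d -> R) :
  (forall k, is_derive t 1 (fun s : R => h s ord0 k) (v k)) ->
  derive1 h t = \row_k v k.
Proof.
move=> dh; have D : derivable h t 1.
  by apply/derivable_mxP => i k; rewrite ord1; case: (dh k).
rewrite derive1E derive_mx//; apply/matrixP => i k; rewrite !mxE ord1.
by case: (dh k).
Qed.

End paths.

Lemma ae_forall_fin {R : realType} {dT} {T : measurableType dT}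
    (m : {measure set T -> \bar R}) (I : finType) (P : I -> T -> Prop) :
  (forall i, {ae m, forall x, P i x}) -> {ae m, forall x, forall i, P i x}.
Proof.
move=> Pae; suff H (s : seq I) : {ae m, forall x, forall i, i \in s -> P i x}.
  have := H (enum I); apply: filterS => x hx i; exact/hx/mem_enum.
elim: s => [|i s ih]; first by apply: nearW.
apply: filterS2 (Pae i) ih => x Pi Ps j; rewrite inE => /predU1P[->//|]; exact: Ps.
Qed.

Lemma is_derive_sumr {R : realType} (I : Type) (s : seq I) (f : I -> R -> R) (t : R) (df : I -> R) :
  (forall i, is_derive t 1 (f i) (df i)) ->
  is_derive t 1 (fun x : R => \sum_(i <- s) f i x) (\sum_(i <- s) df i).
Proof.
move=> dfi; elim: s => [|i s ih].
  by rewrite big_nil; under eq_fun do rewrite big_nil; exact: is_derive_cst.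
by rewrite big_cons; under eq_fun do rewrite big_cons; exact: is_deriveD.
Qed.

Section Rintegral_sums_dom.
Context {R : realType} {dT} {T : measurableType dT} (m : {measure set T -> \bar R}).
Variables (D : set T) (mD : measurable D).

Lemma integrable_sum_dom (I : Type) (s : seq I) (f : I -> T -> R) :
  (forall i, m.-integrable D (EFin \o f i)) ->
  m.-integrable D (EFin \o (fun x => \sum_(i <- s) f i x)).
Proof.
move=> intf; have := integrable_sum mD s (P := xpredT) (fun i _ => intf i).
by apply: eq_integrable => // x _ /=; rewrite sumEFin.
Qed.

Lemma Rintegral_sum_dom (I : Type) (s : seq I) (f : I -> T -> R) :
  (forall i, m.-integrable D (EFin \o f i)) ->
  \int[m]_(x in D) (\sum_(i <- s) f i x) = \sum_(i <- s) \int[m]_(x in D) f i x.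
Proof.
move=> intf; elim: s => [|i s ih].
  rewrite big_nil; under eq_Rintegral do rewrite big_nil.
  by rewrite /Rintegral integral0.
rewrite big_cons -ih -RintegralD//; last exact: integrable_sum_dom.
by apply: eq_Rintegral => x _; rewrite big_cons.
Qed.

End Rintegral_sums_dom.

(** * The Riesz representative of a combination of evaluations *)

Section gradient_path.
Context {R : realType} (d : nat) (M : \bar R) (p : R -> R) (kappa : R) (q : R -> R).
Local Notation mu := (@lebesgue_measure R).
Hypotheses (mq : measurable_fun setT q) (q_ge0 : forall t, 0 <= q t)
  (q_bnd : forall a, exists C : R, forall t, t <= a -> q t <= C)
  (qp : forall t, open_time_dom M t -> q t * p t `^ kappa = 1).
Variables (n : nat) (a : 'I_n -> R) (c : 'I_n -> 'I_d -> R).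
Hypothesis a_ge0 : forall i, 0 <= a i.

Let valid i := `[< time_dom M (a i) >].
Let cv i k := (valid i)%:R * c i k.
Let gsum (t : R) : 'rV[R]_d := \row_k \sum_i cv i k * stopped q (a i) t.

(** Represents h |-> sum over i, k of c i k times the k-th coordinate of h (a i). The coefficients
    [cv] suppress the times beyond [M], where extended paths vanish. *)
Definition gradient_fun (t : R) : 'rV[R]_d :=
  if `[< time_dom M t >] then gsum t else 0.

Let gsum_lip : exists C : R, 0 <= C /\ forall x y, `|gsum y - gsum x| <= C * `|y - x|.
Proof.
have /choice[C HC] i := stopped_lip mq q_ge0 q_bnd (a i).
exists (\sum_k \sum_i `|cv i k| * C i); split.
  by apply: sumr_ge0 => k _; apply: sumr_ge0 => i _; rewrite mulr_ge0//; case: (HC i).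
move=> x y; rewrite {1}/Num.Def.normr/= mx_normrE; apply: bigmax_le.
  rewrite mulr_ge0//; apply: sumr_ge0 => k _; apply: sumr_ge0 => i _.
  by rewrite mulr_ge0//; case: (HC i).
move=> [z k] _ /=; rewrite !mxE -sumrB.
rewrite (bigD1 k)//= mulrDl; apply: ler_wpDr.
  rewrite mulr_ge0//; apply: sumr_ge0 => l _; apply: sumr_ge0 => i _.
  by rewrite mulr_ge0//; case: (HC i).
rewrite (le_trans (ler_norm_sum _ _ _))// mulr_suml; apply: ler_sum => i _.
by rewrite -mulrBr normrM -mulrA ler_wpM2l//; case: (HC i).
Qed.

Let gsum_continuous : continuous gsum.
Proof.
have [C [C0 HC]] := gsum_lip => x; apply/cvgrPdist_lt => e e0.
have C1 : 0 < C + 1 by rewrite ltr_wpDl.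
apply/nbhs_ballP; exists (e / (C + 1)) => /=; first by rewrite divr_gt0.
move=> y; rewrite /ball/= => h; apply: (le_lt_trans (HC y x)).
rewrite ltr_pdivlMr// in h; apply: le_lt_trans h.
by rewrite mulrC ler_wpM2l// lerDl.
Qed.

Lemma gradient_funP : is_wpath M gradient_fun.
Proof.
split.
- rewrite /gradient_fun; case: asboolP => // _; apply/rowP => k; rewrite !mxE.
  by rewrite big1// => i _; rewrite /stopped min_l// primitive0 mulr0.
- apply: (@subspace_eq_continuous _ _ _ gsum); last exact: continuous_subspaceT gsum_continuous.
  by move=> x; rewrite inE => xM; rewrite /from_subspace /gradient_fun asboolT.
- by move=> t tM; rewrite /gradient_fun asboolF.
Qed.

Definition gradient_path : wpath d M := WPath gradient_funP.

Let open_near (t : R) : open_time_dom M t -> \forall s \near t, time_dom M s.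
Proof.
move=> [t0 tM].
have h : \forall s \near t, (s%:E <= M)%E.
  case: M tM => [r| |]//=; rewrite ?lte_fin => tr; near=> s; last by rewrite leey.
  rewrite lee_fin ltW//; near: s; exact: lt_nbhsl.
near=> s; split; last by near: s.
by apply/ltW; near: s; exact: lt_nbhsr.
Unshelve. all: by end_near. Qed.

Let gD (t : R) k := \sum_i cv i k * (if t < a i then q t else 0).

Let gradient_is_derive (t : R) k : open_time_dom M t ->
  (forall i, 0 < t -> is_derive t 1 (stopped q (a i)) (if t < a i then q t else 0)) ->
  is_derive t 1 (fun s : R => gradient_fun s ord0 k) (gD t k).
Proof.
move=> tM Ht; have t0 : 0 < t by case: tM.
have D : is_derive t 1 (fun s : R => \sum_i cv i k * stopped q (a i) s) (gD t k).
  apply: is_derive_sumr => i; have := Ht i t0 => dH.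
  by have := @is_deriveZ _ _ _ (stopped q (a i)) (cv i k) t 1 _ dH.
apply: near_eq_is_derive D; near=> s.
rewrite /gradient_fun asboolT ?mxE//; near: s; exact: open_near.
Unshelve. all: by end_near. Qed.

Let gradient_derive1 :
  {ae mu, forall t, open_time_dom M t -> derive1 gradient_fun t = \row_k gD t k}.
Proof.
have := ae_forall_fin (fun i => stopped_is_derive mq q_ge0 q_bnd (a i)).
by apply: filterS => t Ht tM; apply: derive1_row => k; exact: gradient_is_derive.
Qed.

(** The weight in the derivative of [gradient_fun] cancels the power of [p], leaving the derivatives
    of h on the intervals ]0, a i[. It serves for a general path of the space and for the
    representative itself. *)
Lemma gradient_integrand (h : R -> 'rV[R]_d) (f : 'I_n -> 'I_d -> R -> R) :
  (forall i k, valid i ->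
    {ae mu, forall t : R, 0 < t < a i -> is_derive t 1 (fun s : R => h s ord0 k) (f i k t)}) ->
  {ae mu, forall t, open_time_dom M t ->
    dotr (derive1 gradient_fun t) (derive1 h t) * p t `^ kappa =
    \sum_i \sum_k cv i k * (f i k t * \1_(`]0, a i[) t)}.
Proof.
move=> hf.
have H : {ae mu, forall t : R, forall ik : 'I_n * 'I_d, valid ik.1 -> 0 < t < a ik.1 ->
    is_derive t 1 (fun s : R => h s ord0 ik.2) (f ik.1 ik.2 t)}.
  apply: ae_forall_fin => -[i k] /=.
  case: (boolP (valid i)) => vi; last by apply: nearW.
  have := hf i k vi; apply: filterS; first exact: (ae_filter_ringOfSetsType mu).
  by move=> t Ht _.
apply: filterS2 gradient_derive1 H; first exact: (ae_filter_ringOfSetsType mu).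
move=> t gt Ht tM; rewrite gt// /dotr mulr_suml exchange_big/=.
apply: eq_bigr => k _; rewrite mxE !mulr_suml; apply: eq_bigr => i _.
have t0 : 0 < t by case: tM.
have [tai|tai] := ltP t (a i); last first.
  by rewrite indicE memNset ?mulr0 ?mul0r// /= in_itv/= t0 ltNge tai.
rewrite indicE mem_set ?mulr1//=; last by rewrite in_itv/= t0.
have [vi|vi] := boolP (valid i); last by rewrite /cv (negbTE vi) !mul0r.
have -> : derive1 h t = \row_k f i k t.
  by apply: derive1_row => l; have := Ht (i, l) vi; rewrite t0 tai; exact.
rewrite mxE.
have := qp tM; move: (p t `^ kappa) (q t) => P Q QP.
by rewrite -mulrA -mulrA [Q * _]mulrCA QP mulr1.
Qed.

Let open_time_dom_meas : measurable (open_time_dom M : set (measurableTypeR R)).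
Proof.
rewrite (_ : open_time_dom M = `]0, +oo[ `&` [set t | (t%:E < M)%E]); last first.
  by apply/seteqP; split => t /=; rewrite in_itv/= andbT.
apply: measurableI => //; case: M => [r| |] /=.
- by rewrite (_ : [set _ | _] = `]-oo, r[%classic).
- by rewrite (_ : [set _ | _] = setT)//; apply/seteqP; split => t //= _; rewrite ltry.
- by rewrite (_ : [set _ | _] = set0)//; apply/seteqP; split => t.
Qed.

Let int_term i (f : R -> R) : valid i ->
  mu.-integrable `]0, a i[ (EFin \o f) ->
  mu.-integrable (open_time_dom M) (EFin \o (fun t => f t * \1_(`]0, a i[) t)) /\
  \int[mu]_(t in open_time_dom M) (f t * \1_(`]0, a i[) t) =
    \int[mu]_(t in `]0, a i[) f t.
Proof.
move=> /asboolP[_ aM] intf.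
have sub : `]0, a i[ `<=` open_time_dom M.
  move=> t /=; rewrite in_itv/= => /andP[t0 ta]; split=> //.
  by apply: lt_le_trans aM; rewrite lte_fin.
have E : (fun t : R => f t * \1_(`]0, a i[) t) = f \_ `]0, a i[.
  apply/funext => t; rewrite patchE indicE; case: ifPn => _; rewrite ?mulr1 ?mulr0//.
split; last first.
  rewrite E -Rintegral_mkcondr; congr (Rintegral _ _ _).
  by apply/seteqP; split => t /=; [case|move=> ta; split=> //; exact: sub].
have I2 : mu.-integrable (open_time_dom M) (EFin \o (fun t => f t * \1_(`]0, a i[) t)).
  rewrite E; apply/integrable_mkcond => //.
  have : mu.-integrable setT ((EFin \o f) \_ `]0, a i[).
    by apply/(integrable_mkcond _ _).1.
  apply: eq_integrable => // t _; rewrite !patchE /= patchE.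
  case: (boolP (t \in `]0%R, a i[%classic)) => [ta|_]; last by case: ifP.
  by rewrite mem_set//; apply: sub; rewrite -inE.
exact: I2.
Qed.

(** After the cancellation of the weights, the fundamental theorem of calculus on each [[0, a i]]
    returns the values [h (a i)]. *)
Lemma gradient_inner (h : wpath d M) : H_space p kappa h ->
  H_inner p kappa gradient_path h = \sum_i \sum_k c i k * h (a i) ord0 k.
Proof.
move=> [ach _].
have Hf ik : exists f : R -> R, [/\ mu.-integrable setT (EFin \o f),
    valid ik.1 -> {ae mu, forall t : R, 0 < t < a ik.1 ->
      is_derive t 1 (fun s : R => h s ord0 ik.2) (f t)} &
    valid ik.1 -> h (a ik.1) ord0 ik.2 = \int[mu]_(t in `]0, a ik.1[) f t].
  have [vi|nvi] := pselect (valid ik.1); last first.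
    by exists (cst 0); split=> //; exact: integrable0.
  (* The fundamental theorem is stated for intervals of positive length; at time 0 the path
     vanishes. *)
  have [a0|a0] := eqVneq (a ik.1) 0.
    exists (cst 0); split=> //; first exact: integrable0.
      by move=> _; apply: nearW => t; rewrite a0 => /andP[/lt_trans h1 /h1]; rewrite ltxx.
    move=> _; rewrite a0 set_itv_ge ?Rintegral_set0 ?bnd_simp -?leNgt//.
    by have [-> _ _] := wpathP h; rewrite mxE.
  have ap : 0 < a ik.1 by rewrite lt_neqAle eq_sym a0 a_ge0.
  have dom : time_dom M (a ik.1) by exact/asboolP.
  have [f [intf fE df]] := ac_FTC ap (abs_continuous_entry ik.2 (ach _ dom))
    (@wpath_continuous_entry _ _ _ h _ ik.2 dom).
  exists f; split=> // _; rewrite Rintegral_itv_bndo_bndc; last first.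
    by apply: integrableS intf.
  rewrite -fE ?(ltW ap)//; have [-> _ _] := wpathP h; by rewrite mxE subr0.
have /choice[f {}Hf] := Hf.
have ae := @gradient_integrand h (fun i k => f (i, k)) (fun i k vi =>
  let: And3 _ H _ := Hf (i, k) in H vi).
rewrite /H_inner /Rintegral (@integral_ae_congr _ _ _ mu _ _
  (EFin \o (fun t => \sum_i \sum_k cv i k * (f (i, k) t * \1_(`]0, a i[) t)))); last first.
  move: ae; apply: filterS; first exact: (ae_filter_ringOfSetsType mu).
  by move=> t /[apply] ->.
have I0 i k : valid i -> mu.-integrable (open_time_dom M)
    (EFin \o (fun t => f (i, k) t * \1_(`]0, a i[) t)).
  move=> vi; have [intf _ _] := Hf (i, k).
  by have [] := @int_term i (f (i, k)) vi _; first by apply: integrableS intf.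
have I1 i k : mu.-integrable (open_time_dom M)
    (EFin \o (fun t => cv i k * (f (i, k) t * \1_(`]0, a i[) t))).
  case: (boolP (valid i)) => vi.
    exact: (integrableZl open_time_dom_meas (cv i k) (I0 i k vi)).
  rewrite (_ : _ \o _ = cst 0%E); first exact: integrable0.
  by apply/funext => t /=; rewrite /cv (negbTE vi) !mul0r.
rewrite -/(Rintegral mu _ _) Rintegral_sum_dom//; last by move=> i; exact: integrable_sum_dom.
apply: eq_bigr => i _; rewrite Rintegral_sum_dom//; apply: eq_bigr => k _.
case: (boolP (valid i)) => vi; last first.
  have [_ _ ->] := wpathP h; last by move/asboolP; exact/negP.
  rewrite mxE mulr0 /Rintegral (eq_integral (cst 0%E)) ?integral0// => t _.
  by rewrite /cv (negbTE vi) !mul0r.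
rewrite RintegralZl//; last exact: I0.
have [intf _ ->//] := Hf (i, k); rewrite /cv vi mul1r; congr (_ * _).
by have [] := @int_term i (f (i, k)) vi _; first by apply: integrableS intf.
Qed.

Let gD_meas k : measurable_fun setT (gD ^~ k).
Proof.
apply: measurable_sum => i; apply: measurable_funM => //.
rewrite (_ : (fun _ => _) = fun t => q t * \1_(`]-oo, a i[) t).
  by apply: measurable_funM => //; exact: measurable_indic.
apply/funext => t; rewrite indicE; case: ltP => ta.
  by rewrite mem_set ?mulr1//= in_itv.
by rewrite memNset ?mulr0//= in_itv/= ltNge ta.
Qed.

Let gD_bnd k : exists B : R, forall i t, t < a i -> `|gD t k| <= B.
Proof.
have /choice[C HC] i := q_bnd (a i).
exists (\sum_i `|cv i k| * `|C i|) => _ t _.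
rewrite (le_trans (ler_norm_sum _ _ _))//; apply: ler_sum => i _.
rewrite normrM ler_wpM2l//; case: ltP => ti; last by rewrite normr0.
by rewrite ger0_norm// (le_trans (HC i t (ltW ti)))// ler_norm.
Qed.

Lemma gradient_path_H : H_space p kappa gradient_path.
Proof.
split.
  move=> b bM e e0; have [C [C0 HC]] := gsum_lip.
  have C1 : 0 < C + 1 by rewrite ltr_wpDl.
  exists (e / (C + 1)); first by rewrite divr_gt0.
  move=> N u v Huv _; rewrite ltr_pdivlMr// => sum; apply: le_lt_trans sum.
  rewrite mulr_suml; apply: ler_sum => i _; have [u0 uv va] := Huv i.
  have D (x : R) : 0 <= x -> x <= b -> gradient_path x = gsum x.
    move=> x0 xb; rewrite /= /gradient_fun asboolT//; split=> //.
    by case: bM => _; apply: le_trans; rewrite lee_fin.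
  rewrite !D ?(le_trans u0)//; last exact: (le_trans uv).
  rewrite (le_trans (HC _ _))// ger0_norm ?subr_ge0// mulrC ler_wpM2l ?subr_ge0//.
  by rewrite lerDl.
have ae : {ae mu, forall t, open_time_dom M t ->
    dotr (derive1 gradient_fun t) (derive1 gradient_path t) * p t `^ kappa =
    \sum_i \sum_k cv i k * (gD t k * \1_(`]0, a i[) t)}.
  apply: (@gradient_integrand _ (fun i k => gD ^~ k)) => i k /asboolP[_ aM].
  have := ae_forall_fin (fun i => stopped_is_derive mq q_ge0 q_bnd (a i)).
  apply: filterS => t Ht /andP[t0 ta].
  have tM : open_time_dom M t by split=> //; apply: lt_le_trans aM; rewrite lte_fin.
  exact: gradient_is_derive.
have intf i k : valid i -> mu.-integrable `]0, a i[ (EFin \o gD ^~ k).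
  move=> vi; have [B HB] := gD_bnd k.
  apply: (bounded_integrable_itv (C := B)); first exact: gD_meas.
    by rewrite lebesgue_measure_itv/=; case: ifP => _; rewrite ?ltry// -EFinB ltry.
  by move=> t; rewrite in_itv/= => /andP[_]; exact: HB.
have I1 i k : mu.-integrable (open_time_dom M)
    (EFin \o (fun t => cv i k * (gD t k * \1_(`]0, a i[) t))).
  case: (boolP (valid i)) => vi.
    have [I0 _] := int_term vi (intf i k vi).
    exact: (integrableZl open_time_dom_meas (cv i k) I0).
  rewrite (_ : _ \o _ = cst 0%E); first exact: integrable0.
  by apply/funext => t /=; rewrite /cv (negbTE vi) !mul0r.
rewrite (@integral_ae_congr _ _ _ mu _ _
  (EFin \o (fun t => \sum_i \sum_k cv i k * (gD t k * \1_(`]0, a i[) t)))); last first.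
  move: ae; apply: filterS; first exact: (ae_filter_ringOfSetsType mu).
  by move=> t /[apply] /= ->.
apply: integrable_lty => //; apply: integrable_sum_dom => // i.
exact: integrable_sum_dom.
Qed.

End gradient_path.

(** * Cylinder functions and their energy *)

Section partial_rules.
Context {R : realType} (d n : nat).
Implicit Types (f g : 'M[R]_(n, d) -> R).

Lemma is_derive_unique (V : normedModType R) (f : V -> R) (x v : V) (a b : R) :
  is_derive x v f a -> is_derive x v f b -> a = b.
Proof. by move=> [_ <-] [_ <-]. Qed.

Lemma partial_lin (c : R) f g ik x : smooth_cb f -> smooth_cb g ->
  partial (fun y => c * f y + g y) ik x = c * partial f ik x + partial g ik x.
Proof.
move=> sf sg; have df := smooth_cb_derive x ik sf; have dg := smooth_cb_derive x ik sg.
have := is_deriveD (is_deriveZ c df) dg => H.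
rewrite /partial (_ : (fun y => _) = (c \*: f + g)); last by [].
by case: H => _ ->.
Qed.

Lemma partial_mul f g ik x : smooth_cb f -> smooth_cb g ->
  partial (fun y => f y * g y) ik x = f x * partial g ik x + g x * partial f ik x.
Proof.
move=> sf sg; have df := smooth_cb_derive x ik sf; have dg := smooth_cb_derive x ik sg.
have := is_deriveM df dg => H.
rewrite /partial (_ : (fun y => _) = (f * g)); last by [].
by case: H => _ ->.
Qed.

Lemma partial_soft_clamp e f ik x : 0 < e -> smooth_cb f ->
  partial (fun y => soft_clamp e (f y)) ik x = soft_clamp' e (f x) * partial f ik x.
Proof.
move=> e0 sf; have df : has_partials f by move=> y jl; case: (smooth_cb_derive y jl sf).
by have [_ H] := @is_derive_soft_clamp_comp _ _ _ e e0 f df x ik.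
Qed.

Lemma smooth_cb_clamp e f : 0 < e -> smooth_cb f -> smooth_cb (fun x => soft_clamp e (f x)).
Proof.
move=> e0 sf; apply: smooth_cb_soft_clamp => //.
- exact: CbS_continuous (sf 0%N).
- by move=> y jl; case: (smooth_cb_derive y jl sf).
- by move=> ik; exact: smooth_cb_partial.
Qed.

End partial_rules.

Section cylinder_functions.
Context {R : realType} (d : nat) (M T : \bar R).
Hypothesis T_ge0 : (0 <= T)%E.
Local Notation opath := (opath d M T).
Local Notation wpath := (wpath d M).
Local Notation spath := (spath T).
Implicit Types (F G : opath -> R) (h w : wpath) (l : spath) (wl : wpath * spath).

Definition points n (t : 'I_n -> R) (x : R -> 'rV[R]_d) : 'M[R]_(n, d) :=
  \matrix_(i < n) x (t i).

(* Unlike in [is_cylinder], the times may be unordered and repeated *)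
Definition cyl_rep n (t : 'I_n -> R) (f : 'M[R]_(n, d) -> R) F : Prop :=
  [/\ smooth_cb f, forall i, time_dom T (t i) & F = fun x => f (points t x)].

Let dom0 : time_dom T 0. Proof. by []. Qed.

(** Repeated and unordered times are brought into the required form by sorting the distinct ones and
    letting [f] read the rows it needs. Conversely this freedom lets two cylinder functions share
    one family of times by concatenation. *)
Lemma FCbP F : FCb F <-> exists n t f, @cyl_rep n t f F.
Proof.
split=> [[c [n0 dt st /smooth_boundedP sf] ->]|[n [t [f [sf dt ->]]]]].
  by exists (cyl_n c), (@cyl_t _ _ c), (@cyl_f _ _ c).
(* The time 0 is added because [is_cylinder] asks for at least one time. *)
pose s := sort <=%R (undup (0 :: codom t)).
have s0 : 0 \in s by rewrite mem_sort mem_undup inE eqxx.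
have ms i : (index (t i) s < size s)%N.
  by rewrite index_mem mem_sort mem_undup inE codom_f orbT.
pose sel (i : 'I_n) : 'I_(size s) := Ordinal (ms i).
pose t' (j : 'I_(size s)) := nth 0 s j.
exists (Cylinder t' (fun x => f (rowsub sel x))); last first.
  apply/funext => x; rewrite /cyl_eval /=; congr f; apply/matrixP => i k.
  by rewrite !mxE /t' /= nth_index// -index_mem.
split=> /=.
- by rewrite (leq_ltn_trans (leq0n (index 0 s)))// index_mem.
- move=> j; have : t' j \in s by exact: mem_nth.
  by rewrite mem_sort mem_undup inE => /predU1P[->//|/codomP[i ->]].
- move=> i j ij; have ss : sorted <%R s by rewrite sort_lt_sorted undup_uniq.
  by apply: (sorted_ltn_nth lt_trans 0 ss) => //; rewrite inE.
- by apply/smooth_boundedP; exact: smooth_cb_rowsub.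
Qed.

Lemma FCb_pair F G : FCb F -> FCb G ->
  exists n t f g, @cyl_rep n t f F /\ @cyl_rep n t g G.
Proof.
move=> /FCbP[n1 [t1 [f [sf d1 ->]]]] /FCbP[n2 [t2 [g [sg d2 ->]]]].
pose t (i : 'I_(n1 + n2)) := match fintype.split i with inl j => t1 j | inr j => t2 j end.
have dt i : time_dom T (t i) by rewrite /t; case: splitP.
exists (n1 + n2)%N, t, (fun x => f (rowsub (@lshift n1 n2) x)),
  (fun x => g (rowsub (@rshift n1 n2) x)).
split; split=> //; try exact: smooth_cb_rowsub.
- apply/funext => x; congr f; apply/matrixP => i k; rewrite !mxE /t.
  by rewrite -[lshift _ i]/(unsplit (inl i)) unsplitK.
- apply/funext => x; congr g; apply/matrixP => i k; rewrite !mxE /t.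
  by rewrite -[rshift _ i]/(unsplit (inr i)) unsplitK.
Qed.

Lemma FCb_cst c : FCb (cst c : opath -> R).
Proof.
by apply/FCbP; exists 0%N, (fun=> 0), (fun=> c); split => //; exact: smooth_cb_cst.
Qed.

Lemma cyl_rep_lin c n t f g F G : @cyl_rep n t f F -> @cyl_rep n t g G ->
  cyl_rep t (fun y => c * f y + g y) (fun x => c * F x + G x).
Proof.
move=> [sf dt ->] [sg _ ->]; split=> //; apply: smooth_cbD => //.
by apply: smooth_cbM => //; exact: smooth_cb_cst.
Qed.

Lemma cyl_rep_mul n t f g F G : @cyl_rep n t f F -> @cyl_rep n t g G ->
  cyl_rep t (fun y => f y * g y) (fun x => F x * G x).
Proof. by move=> [sf dt ->] [sg _ ->]; split=> //; exact: smooth_cbM. Qed.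

Lemma cyl_rep_clamp e n t f F : 0 < e -> @cyl_rep n t f F ->
  cyl_rep t (fun y => soft_clamp e (f y)) (fun x => soft_clamp e (F x)).
Proof. by move=> e0 [sf dt ->]; split=> //; exact: smooth_cb_clamp. Qed.

Lemma FCb_lin c F G : FCb F -> FCb G -> FCb (fun x => c * F x + G x).
Proof.
move=> FF FG; have [n [t [f [g [rf rg]]]]] := FCb_pair FF FG; apply/FCbP.
by exists n, t, (fun y => c * f y + g y); exact: cyl_rep_lin.
Qed.

Lemma FCb_mul F G : FCb F -> FCb G -> FCb (fun x => F x * G x).
Proof.
move=> FF FG; have [n [t [f [g [rf rg]]]]] := FCb_pair FF FG; apply/FCbP.
by exists n, t, (fun y => f y * g y); exact: cyl_rep_mul.
Qed.

Lemma FCb_clamp e F : 0 < e -> FCb F -> FCb (fun x => soft_clamp e (F x)).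
Proof.
move=> e0 /FCbP[n [t [f rf]]]; apply/FCbP.
by exists n, t, (fun y => soft_clamp e (f y)); exact: cyl_rep_clamp.
Qed.

Lemma FCb_bounded F : FCb F -> exists C : R, forall x, `|F x| <= C.
Proof.
move=> /FCbP[n [t [f [sf _ ->]]]].
by have [C fC] := CbS_bounded (sf 0%N); exists C.
Qed.

Lemma is_wpath_line w h (e : R) : is_wpath M (fun s => e *: h s + w s).
Proof.
have [w0 cw ww] := wpathP w; have [h0 ch hh] := wpathP h; split.
- by rewrite w0 h0 scaler0 addr0.
- have entry (u : wpath) k : {within time_dom M, continuous (fun s => u s ord0 k)}.
    have [_ cu _] := wpathP u => x.
    apply: (@continuous_comp _ _ _ (fun s : subspace (time_dom M) => u s)
      (fun v : 'rV[R]_d => v ord0 k)); [exact: cu|exact: coord_continuous].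
  apply: (@continuous_mx _ (subspace (time_dom M))) => i k; rewrite ord1.
  rewrite (_ : (fun s => _) = fun s => e * h s ord0 k + w s ord0 k); last first.
    by apply/funext => s; rewrite !mxE.
  apply: (@continuous_funD _ (subspace (time_dom M))); last exact: entry.
  by apply: (@continuous_funM _ (subspace (time_dom M))); [exact: continuous_funC|exact: entry].
- by move=> t tM; rewrite ww// hh// scaler0 addr0.
Qed.

Definition wline w h e : wpath := WPath (is_wpath_line w h e).

(* The right-hand side is the derivative at 0 of e |-> F ((w + e h) \o l), hence
   it does not depend on the representation *)
Lemma dir_deriv_line F h wl n t f : @cyl_rep n t f F ->
  is_derive (0 : R) 1 (fun e : R => F (comp_path (wline wl.1 h e, wl.2)))
    (\sum_i \sum_k partial f (i, k) (points t (wl.1 \o wl.2)) * h (wl.2 (t i)) ord0 k).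
Proof.
move=> [sf _ ->]; pose V := points t (h \o wl.2); pose X := points t (wl.1 \o wl.2).
have := (is_derive_line0P f X V _).1 (smooth_cb_is_derive X V sf).
have E (e : R) : points t (comp_path (wline wl.1 h e, wl.2)) = e *: V + X.
  by apply/matrixP => i k; rewrite !mxE.
rewrite (funext (fun e => congr1 f (E e))).
have -> : \sum_i \sum_k V i k * partial f (i, k) X =
    \sum_i \sum_k partial f (i, k) X * h (wl.2 (t i)) ord0 k.
  by apply: eq_bigr => i _; apply: eq_bigr => k _; rewrite mulrC !mxE.
by [].
Qed.

Lemma dir_derivE F h wl n t f : @cyl_rep n t f F -> dir_deriv F h wl =
  \sum_i \sum_k partial f (i, k) (points t (wl.1 \o wl.2)) * h (wl.2 (t i)) ord0 k.
Proof.
move=> rF.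
have /(xgetPex (@Cylinder _ d 0 (fun=> 0) (fun=> 0))) :
    exists c, [set c | is_cylinder T c /\ F = cyl_eval c] c.
  have [c ? ?] : FCb F by apply/FCbP; exists n, t, f.
  by exists c.
rewrite -/(cyl_repr F) => -[[n0 dt st /smooth_boundedP sf] Fc].
have rc : cyl_rep (@cyl_t _ _ (cyl_repr F)) (@cyl_f _ _ (cyl_repr F)) F by split.
rewrite /dir_deriv -(is_derive_unique (dir_deriv_line h wl rc) (dir_deriv_line h wl rF)).
apply: eq_bigr => i _; rewrite /dotr; apply: eq_bigr => k _.
by rewrite /cyl_grad mxE.
Qed.

Lemma dir_deriv_lin c F G h wl : FCb F -> FCb G ->
  dir_deriv (fun x => c * F x + G x) h wl = c * dir_deriv F h wl + dir_deriv G h wl.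
Proof.
move=> FF FG; have [n [t [f [g [rf rg]]]]] := FCb_pair FF FG.
rewrite (dir_derivE _ _ (cyl_rep_lin c rf rg)) (dir_derivE _ _ rf) (dir_derivE _ _ rg).
rewrite mulr_sumr -big_split; apply: eq_bigr => i _ /=.
rewrite mulr_sumr -big_split; apply: eq_bigr => k _ /=.
by case: rf rg => sf _ _ [sg _ _]; rewrite partial_lin// mulrDl mulrA.
Qed.

Lemma dir_deriv_mul F G h wl : FCb F -> FCb G ->
  dir_deriv (fun x => F x * G x) h wl =
  F (comp_path wl) * dir_deriv G h wl + G (comp_path wl) * dir_deriv F h wl.
Proof.
move=> FF FG; have [n [t [f [g [rf rg]]]]] := FCb_pair FF FG.
rewrite (dir_derivE _ _ (cyl_rep_mul rf rg)) (dir_derivE _ _ rf) (dir_derivE _ _ rg).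
rewrite !mulr_sumr -big_split; apply: eq_bigr => i _ /=.
rewrite !mulr_sumr -big_split; apply: eq_bigr => k _ /=.
by case: rf rg => sf _ -> [sg _ ->]; rewrite partial_mul// mulrDl !mulrA.
Qed.

Lemma dir_deriv_clamp e F h wl : 0 < e -> FCb F ->
  dir_deriv (fun x => soft_clamp e (F x)) h wl =
  soft_clamp' e (F (comp_path wl)) * dir_deriv F h wl.
Proof.
move=> e0 /FCbP[n [t [f rf]]].
rewrite (dir_derivE _ _ (cyl_rep_clamp e0 rf)) (dir_derivE _ _ rf).
rewrite !mulr_sumr; apply: eq_bigr => i _ /=; rewrite !mulr_sumr; apply: eq_bigr => k _ /=.
by case: rf => sf _ ->; rewrite partial_soft_clamp// mulrA.
Qed.

Lemma dir_deriv_cst c h wl : dir_deriv (cst c : opath -> R) h wl = 0.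
Proof.
have r : @cyl_rep 0 (fun=> 0) (fun=> c) (cst c) by split=> //; exact: smooth_cb_cst.
by rewrite (dir_derivE _ _ r) big_ord0.
Qed.

Section carre.
Variables (p : R -> R) (kappa : R) (q : R -> R).
Hypotheses (mq : measurable_fun setT q) (q_ge0 : forall t, 0 <= q t)
  (q_bnd : forall a, exists C : R, forall t, t <= a -> q t <= C)
  (qp : forall t, open_time_dom M t -> q t * p t `^ kappa = 1).

Definition carre F G wl := H_inner p kappa (gradient p kappa F wl) (gradient p kappa G wl).

Lemma H_innerC (g h : wpath) : H_inner p kappa g h = H_inner p kappa h g.
Proof.
have dC (u v : 'rV[R]_d) : dotr u v = dotr v u.
  by apply: eq_bigr => i _; rewrite mulrC.
by apply: eq_Rintegral => t _; rewrite dC.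
Qed.

Lemma H_inner_ge0 (g : wpath) : 0 <= H_inner p kappa g g.
Proof.
apply: Rintegral_ge0 => t _; apply: mulr_ge0; last exact: powR_ge0.
by apply: sumr_ge0 => i _; rewrite -expr2 sqr_ge0.
Qed.

Let gpath n (t : 'I_n -> R) f wl : wpath :=
  gradient_path M mq q_ge0 q_bnd
    (fun i k => partial f (i, k) (points t (wl.1 \o wl.2)))
    (fun i => spath_ge0 wl.2 (t i)).

Let gpathP F wl n t f : @cyl_rep n t f F -> H_space p kappa (gpath t f wl) /\
  forall h, H_space p kappa h -> H_inner p kappa (gpath t f wl) h = dir_deriv F h wl.
Proof.
move=> rF; split; first exact: gradient_path_H.
by move=> h hH; rewrite (gradient_inner _ _ _ qp _ _ hH) (dir_derivE _ _ rF).
Qed.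

Lemma gradientP F wl : FCb F -> H_space p kappa (gradient p kappa F wl) /\
  forall h, H_space p kappa h -> H_inner p kappa (gradient p kappa F wl) h = dir_deriv F h wl.
Proof.
move=> /FCbP[n [t [f rF]]].
pose P := [set g : wpath | H_space p kappa g /\
  forall h, H_space p kappa h -> H_inner p kappa g h = dir_deriv F h wl].
by have /(xgetPex point) : exists g, P g by exists (gpath t f wl); exact: gpathP.
Qed.

(** [gradient] is a mere choice of representative, used only through its inner products. Linearity,
    vanishing on constants and the chain rule thus pass from directional derivatives to [carre]. *)
Lemma carre_dir F G wl : FCb F -> FCb G ->
  carre F G wl = dir_deriv F (gradient p kappa G wl) wl.
Proof.
by move=> FF FG; exact: ((gradientP wl FF).2 _ (gradientP wl FG).1).
Qed.

Lemma carreC F G wl : carre F G wl = carre G F wl. Proof. exact: H_innerC. Qed.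

Lemma carre_ge0 F wl : 0 <= carre F F wl. Proof. exact: H_inner_ge0. Qed.

Lemma carre_lin c F G H wl : FCb F -> FCb G -> FCb H ->
  carre (fun x => c * F x + G x) H wl = c * carre F H wl + carre G H wl.
Proof.
move=> FF FG FH; rewrite !carre_dir//; last exact: FCb_lin.
exact: dir_deriv_lin.
Qed.

Lemma carre_cst c F wl : FCb F -> carre (cst c) F wl = 0.
Proof. by move=> FF; rewrite carre_dir ?dir_deriv_cst//; exact: FCb_cst. Qed.

Lemma carre_clamp e F wl : 0 < e -> FCb F ->
  carre (fun x => soft_clamp e (F x)) (fun x => soft_clamp e (F x)) wl <= carre F F wl.
Proof.
move=> e0 FF; have Fc := FCb_clamp e0 FF.
rewrite carre_dir// dir_deriv_clamp// -carre_dir// carreC carre_dir// dir_deriv_clamp//.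
rewrite -carre_dir// mulrA -expr2 ler_piMl ?carre_ge0//.
by rewrite -[leLHS]real_normK ?num_real// expr_le1// soft_clamp'_le1.
Qed.

(** The inner product of the representatives of the evaluations at x and y; it vanishes as soon as
    one of the times lies beyond [M]. *)
Definition cov_kernel (x y : R) : R :=
  if `[< time_dom M x >] && `[< time_dom M y >] then primitive q (Num.min x y) else 0.

Lemma carreE F G wl n t f n' t' g : @cyl_rep n t f F -> @cyl_rep n' t' g G ->
  carre F G wl =
  \sum_i \sum_j \sum_k partial f (i, k) (points t (wl.1 \o wl.2)) *
    partial g (j, k) (points t' (wl.1 \o wl.2)) * cov_kernel (wl.2 (t i)) (wl.2 (t' j)).
Proof.
move=> rF rG.
have FF : FCb F by apply/FCbP; exists n, t, f.
have FG : FCb G by apply/FCbP; exists n', t', g.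
have [HF IF] := gradientP wl FF; have [HG IG] := gradientP wl FG.
have [Hg Ig] := gpathP wl rG.
(* The chosen gradient of [G] is exchanged for the explicit one, which is then used as a direction
   for [F]. *)
rewrite /carre H_innerC IG// -Ig// H_innerC IF// (dir_derivE _ _ rF).
apply: eq_bigr => i _; rewrite exchange_big/=; apply: eq_bigr => k _.
rewrite /gradient_fun /cov_kernel; case: asboolP => vi /=; last first.
  by rewrite mxE mulr0 big1// => j _; rewrite mulr0.
rewrite mxE mulr_sumr; apply: eq_bigr => j _.
by case: asboolP => vj; rewrite ?mul1r ?mul0r ?mulr0 // mulrA.
Qed.

Lemma carre_nonneg_form wl : nonneg_form (@FCb R d M T) (fun F G => carre F G wl).
Proof.
split; [exact: FCb_lin|by move=> c F G H; exact: carre_lin|by move=> *; exact: carreC|].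
by move=> F _; exact: carre_ge0.
Qed.

(* The path x |-> primitive q (min x a) e_k, whose inner products are the k-th
   coordinates at time a *)
Definition unit_path (a : R) (a0 : 0 <= a) (k : 'I_d) : wpath :=
  gradient_path M mq q_ge0 q_bnd (fun (_ : 'I_1) (k1 : 'I_d) => (k1 == k)%:R) (fun _ => a0).

Lemma dir_deriv_unit F wl n t f (a : R) (a0 : 0 <= a) k : @cyl_rep n t f F ->
  dir_deriv F (unit_path a0 k) wl =
  \sum_i partial f (i, k) (points t (wl.1 \o wl.2)) * cov_kernel (wl.2 (t i)) a.
Proof.
move=> rF; rewrite (dir_derivE _ _ rF); apply: eq_bigr => i _.
rewrite /= /gradient_fun /cov_kernel; case: asboolP => vi /=; last first.
  by rewrite mulr0 big1// => k1 _; rewrite mxE mulr0.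
rewrite (bigD1 k)//= big1 ?addr0; last first.
  by move=> k1 /negbTE lk; rewrite mxE big_ord1 lk mulr0 mul0r mulr0.
rewrite mxE big_ord1 eqxx mulr1; congr (_ * _).
by case: asboolP => va; rewrite ?mul1r ?mul0r.
Qed.

(** Expands the gradient of [G] only. [F] is then differentiated in directions that depend on [wl.2]
    but not on [wl.1], the form to which integration by parts in w applies. *)
Lemma carre_unit F G wl n t g : FCb F -> @cyl_rep n t g G -> carre F G wl =
  \sum_j \sum_k partial g (j, k) (points t (wl.1 \o wl.2)) *
    dir_deriv F (unit_path (spath_ge0 wl.2 (t j)) k) wl.
Proof.
move=> /FCbP[n' [t' [f rF]]] rG; rewrite (carreE _ rF rG) exchange_big/=.
apply: eq_bigr => j _; rewrite exchange_big/=; apply: eq_bigr => k _.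
rewrite (dir_deriv_unit _ _ _ rF) mulr_sumr; apply: eq_bigr => i _.
by rewrite mulrCA mulrA.
Qed.

End carre.

End cylinder_functions.

(** * The energy form on cylinder functions *)

Section form.
Context {R : realType} (d : nat) (M T : \bar R).
Hypothesis T_ge0 : (0 <= T)%E.
Variables (mw : probability (wpath d M) R) (la : probability (spath T) R).
Variables (p : R -> R) (kappa : R) (q : R -> R).
Hypotheses (mq : measurable_fun setT q) (q_ge0 : forall t, 0 <= q t)
  (q_bnd : forall a, exists C : R, forall t, t <= a -> q t <= C)
  (qp : forall t, open_time_dom M t -> q t * p t `^ kappa = 1)
  (int_primitive : forall t, time_dom T t ->
    la.-integrable setT (EFin \o (fun l : spath T => primitive q (l t)))).
Local Notation m := (mw \x la)%E.
Local Notation mS := (distribution m (@comp_path R d M T)).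
Local Notation Pair := (wpath d M * spath T)%type.
Implicit Types (F G : opath d M T -> R) (l : spath T) (wl : Pair).

Lemma measurable_points n (t : 'I_n -> R) (f : 'M[R]_(n, d) -> R) : continuous f ->
  measurable_fun setT (fun wl : Pair => f (points t (wl.1 \o wl.2))).
Proof.
move=> cf; apply: (measurable_continuous_mx cf) => i k.
by under eq_fun do rewrite mxE; exact: measurable_comp_path_coord.
Qed.

Lemma measurable_ocoord (t : R) (k : 'I_d) :
  measurable_fun setT (fun x : opath d M T => x t ord0 k).
Proof.
move=> _ B mB; rewrite setTI; apply: sub_sigma_algebra.
by exists (t, k), B.
Qed.

Lemma measurable_cyl n (t : 'I_n -> R) (f : 'M[R]_(n, d) -> R) : continuous f ->
  measurable_fun setT (fun x : opath d M T => f (points t x)).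
Proof.
move=> cf; apply: (measurable_continuous_mx cf) => i k.
by under eq_fun do rewrite mxE; exact: measurable_ocoord.
Qed.

Lemma FCb_measurable F : FCb F -> measurable_fun setT F.
Proof.
by move=> /(FCbP T_ge0)[n [t [f [sf _ ->]]]]; exact: measurable_cyl (CbS_continuous (sf 0%N)).
Qed.

Lemma FCb_sq F : FCb F -> sq_integrable mS F.
Proof.
move=> FF; have [C FC] := FCb_bounded T_ge0 FF.
exact: bounded_sq_integrable (FCb_measurable FF) FC.
Qed.

Lemma FCb_comp_measurable F : FCb F -> measurable_fun setT (fun wl : Pair => F (comp_path wl)).
Proof.
move=> FF; apply: (measurableT_comp (FCb_measurable FF)); exact: measurable_comp_path.
Qed.

Lemma FCb_comp_sq F : FCb F -> sq_integrable m (fun wl : Pair => F (comp_path wl)).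
Proof.
move=> FF; have [C FC] := FCb_bounded T_ge0 FF.
exact: (bounded_sq_integrable _ (FCb_comp_measurable FF) (fun wl => FC (comp_path wl))).
Qed.

Lemma sq_norm_comp F : FCb F ->
  sq_norm mS F = sq_norm m (fun wl : Pair => F (comp_path wl)).
Proof.
move=> FF; rewrite /sq_norm /Rintegral ge0_integral_distribution//.
- by apply/measurable_EFinP; apply: measurable_funX; exact: FCb_measurable.
- by move=> x; rewrite lee_fin sqr_ge0.
Qed.

Lemma measurable_time_dom (A : \bar R) : measurable (time_dom A : set R).
Proof.
rewrite (_ : time_dom A = `[0, +oo[ `&` [set t | (t%:E <= A)%E]); last first.
  by apply/seteqP; split => t /=; rewrite in_itv/= andbT.
apply: measurableI => //; case: A => [r| |] /=.
- by rewrite (_ : [set _ | _] = `]-oo, r]%classic).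
- by rewrite (_ : [set _ | _] = setT)//; apply/seteqP; split => t //= _; rewrite leey.
- by rewrite (_ : [set _ | _] = set0)//; apply/seteqP; split => t.
Qed.

Lemma cov_kernelE x y : cov_kernel M q x y =
  \1_(time_dom M) x * \1_(time_dom M) y * primitive q (Num.min x y).
Proof.
rewrite /cov_kernel !indicE; case: asboolP => vx; last by rewrite memNset ?mul0r.
rewrite mem_set// mul1r; case: asboolP => vy; last by rewrite memNset ?mul0r.
by rewrite mem_set// mul1r.
Qed.

Lemma cov_kernel_ge0 x y : 0 <= cov_kernel M q x y.
Proof. by rewrite /cov_kernel; case: ifP => // _; exact: primitive_ge0. Qed.

Lemma cov_kernel_le x y : cov_kernel M q x y <= primitive q y.
Proof.
rewrite /cov_kernel; case: ifP => _; last exact: primitive_ge0.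
by apply: primitive_le => //; rewrite ge_min lexx orbT.
Qed.

Lemma measurable_cov_kernel s t :
  measurable_fun setT (fun l => cov_kernel M q (l s) (l t)).
Proof.
rewrite (funext (fun l : spath T => cov_kernelE (l s) (l t))).
have mi (u : R) : measurable_fun setT (fun l : spath T => \1_(time_dom M) (l u) : R).
  apply: (measurableT_comp (f := \1_(time_dom M) : R -> R)); last exact: measurable_scoord.
  exact: measurable_indic (measurable_time_dom M).
apply: measurable_funM; first by apply: measurable_funM; exact: mi.
apply: (measurableT_comp (measurable_primitive mq q_ge0 q_bnd)).
by apply: measurable_minr; exact: measurable_scoord.
Qed.

Lemma integrable_snd (g : spath T -> R) : la.-integrable setT (EFin \o g) ->
  m.-integrable setT (EFin \o (fun wl : Pair => g wl.2)).
Proof.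
move=> /integrableP[mg ig]; have mg' : measurable_fun setT g by exact/measurable_EFinP.
have mg2 : measurable_fun setT (fun wl : Pair => g wl.2).
  by apply: (measurableT_comp mg'); exact: measurable_snd.
apply/integrableP; split; first exact/measurable_EFinP.
rewrite fubini_tonelli2; last 2 first.
- by apply: measurableT_comp => //; exact/measurable_EFinP.
- by move=> wl; exact: abse_ge0.
apply: le_lt_trans ig; rewrite le_eqVlt; apply/orP; left; apply/eqP.
apply: eq_integral => l _; rewrite /fubini_G /= integral_cst//.
rewrite -[RHS]mule1; congr (_ * _)%E; exact: probability_setT.
Qed.

(** The kernel is at most the primitive of the weight at [wl.2 t], whose expectation is finite by
    [int_primitive]. *)
Lemma kernel_integrable (b : Pair -> R) (C s t : R) : measurable_fun setT b ->
  (forall wl, `|b wl| <= C) -> time_dom T t ->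
  m.-integrable setT (EFin \o (fun wl : Pair => b wl * cov_kernel M q (wl.2 s) (wl.2 t))).
Proof.
move=> mb bC tT.
have I1 := integrableZlR `|C| (integrable_snd (int_primitive tT)).
apply: le_integrable I1 => //.
  apply/measurable_EFinP; apply: measurable_funM => //.
  by apply: (measurableT_comp (measurable_cov_kernel s t)); exact: measurable_snd.
move=> wl _ /=; rewrite lee_fin !normrM normr_id ler_pM//.
  by rewrite (le_trans (bC wl))// ler_norm.
by rewrite !ger0_norm ?cov_kernel_le ?cov_kernel_ge0 ?primitive_ge0.
Qed.

Lemma carre_integrable F G : FCb F -> FCb G ->
  m.-integrable setT (EFin \o (fun wl : Pair => carre p kappa F G wl)).
Proof.
move=> /(FCbP T_ge0)[n [t [f rF]]] /(FCbP T_ge0)[n' [t' [g rG]]].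
rewrite (funext (fun wl => carreE T_ge0 mq q_ge0 q_bnd qp wl rF rG)).
have [sf dt _] := rF; have [sg dt' _] := rG.
apply: integrable_sumR => i; apply: integrable_sumR => j; apply: integrable_sumR => k.
have sfi := smooth_cb_partial (i, k) sf; have sgj := smooth_cb_partial (j, k) sg.
have [C1 fC] := CbS_bounded (sfi 0%N); have [C2 gC] := CbS_bounded (sgj 0%N).
apply: (@kernel_integrable (fun wl => partial f (i, k) (points t (wl.1 \o wl.2)) *
  partial g (j, k) (points t' (wl.1 \o wl.2))) (C1 * C2)) => //.
  apply: measurable_funM; apply: measurable_points.
    exact: CbS_continuous (sfi 0%N).
  exact: CbS_continuous (sgj 0%N).
by move=> wl; rewrite normrM ler_pM.
Qed.

Lemma form_nonneg : nonneg_form (@FCb R d M T) (grad_form p m kappa).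
Proof.
have cl := @carre_nonneg_form R d M T T_ge0 p kappa q mq q_ge0 q_bnd qp.
split.
- exact: FCb_lin.
- move=> c F G H FF FG FH; rewrite /grad_form -RintegralZl//; last exact: carre_integrable.
  rewrite -RintegralD//; last exact: carre_integrable.
    by apply: eq_Rintegral => wl _; exact: (nf_linear (cl wl) c FF FG FH).
  exact: (integrableZlR c (carre_integrable FF FH)).
- move=> F G FF FG; apply: eq_Rintegral => wl _; exact: (nf_sym (cl wl) FF FG).
- move=> F FF; apply: Rintegral_ge0 => wl _; exact: (nf_ge0 (cl wl) FF).
Qed.

Lemma form_cst c F : FCb F -> grad_form p m kappa (cst c) F = 0.
Proof.
move=> FF; rewrite /grad_form (_ : \int[m]_wl _ = \int[m]_wl 0).
  by rewrite /Rintegral integral0.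
by apply: eq_Rintegral => wl _; exact: (carre_cst T_ge0 mq q_ge0 q_bnd qp c wl FF).
Qed.

Lemma form_markov F e : FCb F -> 0 < e -> exists G, [/\ FCb G,
  forall x, `|G x - Num.min (Num.max (F x) 0) 1| <= e &
  grad_form p m kappa G G <= grad_form p m kappa F F].
Proof.
move=> FF e0; have FG := FCb_clamp T_ge0 e0 FF.
exists (fun x => soft_clamp e (F x)); split; first exact: FG.
  by move=> x; exact: soft_clamp_approx.
apply: (le_Rintegral measurableT (carre_integrable FG FG) (carre_integrable FF FF)).
move=> wl _; exact: (carre_clamp T_ge0 mq q_ge0 q_bnd qp wl e0 FF).
Qed.

End form.

(** * Closability *)

(** Arithmetic for [ibp_term]: x and y bound the integrals of D(QF) and of F DQ, while z, u, v are
    the squared norms of QF, DQ and F. [C] bounds Q and [B] bounds DQ. A single constant is made to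
    serve in both terms. *)
Lemma ibp_bound {R : realType} (x y z u v dl K B C : R) : 0 <= K -> 0 < dl ->
  x <= dl * K + (2 * dl)^-1 * z -> y <= dl / 2 * u + (2 * dl)^-1 * v ->
  z <= C ^+ 2 * v -> u <= B ^+ 2 -> 0 <= v ->
  x + y <= dl * (K + B ^+ 2 + C ^+ 2 + 1) +
    (2 * dl)^-1 * ((K + B ^+ 2 + C ^+ 2 + 1) * v).
Proof.
move=> K0 dl0 h1 h2 h3 h4 v0.
have d0 : 0 < (2 * dl)^-1 by rewrite invr_gt0 mulr_gt0.
have g1 : (2 * dl)^-1 * z <= (2 * dl)^-1 * (C ^+ 2 * v) by rewrite ler_pM2l.
have g2 : dl / 2 * u <= dl / 2 * B ^+ 2 by rewrite ler_pM2l// divr_gt0.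
have g3 : 0 <= dl * (B ^+ 2 / 2 + C ^+ 2 + 1).
  by rewrite mulr_ge0 ?(ltW dl0)// !addr_ge0// ?divr_ge0// ?sqr_ge0.
have g4 : 0 <= (2 * dl)^-1 * ((K + B ^+ 2) * v).
  by rewrite mulr_ge0 ?(ltW d0)// mulr_ge0// addr_ge0// sqr_ge0.
move: h1 h2 g1 g2 g3 g4; move: ((2 * dl)^-1) => i h1 h2 g1 g2 g3 g4.
have -> : dl * (K + B ^+ 2 + C ^+ 2 + 1) + i * ((K + B ^+ 2 + C ^+ 2 + 1) * v) =
  (dl * K + i * (C ^+ 2 * v)) + (dl / 2 * B ^+ 2 + i * v) +
  (dl * (B ^+ 2 / 2 + C ^+ 2 + 1) + i * ((K + B ^+ 2) * v)) by field.
rewrite -[x + y]addr0; apply: lerD; last exact: addr_ge0.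
apply: lerD; first by apply: (le_trans h1); rewrite lerD2l.
by apply: (le_trans h2); rewrite lerD2r.
Qed.

Section closability.
Context {R : realType} (d : nat) (M T : \bar R).
Hypothesis T_ge0 : (0 <= T)%E.
Variables (mw : probability (wpath d M) R) (la : probability (spath T) R).
Hypothesis bm : brownian_motion mw (fun w : wpath d M => w).
Variables (p : R -> R) (kappa : R) (q : R -> R).
Hypotheses (mq : measurable_fun setT q) (q_ge0 : forall t, 0 <= q t)
  (q_bnd : forall a, exists C : R, forall t, t <= a -> q t <= C)
  (qp : forall t, open_time_dom M t -> q t * p t `^ kappa = 1)
  (int_primitive : forall t, time_dom T t ->
    la.-integrable setT (EFin \o (fun l : spath T => primitive q (l t)))).
Local Notation m := (mw \x la)%E.
Local Notation mS := (distribution m (@comp_path R d M T)).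
Local Notation Pair := (wpath d M * spath T)%type.
Local Notation unit := (unit_path M mq q_ge0 q_bnd).
Implicit Types (F G Q : opath d M T -> R) (l : spath T) (w : wpath d M) (wl : Pair).

Lemma measurable_points_fst n (t : 'I_n -> R) (f : 'M[R]_(n, d) -> R) l : continuous f ->
  measurable_fun setT (fun w : wpath d M => f (points t (w \o l))).
Proof.
move=> cf; apply: (measurable_continuous_mx cf) => i k.
by under eq_fun do rewrite mxE; exact: measurable_wcoord.
Qed.

Lemma FCb_fst_measurable F l : FCb F ->
  measurable_fun setT (fun w : wpath d M => F (comp_path (w, l))).
Proof.
move=> /(FCbP T_ge0)[n [t [f [sf _ ->]]]].
exact: measurable_points_fst (CbS_continuous (sf 0%N)).
Qed.

Lemma dir_deriv_unit_measurable F (a : R) (a0 : 0 <= a) k l : FCb F ->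
  measurable_fun setT (fun w : wpath d M => dir_deriv F (unit a0 k) (w, l)).
Proof.
move=> /(FCbP T_ge0)[n [t [f rF]]].
rewrite (funext (fun w => dir_deriv_unit T_ge0 mq q_ge0 q_bnd (w, l) a0 k rF)).
pose c i := cov_kernel M q (l (t i)) a.
suff H : measurable_fun setT (fun w : wpath d M =>
  \sum_i partial f (i, k) (points t (w \o l)) * c i) by exact: H.
apply: measurable_sum => i.
apply: measurable_funM; last exact: (measurable_cst (c i)).
apply: measurable_points_fst; case: rF => sf _ _.
exact: CbS_continuous (smooth_cb_partial (i, k) sf 0%N).
Qed.

Lemma dir_deriv_unit_bounded F : FCb F -> exists C : R, 0 <= C /\
  forall (a : R) (a0 : 0 <= a) k wl, `|dir_deriv F (unit a0 k) wl| <= C * primitive q a.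
Proof.
move=> /(FCbP T_ge0)[n [t [f rF]]]; have [sf _ _] := rF.
have /choice[C HC] ik := CbS_bounded (smooth_cb_partial ik sf 0%N).
exists (\sum_i \sum_k `|C (i, k)|); split.
  by apply: sumr_ge0 => i _; apply: sumr_ge0.
move=> a a0 k wl; rewrite (dir_deriv_unit T_ge0 mq q_ge0 q_bnd wl a0 k rF).
rewrite (le_trans (ler_norm_sum _ _ _))// mulr_suml; apply: ler_sum => i _.
rewrite normrM ler_pM//; last by rewrite ger0_norm ?cov_kernel_le ?cov_kernel_ge0.
rewrite (le_trans (HC (i, k) _))// (bigD1 k)//=.
rewrite (le_trans (ler_norm _))// lerDl; exact: sumr_ge0.
Qed.

(** Brownian integration by parts with [stopped q a] for [beta]. The Lipschitz constant of the
    stopped primitive is uniform over a <= R0. *)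
Lemma unit_ibp (R0 : R) : exists K : R, 0 <= K /\
  forall F (a : R) (a0 : 0 <= a) k l (dl : R), FCb F -> a <= R0 -> 0 < dl ->
  `|\int[mw]_w dir_deriv F (unit a0 k) (w, l)| <=
    dl * K + (2 * dl)^-1 * \int[mw]_w (F (comp_path (w, l)) ^+ 2).
Proof.
have [c [c0 Hc]] := stopped_lip_min mq q_ge0 q_bnd R0.
exists (4 * c ^+ 2 * `|R0|); split; first by rewrite mulr_ge0// mulr_ge0// sqr_ge0.
move=> F a a0 k l dl /(FCbP T_ge0)[n [t [f rF]]] aR dl0; have [sf _ FE] := rF.
have i0 : 0 <= \int[mw]_w (F (comp_path (w, l)) ^+ 2).
  by apply: Rintegral_ge0 => w _; exact: sqr_ge0.
have d2 : 0 <= (2 * dl)^-1 by rewrite invr_ge0 mulr_ge0// ltW.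
have k0 : 0 <= 4 * c ^+ 2 by rewrite mulr_ge0// sqr_ge0.
have [va|va] := pselect (time_dom M a); last first.
  have H0 w : dir_deriv F (unit a0 k) (w, l) = 0.
    rewrite (dir_deriv_unit T_ge0 mq q_ge0 q_bnd (w, l) a0 k rF) big1// => i _.
    by rewrite /cov_kernel (asboolF va) andbF mulr0.
  rewrite (eq_Rintegral _ (fun w _ => H0 w)) {1}/Rintegral integral0 normr0.
  by rewrite addr_ge0// mulr_ge0// ?(ltW dl0)// mulr_ge0.
have b0 : stopped q a 0 = 0 by rewrite /stopped min_l// primitive0.
rewrite (eq_Rintegral _ (fun w _ => dir_deriv_unit T_ge0 mq q_ge0 q_bnd (w, l) a0 k rF)).
have := @brownian_ibp R d M mw n f (fun i => l (t i)) (stopped q a) c a k dl bm sf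
  (fun i => spath_ge0 l (t i)) a0 b0 (fun x y _ xy => Hc a x y aR xy) dl0.
rewrite (_ : \int[mw]_w _ = \int[mw]_w (\sum_i partial f (i, k) (points t (w \o l)) *
    cov_kernel M q (l (t i)) a)); last first.
  apply: eq_Rintegral => w _; apply: eq_bigr => i _; rewrite mulrC; congr (_ * _).
  by rewrite /cov_kernel (asboolT va) andbT; case: asboolP.
rewrite (_ : \int[mw]_w (f _ ^+ 2) = \int[mw]_w (F (comp_path (w, l)) ^+ 2)); last first.
  by apply: eq_Rintegral => w _; rewrite FE.
move=> /le_trans; apply; rewrite lerD2r ler_pM2l// ler_wpM2l//.
by rewrite (le_trans aR)// ler_norm.
Qed.

Lemma FCb_fst_sq F l : FCb F -> sq_integrable mw (fun w => F (comp_path (w, l))).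
Proof.
move=> FF; have [C FC] := FCb_bounded T_ge0 FF.
exact: (bounded_sq_integrable _ (FCb_fst_measurable l FF) (fun w => FC (comp_path (w, l)))).
Qed.

Lemma dir_deriv_unit_sq F (a : R) (a0 : 0 <= a) k l : FCb F ->
  sq_integrable mw (fun w => dir_deriv F (unit a0 k) (w, l)).
Proof.
move=> FF; have [C [_ HC]] := dir_deriv_unit_bounded FF.
exact: (bounded_sq_integrable _ (dir_deriv_unit_measurable a0 k l FF) (fun w => HC a a0 k (w, l))).
Qed.

Let sq_integrable_integrable (u : wpath d M -> R) : sq_integrable mw u ->
  mw.-integrable setT (EFin \o u).
Proof.
move=> su; have := sq_integrable_mul su (sq_integrable_cst mw 1).
by apply: eq_integrable => // w _ /=; rewrite mulr1.
Qed.

(** The product rule Q DF = D(QF) - F DQ: the first term is a pure derivative, and in the second [F]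
    is no longer differentiated. *)
Lemma ibp_term Q (R0 : R) : FCb Q -> exists K : R, 0 <= K /\
  forall F (a : R) (a0 : 0 <= a) k l (dl : R), FCb F -> a <= R0 -> 0 < dl ->
  `|\int[mw]_w (Q (comp_path (w, l)) * dir_deriv F (unit a0 k) (w, l))| <=
    dl * K + (2 * dl)^-1 * (K * \int[mw]_w (F (comp_path (w, l)) ^+ 2)).
Proof.
move=> FQ; have [C QC] := FCb_bounded T_ge0 FQ.
have [K [K0 HK]] := unit_ibp R0; have [B [B0 HB]] := dir_deriv_unit_bounded FQ.
pose B1 := B * primitive q R0.
have B10 : 0 <= B1 by rewrite mulr_ge0// primitive_ge0.
exists (K + B1 ^+ 2 + C ^+ 2 + 1); split; first by rewrite !addr_ge0// sqr_ge0.
move=> F a a0 k l dl FF aR dl0.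
have FQF := FCb_mul T_ge0 FQ FF.
rewrite (_ : \int[mw]_w _ =
  \int[mw]_w (dir_deriv (fun x => Q x * F x) (unit a0 k) (w, l)
    - dir_deriv Q (unit a0 k) (w, l) * F (comp_path (w, l)))); last first.
  by apply: eq_Rintegral => w _; rewrite (dir_deriv_mul T_ge0 _ _ FQ FF); ring.
have sD := dir_deriv_unit_sq a0 k l FQF; have sQ := dir_deriv_unit_sq a0 k l FQ.
have sF := FCb_fst_sq l FF; have sQF := FCb_fst_sq l FQF.
have i2 := sq_integrable_mul sQ sF.
rewrite RintegralB//; last exact: sq_integrable_integrable.
have h1 := HK _ a a0 k l dl FQF aR dl0.
have [mQ iQ] := sQ; have [mF iF] := sF.
have h2 := Rintegral_young dl0 mQ mF iQ iF.
have h3 : \int[mw]_w ((Q (comp_path (w, l)) * F (comp_path (w, l))) ^+ 2) <=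
    C ^+ 2 * \int[mw]_w (F (comp_path (w, l)) ^+ 2).
  rewrite -RintegralZl//; apply: le_Rintegral => //; first by case: sQF.
    exact: integrableZlR.
  move=> w _; rewrite exprMn ler_wpM2r ?sqr_ge0//.
  by rewrite -[leLHS]real_normK ?num_real// lerXn2r ?nnegrE// (le_trans _ (QC (comp_path (w, l)))).
have h4 : \int[mw]_w (dir_deriv Q (unit a0 k) (w, l) ^+ 2) <= B1 ^+ 2.
  rewrite -(sq_norm_cst mw); apply: sq_norm_le => //; first exact: sq_integrable_cst.
  move=> w /=; rewrite (ger0_norm B10) (le_trans (HB a a0 k (w, l)))// ler_wpM2l//.
  exact: primitive_le.
have I0 : 0 <= \int[mw]_w (F (comp_path (w, l)) ^+ 2).
  by apply: Rintegral_ge0 => w _; exact: sqr_ge0.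
apply: (le_trans (ler_normB _ _)).
exact: ibp_bound h1 h2 h3 h4 I0.
Qed.

Lemma carre_fst_integrable F G l : FCb F -> FCb G ->
  mw.-integrable setT (EFin \o (fun w => carre p kappa F G (w, l))).
Proof.
move=> FF /(FCbP T_ge0)[n [t [g rG]]].
rewrite (funext (fun w => carre_unit T_ge0 mq q_ge0 q_bnd qp (w, l) FF rG)).
apply: integrable_sumR => j; apply: integrable_sumR => k; case: (rG) => sg tT _.
have FQ : FCb (fun x : opath d M T => partial g (j, k) (points t x)).
  by apply/(FCbP T_ge0); exists n, t, (partial g (j, k)); split=> //; exact: smooth_cb_partial.
exact: (sq_integrable_mul (FCb_fst_sq l FQ) (dir_deriv_unit_sq (spath_ge0 l (t j)) k l FF)).
Qed.

Lemma carre_fst_bound G n (t : 'I_n -> R) g (R0 : R) : cyl_rep t g G ->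
  exists K : R, 0 <= K /\ forall F l (dl : R), FCb F -> (forall j, l (t j) <= R0) -> 0 < dl ->
  `|\int[mw]_w carre p kappa F G (w, l)| <=
    dl * K + (2 * dl)^-1 * (K * \int[mw]_w (F (comp_path (w, l)) ^+ 2)).
Proof.
move=> rG; case: (rG) => sg tT _.
have FQ jk : FCb (fun x : opath d M T => partial g jk (points t x)).
  by apply/(FCbP T_ge0); exists n, t, (partial g jk); split=> //; exact: smooth_cb_partial.
have /choice[K HK] jk := ibp_term R0 (FQ jk).
have K0 jk : 0 <= K jk by case: (HK jk).
exists (\sum_j \sum_k K (j, k)); split.
  by apply: sumr_ge0 => j _; apply: sumr_ge0.
move=> F l dl FF lR dl0.
rewrite (eq_Rintegral _ (fun w _ => carre_unit T_ge0 mq q_ge0 q_bnd qp (w, l) FF rG)).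
have I1 j k : mw.-integrable setT (EFin \o (fun w : wpath d M =>
    partial g (j, k) (points t (w \o l)) * dir_deriv F (unit (spath_ge0 l (t j)) k) (w, l))).
  exact: (sq_integrable_mul (FCb_fst_sq l (FQ (j, k)))
    (dir_deriv_unit_sq (spath_ge0 l (t j)) k l FF)).
rewrite Rintegral_sumR; last by move=> j; exact: integrable_sumR.
rewrite mulr_sumr mulr_suml mulr_sumr -big_split/=.
apply: (le_trans (ler_norm_sum _ _ _)); apply: ler_sum => j _.
rewrite Rintegral_sumR//.
rewrite mulr_sumr mulr_suml mulr_sumr -big_split/=.
apply: (le_trans (ler_norm_sum _ _ _)); apply: ler_sum => k _.
by have [_ H] := HK (j, k); exact: (H F _ (spath_ge0 l (t j)) k l dl FF (lR j) dl0).
Qed.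

(** The truncation in l: on this set all times at which the directions are stopped are at most [R0],
    so one constant of integration by parts serves every l. *)
Let good n (t : 'I_n -> R) (R0 : R) : set (spath T) := [set l | forall j, l (t j) <= R0].

Let good_meas n (t : 'I_n -> R) (R0 : R) : measurable (good t R0).
Proof.
rewrite (_ : good t R0 = \bigcap_(j in [set: 'I_n]) (fun l : spath T => l (t j)) @^-1` `]-oo, R0]).
  apply: fin_bigcap_measurable => // j _; rewrite -[X in measurable X]setTI.
  exact: measurable_scoord.
apply/seteqP; split => l /= H; first by move=> j _ /=; rewrite in_itv/=; exact: H.
by move=> j; have := H j I; rewrite /= in_itv.
Qed.

(** The bound for fixed l is integrated over l by Fubini's theorem; outside [good] the inner
    integral is 0. *)
Lemma carre_good_bound G n (t : 'I_n -> R) g (R0 : R) : cyl_rep t g G ->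
  exists K : R, 0 <= K /\ forall F (dl : R), FCb F -> 0 < dl ->
  `|\int[m]_wl (\1_(good t R0) wl.2 * carre p kappa F G wl)| <=
    dl * K + (2 * dl)^-1 * (K * sq_norm mS F).
Proof.
move=> rG; have [K [K0 HK]] := carre_fst_bound R0 rG.
have FG : FCb G by apply/(FCbP T_ge0); exists n, t, g.
exists K; split=> // F dl FF dl0.
have mi : measurable_fun setT (fun wl : Pair => \1_(good t R0) wl.2 : R).
  apply: (measurableT_comp (f := \1_(good t R0) : spath T -> R)); last exact: measurable_snd.
  exact: measurable_indic (good_meas t R0).
pose f (wl : Pair) := \1_(good t R0) wl.2 * carre p kappa F G wl.
have If : m.-integrable setT (EFin \o f).
  have IC := carre_integrable T_ge0 mw mq q_ge0 q_bnd qp int_primitive FF FG.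
  apply: le_integrable IC => //.
    apply/measurable_EFinP; apply: measurable_funM => //.
    apply/measurable_EFinP.
    by case/integrableP: (carre_integrable T_ge0 mw mq q_ge0 q_bnd qp int_primitive FF FG).
  move=> wl _; rewrite /= lee_fin /f normrM ler_piMl// indicE.
  by case: (_ \in _); rewrite ?normr1 ?normr0.
have d2 : 0 <= (2 * dl)^-1 by rewrite invr_ge0 mulr_ge0// ltW.
pose s l := \int[mw]_w (F (comp_path (w, l)) ^+ 2).
have sE l : fubini_G mw (fun wl => (F (comp_path wl) ^+ 2)%:E) l = (s l)%:E.
  rewrite /fubini_G /s /Rintegral fineK//.
  by have [_ /integrable_fin_num] := FCb_fst_sq l FF; exact.
have phi l : (`|fubini_G mw (EFin \o f) l| <= (dl * K + (2 * dl)^-1 * (K * s l))%:E)%E.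
  have s0 : 0 <= s l by apply: Rintegral_ge0 => w _; exact: sqr_ge0.
  rewrite /fubini_G; have [lg|lg] := pselect (good t R0 l); last first.
    rewrite (eq_integral (cst 0%E)) ?integral0 ?abse0 ?lee_fin.
      by rewrite addr_ge0// ?mulr_ge0// ?(ltW dl0).
    by move=> w _; rewrite /= /f indicE memNset//= mul0r.
  rewrite (eq_integral (fun w => (carre p kappa F G (w, l))%:E)); last first.
    by move=> w _; rewrite /= /f indicE mem_set//= mul1r.
  have iC := integrable_fin_num measurableT (carre_fst_integrable l FF FG).
  rewrite -[X in `|X|%E]fineK// abse_EFin lee_fin; exact: HK.
have iF2 : m.-integrable setT (fun wl : Pair => (F (comp_path wl) ^+ 2)%:E).
  by case: (FCb_comp_sq T_ge0 mw la FF).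
have Is : la.-integrable setT (EFin \o s).
  have mG := measurable_fubini_G iF2; apply/integrableP; split.
    by move: mG; congr measurable_fun; apply/funext => l; exact: sE.
  apply: le_lt_trans (integrable_lty measurableT iF2).
  rewrite -(integral21_prod_meas1 iF2) le_eqVlt; apply/orP; left; apply/eqP.
  apply: eq_integral => l _; rewrite sE gee0_abs// lee_fin.
  by apply: Rintegral_ge0 => w _; exact: sqr_ge0.
have sS : \int[la]_l s l = sq_norm mS F.
  rewrite (sq_norm_comp T_ge0 mw la FF) /sq_norm /Rintegral; congr fine.
  by rewrite -(integral21_prod_meas1 iF2); apply: eq_integral => l _; rewrite sE.
have Ib : la.-integrable setT (EFin \o (fun l => dl * K + (2 * dl)^-1 * (K * s l))).
  have := integrableD measurableT (finite_measure_integrable_cst la (dl * K) measurableT)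
    (integrableZlR ((2 * dl)^-1 * K) Is).
  by apply: eq_integrable => // l _ /=; rewrite -EFinD mulrA.
have -> : dl * K + (2 * dl)^-1 * (K * sq_norm mS F) =
    \int[la]_l (dl * K + (2 * dl)^-1 * (K * s l)).
  rewrite (eq_Rintegral _ (g := fun l => cst (dl * K) l + (2 * dl)^-1 * K * s l)).
    rewrite RintegralD//; last 2 first.
    - exact: finite_measure_integrable_cst.
    - exact: integrableZlR.
    rewrite (@RintegralZl _ _ _ la setT s ((2 * dl)^-1 * K) measurableT Is) sS mulrA.
    by have /= -> := Rintegral_cst la measurableT (dl * K); rewrite probability_setT mulr1.
  by move=> l _ /=; rewrite mulrA.
have Mphi := measurable_fubini_G If.
rewrite -lee_fin /Rintegral fineK ?integrable_fin_num//.
rewrite -abse_EFin fineK ?integrable_fin_num// -(integral21_prod_meas1 If).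
apply: le_trans (le_abse_integral la measurableT _) _; first exact: Mphi.
apply: ge0_le_integral => //.
- exact: measurableT_comp.
- by case/integrableP: Ib.
Qed.

Let indic_bound (A : set (spath T)) F G : measurable A -> FCb F -> FCb G ->
  m.-integrable setT (EFin \o (fun wl : Pair => \1_A wl.2 * carre p kappa F G wl)).
Proof.
move=> mA FF FG; have IC := carre_integrable T_ge0 mw mq q_ge0 q_bnd qp int_primitive FF FG.
apply: le_integrable IC => //.
  apply/measurable_EFinP; apply: measurable_funM => //; last first.
    apply/measurable_EFinP.
    by case/integrableP: (carre_integrable T_ge0 mw mq q_ge0 q_bnd qp int_primitive FF FG).
  apply: (measurableT_comp (f := \1_A : spath T -> R)); last exact: measurable_snd.
  exact: measurable_indic mA.
move=> wl _; rewrite /= lee_fin normrM ler_piMl// indicE.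
by case: (_ \in _); rewrite ?normr1 ?normr0.
Qed.

(** The sets [good] exhaust the space of time changes as the bound grows, and the energy density of
    [G] is an integrable dominating function. *)
Lemma carre_bad_small G n (t : 'I_n -> R) (e : R) : FCb G -> 0 < e -> exists N : nat,
  \int[m]_wl (\1_(~` good t N%:R) wl.2 * carre p kappa G G wl) < e.
Proof.
move=> FG e0.
pose f (N : nat) (wl : Pair) := \1_(~` good t N%:R) wl.2 * carre p kappa G G wl.
have mB (N : nat) : measurable (~` good t N%:R) by apply: measurableC; exact: good_meas.
have If N : m.-integrable setT (EFin \o f N) by exact: indic_bound.
have IC := carre_integrable T_ge0 mw mq q_ge0 q_bnd qp int_primitive FG FG.
have [] := @dominated_convergence _ _ _ m setT measurableT (fun N => EFin \o f N)
  (cst 0%E) (EFin \o (fun wl => carre p kappa G G wl)).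
- by move=> N; case/integrableP: (If N).
- exact: measurable_cst.
- apply: nearW => wl _; apply: cvg_near_cst.
  near=> N; rewrite /f /= indicE memNset ?mul0r//=; apply: contrapT => h; apply: h => /=.
  move=> h; apply: h => j.
  (* The values are nonnegative, so their sum bounds each of them. *)
  apply: (@le_trans _ _ (Num.truncn (\sum_j wl.2 (t j))).+1%:R).
    apply: ltW; apply: le_lt_trans (truncnS_gt _).
    rewrite (bigD1 j)//= lerDl; apply: sumr_ge0 => i _; exact: spath_ge0.
  rewrite ler_nat; near: N; exact: nbhs_infty_ge.
- exact: IC.
- apply: nearW => wl N _; rewrite /f /= lee_fin normrM indicE.
  rewrite (ger0_norm (carre_ge0 _ _ _ _)) ler_piMl ?carre_ge0//.
  by case: (_ \in _); rewrite ?normr1 ?normr0.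
move=> _ _; rewrite integral0 => /fine_cvgP[_ /cvgrPdist_lt/(_ _ e0)[N _ HN]].
exists N; have := HN N (leqnn N); rewrite /= sub0r normrN.
by apply: le_lt_trans; exact: ler_norm.
Unshelve. all: by end_near. Qed.

Let E := grad_form p m kappa.

Let HE : nonneg_form (@FCb R d M T) E.
Proof. exact: (form_nonneg T_ge0 mw mq q_ge0 q_bnd qp int_primitive). Qed.

(** E(a n, G) is split according to [good]. On the complement, Young's inequality weighs the bounded
    energies of [a n] against the small remaining energy of [G]; on [good], integration by parts
    leaves only the L^2-norm of [a n]. The truncation level is chosen before the constant [K], which
    depends on it, and n comes last. *)
Lemma form_weak0 (a : nat -> opath d M T -> R) (B : R) : (forall n, FCb (a n)) -> 0 <= B ->
  (forall n, E (a n) (a n) <= B) -> sq_norm mS (a n) @[n --> \oo] --> (0 : R) ->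
  forall G (e : R), FCb G -> 0 < e -> exists N : nat, forall n, (N <= n)%N -> `|E (a n) G| < e.
Proof.
move=> Fa B0 EB /cvgrPdist_lt a0 G e FG e0.
have [n [t [g rG]]] := (FCbP T_ge0 G).1 FG.
have e2 : 0 < e / 2 by rewrite divr_gt0.
have [del [del0 sdel hdel]] := young_small B0 e2.
have [N tail] := carre_bad_small t FG sdel.
have [K [K0 HK]] := carre_good_bound N%:R rG.
have [dl [dl0 sdl hdl]] := young_small K0 e2.
have K1 : 0 < K + 1 by rewrite ltr_wpDl.
(* Below this threshold K times the squared norm meets the smallness asked for by [hdl]; K + 1
   avoids a division by 0. *)
have sdlK : 0 < dl * (e / 2) / 2 / (K + 1) by rewrite divr_gt0.
have [N0 _ HN0] := a0 _ sdlK.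
exists N0 => k kN0; have := HN0 k kN0; rewrite /= sub0r normrN ger0_norm ?sq_norm_ge0// => ak.
have Ksq : K * sq_norm mS (a k) < dl * (e / 2) / 2.
  rewrite ltr_pdivlMr// in ak; apply: le_lt_trans ak; rewrite mulrC ler_wpM2l ?sq_norm_ge0//.
  by rewrite lerDl.
have g1 := HK (a k) dl (Fa k) dl0.
have g2 : `|\int[m]_wl (\1_(good t N%:R) wl.2 * carre p kappa (a k) G wl)| < e / 2.
  have := hdl _ 0 Ksq sdl; rewrite addr0; exact: le_lt_trans g1.
pose bad := ~` good t N%:R.
have mbad : measurable bad by apply: measurableC; exact: good_meas.
have g3 : `|\int[m]_wl (\1_bad wl.2 * carre p kappa (a k) G wl)| <=
    del / 2 * E (a k) (a k) + (2 * del)^-1 * \int[m]_wl (\1_bad wl.2 * carre p kappa G G wl).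
  have I1 := indic_bound mbad (Fa k) FG; have I2 := indic_bound mbad FG FG.
  have I3 := carre_integrable T_ge0 mw mq q_ge0 q_bnd qp int_primitive (Fa k) (Fa k).
  apply: le_trans (le_normr_Rintegral measurableT I1) _.
  rewrite /E /grad_form -(RintegralZl _ measurableT I3) -(RintegralZl _ measurableT I2).
  rewrite -(RintegralD measurableT (integrableZlR _ I3) (integrableZlR _ I2)).
  apply: le_Rintegral => //.
  - exact: (integrable_norm I1).
  - have := integrableD measurableT (integrableZlR (del / 2) I3) (integrableZlR (2 * del)^-1 I2).
    by apply: eq_integrable.
  move=> wl _; have cl := carre_nonneg_form T_ge0 mq q_ge0 q_bnd qp wl.
  have ca0 := nf_ge0 cl (Fa k).
  have y := nf_young cl del0 (Fa k) FG.
  rewrite normrM indicE; case: (_ \in _); rewrite ?normr1 ?normr0 ?mul1r// !mul0r mulr0 addr0.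
  by rewrite mulr_ge0// divr_ge0// ltW.
have g4 : `|\int[m]_wl (\1_bad wl.2 * carre p kappa (a k) G wl)| < e / 2.
  apply: le_lt_trans g3 _; have := hdel _ 0 tail sdel; rewrite addr0.
  apply: le_lt_trans; rewrite lerD2r -mulrA ler_pM2l//.
  have Ea := nf_ge0 HE (Fa k); have := EB k; lra.
have -> : E (a k) G = \int[m]_wl (\1_(good t N%:R) wl.2 * carre p kappa (a k) G wl) +
    \int[m]_wl (\1_bad wl.2 * carre p kappa (a k) G wl).
  rewrite -(RintegralD measurableT (indic_bound (good_meas t N%:R) (Fa k) FG) (indic_bound mbad (Fa k) FG)).
  apply: eq_Rintegral => wl _; rewrite -mulrDl !indicE in_setC.
  by case: (_ \in _); rewrite /= ?addr0 ?add0r mul1r.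
apply: (le_lt_trans (ler_normD _ _)); have := ltrD g2 g4.
by rewrite (_ : e / 2 + e / 2 = e)//; field.
Qed.

(** E(a n, a n) = E(a n, a n - a N) + E(a n, a N) with N fixed. The first term is small by the
    Cauchy property and bounded energies, the second by [form_weak0]. *)
Lemma form_closable : closable mS (@FCb R d M T) E.
Proof.
move=> a Fa /L2_cvgP a0 ca.
have {}a0 : sq_norm mS (a n) @[n --> \oo] --> (0 : R).
  rewrite (_ : (fun n => sq_norm mS (a n)) = fun n => sq_norm mS (a n \- cst 0)).
    by apply: a0 => [n|]; [exact: FCb_sq|exact: sq_integrable_cst].
  by apply/funext => n; apply: eq_Rintegral => x _; rewrite /= subr0.
have [B [B0 HB]] := nf_cauchy_bounded HE Fa ca.
apply/cvgrPdist_lt => e e0; have e2 : 0 < e / 2 by rewrite divr_gt0.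
have [dl [dl0 sdl hdl]] := young_small B0 e2.
have [N HN] := ca _ sdl.
have [N1 HN1] := form_weak0 Fa B0 HB a0 (Fa N) e2.
exists (maxn N N1) => // n /=; rewrite geq_max => /andP[Nn N1n].
rewrite sub0r normrN.
have -> : E (a n) (a n) = E (a n) (a n \- a N) + E (a n) (a N).
  by rewrite (nf_subr HE)// subrK.
have FB := nf_domB HE (Fa n) (Fa N).
have h1 := nf_young HE dl0 (Fa n) FB.
have h2 := hdl _ 0 (HN n N Nn (leqnn N)) sdl.
have h3 : `|E (a n) (a n \- a N)| < e / 2.
  apply: le_lt_trans h1 _; move: h2; rewrite addr0; apply: le_lt_trans.
  rewrite lerD2r -mulrA ler_pM2l//.
  have Ea := nf_ge0 HE (Fa n); have := HB n; lra.
apply: (le_lt_trans (ler_normD _ _)); have := ltrD h3 (HN1 n N1n).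
by rewrite (_ : e / 2 + e / 2 = e)//; field.
Qed.

End closability.

(** * Density of the cylinder functions *)

Section square_approximation.
Context {R : realType} {dX} {X : measurableType dX} (m : probability X R).
Variable C : set (X -> R).
Implicit Types (u v : X -> R) (A B : set X).
Hypotheses (C_sq : forall u, C u -> sq_integrable m u)
  (C_lin : forall (c : R) u v, C u -> C v -> C (fun x => c * u x + v x))
  (C_mul : forall u v, C u -> C v -> C (fun x => u x * v x))
  (C_cst : forall c, C (cst c))
  (C_clamp : forall u (e : R), C u -> 0 < e -> exists2 v, C v &
    forall x, `|v x - Num.min (Num.max (u x) 0) 1| <= e).

Definition sq_approx u := sq_integrable m u /\
  forall e : R, 0 < e -> exists2 v, C v & sq_norm m (u \- v) < e.

Lemma sq_approx_core u : C u -> sq_approx u.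
Proof.
move=> Cu; split=> [|e e0]; first exact: C_sq.
exists u => //; rewrite (_ : sq_norm _ _ = 0)//.
by rewrite /sq_norm /Rintegral (eq_integral (cst 0%E)) ?integral0// => x _;
  rewrite /= subrr expr0n.
Qed.

Lemma sq_approx_closed u : sq_integrable m u ->
  (forall e : R, 0 < e -> exists2 v, sq_approx v & sq_norm m (u \- v) < e) -> sq_approx u.
Proof.
move=> su H; split=> // e e0; have e4 : 0 < e / 4 by rewrite divr_gt0.
have [v [sv Hv] uv] := H _ e4; have [w Cw vw] := Hv _ e4.
exists w => //; have := sq_normBle su sv (C_sq Cw); lra.
Qed.

Lemma sq_approx_lin (c : R) u v : sq_approx u -> sq_approx v ->
  sq_approx (fun x => c * u x + v x).
Proof.
move=> [su Hu] [sv Hv]; split=> [|e e0]; first exact: sq_integrableP.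
have c1 : 0 < 4 * (c ^+ 2 + 1) by rewrite mulr_gt0// ltr_wpDl ?sqr_ge0.
have d0 : 0 < e / (4 * (c ^+ 2 + 1)) by rewrite divr_gt0.
have [u' Cu' uu'] := Hu _ d0; have [v' Cv' vv'] := Hv (e / 4) (divr_gt0 e0 (ltr0Sn _ 3)).
exists (fun x => c * u' x + v' x); first exact: C_lin.
have s1 := sq_integrableB su (C_sq Cu'); have s2 := sq_integrableB sv (C_sq Cv').
have s3 := sq_integrableZ c s1.
have h := sq_normDle s3 s2.
have q3 : sq_norm m (fun x => c * (u \- u') x) = c ^+ 2 * sq_norm m (u \- u').
  rewrite /sq_norm -RintegralZl//; last by case: s1.
  by apply: eq_Rintegral => x _; rewrite exprMn.
rewrite q3 in h; apply: le_lt_trans (_ : _ <= 2 * (c ^+ 2 * sq_norm m (u \- u')) + 2 * sq_norm m (v \- v')) _.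
  apply: le_trans h; rewrite le_eqVlt; apply/orP; left; apply/eqP.
  by apply: eq_Rintegral => x _ /=; ring.
rewrite ltr_pdivlMr// in uu'.
have := sq_norm_ge0 m (u \- u'); nra.
Qed.

(** Dominated convergence for the squared differences. It is applied to indicators, to truncations
    and to soft clamps. *)
Lemma bounded_cvg_sq (a : nat -> X -> R) u g : measurable_fun setT u ->
  (forall n, measurable_fun setT (a n)) -> sq_integrable m g ->
  (forall n x, `|u x - a n x| <= `|g x|) ->
  (forall x, a n x @[n --> \oo] --> u x) -> forall e : R, 0 < e ->
  exists n, sq_norm m (u \- a n) < e.
Proof.
move=> mu ma [mg ig] ug au e e0.
have md n : measurable_fun setT (u \- a n) by exact: measurable_funB.
have [] := @dominated_convergence _ _ _ m setT measurableT
  (fun n x => ((u x - a n x) ^+ 2)%:E) (cst 0%E) (fun x => (g x ^+ 2)%:E).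
- by move=> n; apply/measurable_EFinP; apply: measurable_funX; exact: md.
- exact: measurable_cst.
- apply: nearW => x _; apply: cvg_EFin; first exact: nearW.
  have h : u x - a n x @[n --> \oo] --> u x - u x by apply: cvgB; [exact: cvg_cst|exact: au].
  rewrite subrr in h.
  have h2 : (u x - a n x) * (u x - a n x) @[n --> \oo] --> (0 * 0 : R) by exact: cvgM.
  rewrite mulr0 in h2; suff : (u x - a n x) ^+ 2 @[n --> \oo] --> (0 : R) by [].
  by under eq_fun do rewrite expr2.
- exact: ig.
- apply: nearW => x n _; rewrite abse_EFin lee_fin ger0_norm ?sqr_ge0//.
  rewrite -[(u x - _) ^+ 2]real_normK ?num_real// -[g x ^+ 2]real_normK ?num_real//.
  by rewrite lerXn2r ?nnegrE.
move=> _ _; rewrite integral0 => /fine_cvgP[_ /cvgrPdist_lt/(_ _ e0)[N _ HN]].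
exists N; have := HN N (leqnn N); rewrite /= sub0r normrN.
by apply: le_lt_trans; exact: ler_norm.
Qed.

Let sq_indic A : measurable A -> sq_integrable m (\1_A : X -> R).
Proof.
move=> mA; apply: (@bounded_sq_integrable _ _ _ m _ 1); first exact: measurable_indic.
by move=> x; rewrite indicE; case: (_ \in _); rewrite ?normr1 ?normr0.
Qed.

(** The density argument shows that these sets form a sigma-algebra which contains the generating
    half-spaces, hence every measurable set. *)
Definition approx_sets := [set A | measurable A /\ sq_approx (\1_A : X -> R)].

Let approx_setC A : approx_sets A -> approx_sets (~` A).
Proof.
move=> [mA aA]; split; first exact: measurableC.
have := sq_approx_lin (-1) aA (sq_approx_core (C_cst 1)).
congr sq_approx; apply/funext => x; rewrite !indicE in_setC.
by case: (_ \in _); rewrite /= ?mulr1 ?mulr0 ?addNr ?add0r.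
Qed.

(** A clamp makes the approximating functions uniformly bounded, which L^2-closeness does not give
    and which products of approximants require. *)
Let bounded_approx A (e : R) : approx_sets A -> 0 < e -> exists v,
  [/\ C v, forall x, `|v x| <= 2 & sq_norm m (\1_A \- v) < e].
Proof.
move=> [mA [sA aA]] e0.
have e4 : 0 < e / 4 by rewrite divr_gt0.
have [u Cu uA] := aA _ e4.
pose e' := Num.min 1 (e / 4); have e'0 : 0 < e' by rewrite lt_min ltr01.
have [v Cv vu] := C_clamp Cu e'0.
pose cu x := Num.min (Num.max (u x) 0) 1.
have cu01 x : 0 <= cu x <= 1 by rewrite /cu le_min le_max lexx orbT ler01 ge_min lexx orbT.
have mcu : measurable_fun setT cu.
  by apply: measurable_minr => //; apply: measurable_maxr => //; case: (C_sq Cu).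
have scu : sq_integrable m cu.
  apply: (@bounded_sq_integrable _ _ _ m _ 1) => // x.
  by have /andP[h1 h2] := cu01 x; rewrite ger0_norm.
exists v; split=> //.
  move=> x; have -> : v x = (v x - cu x) + cu x by rewrite subrK.
  rewrite (le_trans (ler_normD _ _))// (_ : 2 = 1 + 1)// lerD//.
    by rewrite (le_trans (vu x))// ge_min lexx.
  by have /andP[h1 h2] := cu01 x; rewrite ger0_norm.
have := sq_normBle sA scu (C_sq Cv).
have h1 : sq_norm m (\1_A \- cu) <= sq_norm m (\1_A \- u).
  apply: sq_norm_le; [exact: sq_integrableB|exact: sq_integrableB sA (C_sq Cu)|].
  move=> x /=; have := clamp_lipschitz (\1_A x : R) (u x).
  rewrite [Num.min (Num.max (\1_A x) 0) 1](_ : _ = \1_A x)//.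
  by rewrite indicE; case: (_ \in _); rewrite /= ?maxxx ?min_l// max_l// minxx.
have h2 : sq_norm m (cu \- v) <= e'.
  apply: (@le_trans _ _ (sq_norm m (cst e'))).
    apply: sq_norm_le; first exact: sq_integrableB scu (C_sq Cv).
      exact: sq_integrable_cst.
    by move=> x /=; rewrite distrC (ger0_norm (ltW e'0)).
  by rewrite sq_norm_cst expr2 ler_piMr ?(ltW e'0)// ge_min lexx.
have h3 : e' <= e / 4 by rewrite ge_min lexx orbT.
lra.
Qed.

(** 1_A 1_B - u v = 1_B (1_A - u) + u (1_B - v), where 1_B is bounded by 1 and [u] by 2. The squared
    norms cost 2 + 8 shares of e / 16. *)
Let approx_setI A B : approx_sets A -> approx_sets B -> approx_sets (A `&` B).
Proof.
move=> aA aB; have [mA [sA _]] := aA; have [mB [sB _]] := aB.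
have mAB := measurableI _ _ mA mB.
split=> //; split; first exact: sq_indic.
move=> e e0; have e16 : 0 < e / 16 by rewrite divr_gt0.
have [u [Cu u2 uA]] := bounded_approx aA e16; have [v [Cv v2 vB]] := bounded_approx aB e16.
exists (fun x => u x * v x); first exact: C_mul.
have s1 : sq_integrable m (\1_A \- u) by exact: sq_integrableB sA (C_sq Cu).
have s2 : sq_integrable m (\1_B \- v) by exact: sq_integrableB sB (C_sq Cv).
have [m1 i1] := s1; have [m2 i2] := s2.
have bnd (w z : X -> R) (K : R) : measurable_fun setT w -> sq_integrable m z ->
    (forall x, `|w x| <= K) ->
    sq_integrable m (fun x => w x * z x) /\
    sq_norm m (fun x => w x * z x) <= K ^+ 2 * sq_norm m z.
  move=> mw sz wK; have K0 : 0 <= K := le_trans (normr_ge0 _) (wK point).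
  have sKz := sq_integrableZ K sz; have [mz iz] := sz.
  have le x : `|w x * z x| <= `|K * z x|.
    by rewrite !normrM ler_wpM2r// (ger0_norm K0).
  have swz : sq_integrable m (fun x => w x * z x).
    split; first exact: measurable_funM.
    have [mKz iKz] := sKz; apply: le_integrable iKz => //.
      by apply/measurable_EFinP; apply: measurable_funX; exact: measurable_funM.
    move=> x _; rewrite /= lee_fin !ger0_norm ?sqr_ge0//.
    rewrite -[leLHS]real_normK ?num_real// -[leRHS]real_normK ?num_real//.
    by rewrite lerXn2r ?nnegrE.
  split=> //; apply: (le_trans (sq_norm_le swz sKz le)).
  rewrite /sq_norm -RintegralZl// le_eqVlt; apply/orP; left; apply/eqP.
  by apply: eq_Rintegral => x _; rewrite exprMn.
have mu : measurable_fun setT u by case: (C_sq Cu).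
have [b1 b2] := bnd (\1_B) _ 1 (measurable_indic mB) s1 (fun x =>
  ltac:(by rewrite indicE; case: (_ \in _); rewrite ?normr1 ?normr0)).
have [b3 b4] := bnd u _ 2 mu s2 u2.
have h := sq_normDle b1 b3.
apply: le_lt_trans (_ : _ <= 2 * sq_norm m (fun x => \1_B x * (\1_A \- u) x) +
    2 * sq_norm m (fun x => u x * (\1_B \- v) x)) _; last by lra.
apply: le_trans h; rewrite le_eqVlt; apply/orP; left; apply/eqP.
by apply: eq_Rintegral => x _ /=; rewrite indicI /=; ring.
Qed.

Let approx_set0 : approx_sets set0.
Proof.
split=> //; rewrite indic0; exact: sq_approx_core.
Qed.

(** Complements and intersections yield finite unions, whose indicators increase to that of the
    countable union. *)
Lemma approx_sets_sigma_algebra : sigma_algebra setT approx_sets.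
Proof.
split=> [|A aA|F aF]; first exact: approx_set0.
  by rewrite setTD; exact: approx_setC.
have mF : measurable (\bigcup_n F n) by apply: bigcupT_measurable => n; case: (aF n).
split=> //; apply: sq_approx_closed; first exact: sq_indic.
move=> e e0; pose U n := \big[setU/set0]_(i < n) F i.
have aU n : approx_sets (U n).
  rewrite /U; elim: n => [|n ih]; first by rewrite big_ord0; exact: approx_set0.
  rewrite big_ord_recr/= -[X in approx_sets X]setCK setCU.
  by apply: approx_setC; apply: approx_setI; apply: approx_setC.
have [n Hn] : exists n, sq_norm m ((\1_(\bigcup_n F n) : X -> R) \- \1_(U n)) < e.
  apply: (@bounded_cvg_sq _ _ (cst 1)) => //.
  - by move=> n; apply: measurable_indic; case: (aU n).
  - exact: sq_integrable_cst.
  - move=> n x; rewrite !indicE normr1.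
    by case: (_ \in _); case: (_ \in _); rewrite ?subrr ?subr0 ?sub0r ?normrN ?normr1 ?normr0.
  - move=> x; have [[k _ Fkx]|nFx] := pselect ((\bigcup_n F n) x).
      apply: cvg_near_cst; near=> n; rewrite !indicE mem_set ?mem_set//.
        by exists k.
      rewrite /U -bigcup_mkord; exists k => //=; near: n; exact: nbhs_infty_gt.
    apply: cvg_near_cst; apply: nearW => n; rewrite !indicE memNset ?memNset//.
    by rewrite /U -bigcup_mkord => -[k _ Fkx]; apply: nFx; exists k.
by exists (\1_(U n)) => //; case: (aU n).
Unshelve. all: by end_near. Qed.

(** For z >= 0 this is the integer part of z capped at [K], written as a sum of indicators of upper
    level sets so that linearity applies. *)
Definition step_count (K : nat) (z : R) : R := \sum_(k < K) (nat_of_bool (k.+1%:R <= z)%R)%:R.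

Let step_count_le0 K z : z <= 0 -> step_count K z = 0.
Proof.
move=> z0; apply: big1 => k _; rewrite (_ : _ <= z = false)//.
by apply/negbTE; rewrite -ltNge (le_lt_trans z0).
Qed.

Let step_count_bounds K z : 0 <= z ->
  [/\ step_count K z <= z, step_count K z <= K%:R & z <= K%:R -> z - 1 <= step_count K z].
Proof.
move=> z0; have main k : step_count k z <= z /\ step_count k z <= k%:R /\
    Num.min k%:R (z - 1) <= step_count k z.
  elim: k => [|k [h1 [h2 h3]]]; first by rewrite /step_count big_ord0 ge_min lexx.
  have S : step_count k.+1 z = step_count k z + (nat_of_bool (k.+1%:R <= z)%R)%:R.
    by rewrite /step_count big_ord_recr.
  have kS : k.+1%:R = k%:R + 1 :> R by rewrite natr1.
  rewrite S; case: (leP k.+1%:R z) => kz; rewrite /= ?addr0 kS.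
    rewrite kS in kz; split; first lra.
    split; first by rewrite lerD2r.
    move: h3; rewrite min_l; last by lra.
    by move=> h3; rewrite ge_min lerD2r h3.
  rewrite kS in kz; split; first by [].
  split; first by rewrite (le_trans h2)// lerDl.
  move: h3; rewrite min_r; last by lra.
  by move=> h3; rewrite ge_min h3 orbT.
have [h1 [h2 h3]] := main K; split=> // zK.
by move: h3; rewrite min_r//; lra.
Qed.

Lemma sq_approx_all : (forall A, measurable A -> approx_sets A) ->
  forall u, sq_integrable m u -> sq_approx u.
Proof.
move=> HA u su; apply: sq_approx_closed => // e e0; have [mu iu] := su.
have sq_approx_sum (I : Type) (s : seq I) (f : I -> X -> R) :
    (forall i, sq_approx (f i)) -> sq_approx (fun x => \sum_(i <- s) f i x).
  move=> Hf; elim: s => [|i s ih].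
    have := sq_approx_core (C_cst 0); congr sq_approx.
    by apply/funext => x; rewrite big_nil.
  have := sq_approx_lin 1 (Hf i) ih; congr sq_approx.
  by apply/funext => x; rewrite big_cons mul1r.
have step_approx (c : R) K : sq_approx (fun x => step_count K (c * u x)).
  apply: sq_approx_sum => k.
  pose A := [set x | k.+1%:R <= c * u x].
  have mA : measurable A.
    rewrite (_ : A = (fun x => c * u x) @^-1` `[k.+1%:R, +oo[).
      rewrite -[X in measurable X]setTI.
      by apply: (measurable_funM (measurable_cst c) mu).
    by apply/seteqP; split => x /=; rewrite in_itv/= andbT.
  have [_] := HA A mA; congr sq_approx; apply/funext => x; rewrite indicE.
  by congr (nat_of_bool _)%:R; apply/idP/idP; rewrite inE.
(* Positive and negative parts are rounded down to multiples of 1 / (n + 1); with (n + 1)^2 levels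
   the cap is at n + 1. *)
pose a (n : nat) x := n.+1%:R^-1 *
  (step_count (n.+1 * n.+1) (n.+1%:R * u x) - step_count (n.+1 * n.+1) (- n.+1%:R * u x)).
have aA n : sq_approx (a n).
  have h0 := sq_approx_core (C_cst 0).
  have h1 := sq_approx_lin (- n.+1%:R^-1) (step_approx (- n.+1%:R) (n.+1 * n.+1)%N) h0.
  have := sq_approx_lin (n.+1%:R^-1) (step_approx n.+1%:R (n.+1 * n.+1)%N) h1.
  by congr sq_approx; apply/funext => x; rewrite /a /=; ring.
(* scaled down, z is replaced by an integer between 0 and z, at distance at most 1
   from z when |z| <= (n+1)^2 *)
have half (N y : R) K : 0 < N -> K%:R = N * N -> 0 <= y ->
    `|y - N^-1 * step_count K (N * y)| <= y /\
    (y <= N -> `|y - N^-1 * step_count K (N * y)| <= N^-1).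
  move=> N0 KN y0; have [|h1 _ h3] := @step_count_bounds K (N * y).
    by rewrite mulr_ge0// ltW.
  have iN0 : 0 < N^-1 by rewrite invr_gt0.
  have h4 : N^-1 * step_count K (N * y) <= y by rewrite mulrC ler_pdivrMr// [leRHS]mulrC.
  have h5 : 0 <= N^-1 * step_count K (N * y) by rewrite mulr_ge0 ?sumr_ge0// ltW.
  rewrite ger0_norm ?subr_ge0//; split; first by rewrite gerBl.
  move=> yN; have : N * y <= K%:R by rewrite KN ler_pM2l.
  move=> /h3 h6; rewrite lerBlDl -lerBlDr -(ler_pM2l N0) mulrBr divff ?gt_eqF//.
  by rewrite mulrA divff ?gt_eqF// mul1r.
have bnd (n : nat) x : `|u x - a n x| <= `|u x| /\
    (`|u x| <= n.+1%:R -> `|u x - a n x| <= n.+1%:R^-1).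
  have KN : (n.+1 * n.+1)%:R = n.+1%:R * n.+1%:R :> R by rewrite natrM.
  rewrite /a; have [y0|y0] := leP 0 (u x).
    rewrite [step_count _ (- _ * _)]step_count_le0; last first.
      by rewrite mulNr oppr_le0 mulr_ge0// ltW.
    by rewrite subr0 (ger0_norm y0); exact: half.
  have y0' : 0 <= - u x by rewrite oppr_ge0 ltW.
  rewrite [step_count _ (n.+1%:R * _)]step_count_le0; last first.
    by rewrite mulr_ge0_le0 ?ltW.
  rewrite sub0r mulrN opprK -normrN opprD mulNr -mulrN (ltr0_norm y0).
  exact: half.
have cva x : a n x @[n --> \oo] --> u x.
  apply/cvgrPdist_lt => ep ep0.
  exists (maxn (Num.truncn `|u x|) (Num.truncn ep^-1)) => // n /=.
  rewrite geq_max => /andP[n1 n2]; have [_ H] := bnd n x.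
  have un : `|u x| <= n.+1%:R.
    by rewrite ltW// (lt_le_trans (truncnS_gt _))// ler_nat ltnS.
  apply: (le_lt_trans (H un)); rewrite invf_plt ?posrE//.
  by rewrite (lt_le_trans (truncnS_gt _))// ler_nat ltnS.
have [n Hn] : exists n, sq_norm m (u \- a n) < e.
  apply: (bounded_cvg_sq mu _ su _ cva e0); last by move=> n x; case: (bnd n x).
  by move=> n; case: (aA n) => -[].
by exists (a n).
Qed.

End square_approximation.

(** * The coordinate sigma-algebra is approximated by cylinder functions *)

Section cylinder_density.
Context {R : realType} (d : nat) (M T : \bar R).
Hypothesis T_ge0 : (0 <= T)%E.
Variable mS : probability (opath d M T) R.
Local Notation C := (@FCb R d M T).

Let C_sq u : C u -> sq_integrable mS u.
Proof.
move=> Cu; have [B HB] := FCb_bounded T_ge0 Cu.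
exact: bounded_sq_integrable (FCb_measurable T_ge0 Cu) HB.
Qed.

Let C_clamp u (e : R) : C u -> 0 < e -> exists2 v, C v &
    forall x, `|v x - Num.min (Num.max (u x) 0) 1| <= e.
Proof.
move=> Cu e0; exists (fun x => soft_clamp e (u x)); first exact: FCb_clamp.
by move=> x; exact: soft_clamp_approx.
Qed.

Local Notation approx_sets := (approx_sets mS C).

Let sigma : sigma_algebra setT approx_sets.
Proof.
apply: (approx_sets_sigma_algebra C_sq) => //.
- exact: FCb_lin.
- exact: FCb_mul.
- exact: FCb_cst.
Qed.

(** The clamp of N (x t - a) is 0 up to [a] and equals 1 as soon as x t - a >= 1 / N. Its soft
    version with error 1 / N is a cylinder function and converges pointwise to the indicator. *)
Let ray (t : R) k (a : R) : time_dom T t ->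
  approx_sets ((fun x : opath d M T => x t ord0 k) @^-1` `]a, +oo[).
Proof.
move=> tT; set A := _ @^-1` _.
have mA : measurable A.
  by rewrite -[X in measurable X]setTI; exact: measurable_ocoord.
pose N (n : nat) : R := n.+1%:R.
pose v (n : nat) (x : opath d M T) := soft_clamp (N n)^-1 (N n * x t ord0 k + (- (N n * a))).
have Cv n : C (v n).
  apply/(FCbP T_ge0); exists 1%N, (fun=> t),
    (fun y : 'M[R]_(1, d) => soft_clamp (N n)^-1 (N n * y ord0 k + (- (N n * a)))).
  split=> //; last by apply/funext => x; rewrite /v /points mxE.
  have [h1 h2 h3] := smooth_affine_entry (ord0 : 'I_1) k (N n) (- (N n * a)).
  by apply: smooth_cb_soft_clamp; rewrite ?invr_gt0.
have N_inv n : (N n)^-1 <= 1 by rewrite invf_le1 ?ler1n.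
have app n x : `|v n x - Num.min (Num.max (N n * x t ord0 k - N n * a) 0) 1| <= (N n)^-1.
  by apply: soft_clamp_approx; rewrite invr_gt0.
have sA : sq_integrable mS (\1_A).
  apply: (@bounded_sq_integrable _ _ _ mS _ 1); first exact: measurable_indic.
  by move=> x; rewrite indicE; case: (_ \in _); rewrite ?normr1 ?normr0.
have indicA x : (\1_A x : R) = (a < x t ord0 k)%R%:R.
  rewrite indicE; congr (nat_of_bool _)%:R; apply/idP/idP; rewrite inE /A /= in_itv/= andbT//.
split=> //; apply: (sq_approx_closed C_sq) => // e e0.
have [n Hn] : exists n, sq_norm mS ((\1_A : _ -> R) \- v n) < e.
  apply: (@bounded_cvg_sq _ _ _ mS v _ (cst 3)) => //.
  - by move=> n; case: (C_sq (Cv n)).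
  - exact: sq_integrable_cst.
  (* The indicator is at most 1 and the soft clamp at most 1 + 1 / N <= 2, which explains the
     dominating constant 3. *)
  - move=> n x; rewrite /= [leRHS]ger0_norm//.
    have h := @soft_clamp_le _ (N n)^-1 _ (N n * x t ord0 k + (- (N n * a))).
    rewrite (le_trans (ler_normB _ _))// (_ : 3 = 1 + 2)// lerD//.
      by rewrite indicA; case: (_ < _); rewrite ?normr1 ?normr0.
    by rewrite (le_trans (h _)) ?invr_gt0// (_ : 2 = 1 + 1)// lerD2l.
  - move=> x; apply/cvgrPdist_lt => ep ep0.
    have [xa|ax] := leP (x t ord0 k) a.
      exists (Num.truncn ep^-1) => // n /= nep.
      have := app n x; rewrite max_r; last first.
        by rewrite subr_le0 ler_pM2l.
      rewrite min_l// subr0 indicA (_ : (a < x t ord0 k) = false); last first.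
        by rewrite ltNge xa.
      rewrite sub0r normrN => /le_lt_trans; apply.
      rewrite invf_plt ?posrE//.
      by rewrite (lt_le_trans (truncnS_gt _))// ler_nat ltnS.
    exists (maxn (Num.truncn ep^-1) (Num.truncn (x t ord0 k - a)^-1)) => // n /=.
    rewrite geq_max => /andP[nep nxa].
    have Nx : 1 <= N n * x t ord0 k - N n * a.
      rewrite -mulrBr -ler_pdivrMr ?subr_gt0// div1r ltW//.
      by rewrite (lt_le_trans (truncnS_gt _))// ler_nat ltnS.
    have := app n x; rewrite max_l; last by rewrite (le_trans _ Nx).
    rewrite min_r// indicA ax/= distrC => /le_lt_trans; apply.
    rewrite invf_plt ?posrE//.
    by rewrite (lt_le_trans (truncnS_gt _))// ler_nat ltnS.
by exists (v n) => //; apply: (sq_approx_core C_sq).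
Qed.

Let all_sets A : measurable A -> approx_sets A.
Proof.
have [s0 sC sU] := sigma.
apply: (smallest_sub sigma) => _ [[t k] [B [mB ->]]] /=.
(* Outside the time interval l is extended by 0 and w starts at 0, so the coordinate is constant and
   its preimages are trivial. *)
have [tT|ntT] := pselect (time_dom T t); last first.
  have x0 (x : opath d M T) : x t ord0 k = 0.
    have [w [l ->]] := opathP x; have [_ _ _ lt0] := spathP l.
    by have [w0 _ _] := wpathP w; rewrite /= lt0// w0 mxE.
  have sT : approx_sets setT by rewrite (_ : setT = setT `\` set0); [exact: sC|rewrite setD0].
  have [B0|B0] := pselect (B 0).
    by rewrite (_ : _ @^-1` _ = setT)//; apply/seteqP; split=> x //= _; rewrite x0.
  by rewrite (_ : _ @^-1` _ = set0)//; apply/seteqP; split=> x //=; rewrite x0.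
pose L := [set B : set R | approx_sets ((fun x : opath d M T => x t ord0 k) @^-1` B)].
have sL : sigma_algebra setT L.
  split; first by rewrite /L/= preimage_set0.
    by move=> D LD; rewrite /L/= setTD preimage_setC -setTD; exact: sC.
  by move=> F LF; rewrite /L/= preimage_bigcup; exact: sU.
suff : L B by [].
have : (@RGenOInfty.G R).-sigma.-measurable B by rewrite -RGenOInfty.measurableE; exact: mB.
by apply: (smallest_sub sL) => _ [a ->]; exact: ray.
Qed.

Lemma FCb_dense u (e : R) : sq_integrable mS u -> 0 < e ->
  exists2 v, C v & sq_norm mS (u \- v) < e.
Proof.
move=> su e0; have [_ H] := sq_approx_all C_sq (@FCb_lin R d M T T_ge0) (@FCb_cst R d M T T_ge0)
  all_sets su.
exact: H.
Qed.

End cylinder_density.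

(** * Moments of the subordinator *)

Section subordinator_moments.
Context {R : realType} (dO : measure_display) (Om : measurableType dO).
Variables (P : probability Om R) (T : \bar R) (b : R).
Variables (nu : {measure set R -> \bar R}) (S : {RV P >-> spath T}).
Hypothesis Ssub : subordinator P b nu S.
Local Notation phi := (laplace_exponent b nu).

Lemma measurable_eval (t : R) : measurable_fun setT (fun om => S om t).
Proof. by apply: (measurableT_comp (@measurable_scoord R T t)). Qed.

Lemma laplace_tail (t u : R) : time_dom T t -> 0 < u ->
  (\int[P]_om (1 - expR (- (u * S om t)))%:E <= (t * phi u)%:E)%E.
Proof.
move=> tT u0; have mS := measurable_eval t.
have mE : measurable_fun setT (fun om => expR (- (u * S om t))).
  by apply: measurableT_comp => //; apply: measurable_funN; exact: measurable_funM.
have E1 om : 0 <= expR (- (u * S om t)) <= 1.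
  by rewrite expR_ge0 expR_le1 oppr_le0 mulr_ge0 ?(ltW u0)// spath_ge0.
have iE : P.-integrable setT (EFin \o (fun om => expR (- (u * S om t)))).
  apply: (@le_integrable _ _ _ P _ measurableT _ (cst 1%:E)).
  - exact/measurable_EFinP.
  - by move=> om _ /=; rewrite lee_fin normr1 ger0_norm; case/andP: (E1 om).
  - exact: finite_measure_integrable_cst.
under eq_integral do rewrite EFinB.
rewrite (@integralB_EFin _ _ _ P setT (cst 1))//; last first.
  exact: finite_measure_integrable_cst.
have := sub_laplace Ssub tT u0; rewrite unlock => ->.
have -> : (\int[P]_om (cst 1 om)%:E = 1)%E.
  by rewrite -[LHS]/(\int[P]_om (cst 1%:E om))%E integral_cst// mul1e; exact: probability_setT.
rewrite -EFinB lee_fin.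
by have := expR_ge1Dx (- (t * phi u)); lra.
Qed.

(** Markov's inequality for 1 - exp(- S_t / s), which is at least 1 - exp(- 1) where S_t >= s and
    has expectation at most t phi(1 / s). *)
Lemma survival_bound (t s : R) : time_dom T t -> 0 < s ->
  fine (P [set om | s <= S om t]) <= (1 - expR (- 1))^-1 * (t * phi (s^-1)).
Proof.
move=> tT s0; have mS := measurable_eval t.
pose A := [set om | s <= S om t].
have mA : measurable A.
  rewrite (_ : A = (fun om => S om t) @^-1` `[s, +oo[).
    by rewrite -[X in measurable X]setTI; exact: mS.
  by apply/seteqP; split=> x /=; rewrite in_itv/= andbT.
rewrite -ler_pdivrMl// invrK -lee_fin EFinM fineK; last exact: fin_num_measure.
have s'0 : 0 < s^-1 by rewrite invr_gt0.
apply: le_trans (laplace_tail tT s'0).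
rewrite -[[set om | _]]setIT -[[set om | _]]/A -integral_indic// -ge0_integralZl//; last first.
  by apply/measurable_EFinP; exact: measurable_indic.
have x1 om : 0 <= 1 - expR (- (s^-1 * S om t)).
  by rewrite subr_ge0 expR_le1 oppr_le0 mulr_ge0 ?(ltW s'0)// spath_ge0.
apply: ge0_le_integral => //.
- by apply/measurable_EFinP; apply: measurable_funM => //; exact: measurable_indic.
- apply/measurable_EFinP; apply: measurable_funB => //.
  by apply: measurableT_comp => //; apply: measurable_funN; exact: measurable_funM.
- move=> om _; rewrite -EFinM lee_fin indicE.
  have [|_] := boolP (om \in A); last by rewrite mulr0.
  rewrite inE /A/= => sS; rewrite mulr1 lerD2l lerN2 ler_expR lerN2.
  by rewrite ler_pdivlMl// mulr1.
Qed.

(** From 1 - exp(- u x) <= u x, with [K] the drift plus the first moment of [nu]; this moment is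
    finite below 1 by the Levy condition and above 1 by assumption. *)
Lemma laplace_exponent_linear_bound :
  (\int[nu]_(x in `]0%R, +oo[) (Num.min x 1)%:E < +oo)%E ->
  (\int[nu]_(x in `]1%R, +oo[) x%:E < +oo)%E ->
  exists K : R, forall u : R, 0 < u -> phi u <= u * K.
Proof.
move=> h1 h2.
have ifin : (\int[nu]_(x in `]0%R, +oo[) x%:E < +oo)%E.
  have -> : `]0%R, +oo[%classic = `]0%R, 1%R] `|` `]1%R, +oo[ :> set R.
    by rewrite -itv_bndbnd_setU// bnd_simp.
  rewrite ge0_integral_setU//=; last 2 first.
  - by move=> x [|]/=; rewrite in_itv/= lee_fin => /andP[]; lra.
  - apply/disj_setPS => x []/=; rewrite !in_itv/=; lra.
  apply: lte_add_pinfty => //; apply: le_lt_trans h1.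
  rewrite (@eq_integral _ _ _ nu `]0%R, 1%R] (fun x => (Num.min x 1)%:E)); last first.
    by move=> x; rewrite inE/= in_itv/= => /andP[_ x1]; rewrite min_l.
  apply: ge0_subset_integral => //=.
  - by apply/measurable_EFinP; apply: measurable_funTS; exact: measurable_minr.
  - by move=> x; rewrite in_itv/= lee_fin le_min ler01 andbT; lra.
  - by move=> x/=; rewrite !in_itv/= => /andP[-> _].
exists (b + fine (\int[nu]_(x in `]0%R, +oo[) x%:E)) => u u0.
rewrite /laplace_exponent mulrDr mulrC lerD// /Rintegral.
have ge0 : (0 <= \int[nu]_(x in `]0%R, +oo[) x%:E)%E.
  by apply: integral_ge0 => x/=; rewrite in_itv/= lee_fin; lra.
rewrite -lee_fin EFinM [X in (_ <= _ * X)%E]fineK; last by rewrite ge0_fin_numE.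
have x1 (x : R) : 0 < x -> 0 <= 1 - expR (- (u * x)) <= u * x.
  move=> x0; rewrite subr_ge0 expR_le1 oppr_le0 mulr_ge0 ?(ltW u0) ?(ltW x0)//=.
  by have := expR_ge1Dx (- (u * x)); lra.
have mE : measurable_fun setT (fun x : R => (1 - expR (- (u * x)))%:E).
  apply/measurable_EFinP; apply: measurable_funB => //.
  by apply: measurableT_comp => //; apply: measurable_funN; exact: measurable_funM.
have le : (\int[nu]_(x in `]0%R, +oo[) (1 - expR (- (u * x)))%:E <=
    u%:E * \int[nu]_(x in `]0%R, +oo[) x%:E)%E.
  rewrite -ge0_integralZl//=; last 2 first.
  - by move=> x; rewrite in_itv/= lee_fin; lra.
  - by rewrite lee_fin ltW.
  apply: ge0_le_integral => //=.
  - by move=> x; rewrite in_itv/= lee_fin andbT => /x1/andP[].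
  - exact: measurable_funTS.
  - by apply/measurable_EFinP; apply: measurable_funTS; exact: measurable_funM.
  - by move=> x; rewrite in_itv/= -EFinM lee_fin andbT => /x1/andP[].
rewrite fineK// ge0_fin_numE; first by rewrite (le_lt_trans le)// lte_mul_pinfty// lee_fin ltW.
by apply: integral_ge0 => x/=; rewrite in_itv/= lee_fin andbT => /x1/andP[].
Qed.

(** As u decreases to 0, (1 - exp(- u S_t)) / u tends to S_t, while its expectation is at most t
    phi(u) / u <= t K; Fatou's lemma gives the first moment. *)
Lemma subordinator_integrable (t : R) :
  (\int[nu]_(x in `]0%R, +oo[) (Num.min x 1)%:E < +oo)%E ->
  (\int[nu]_(x in `]1%R, +oo[) x%:E < +oo)%E -> time_dom T t ->
  P.-integrable setT (EFin \o (fun om => S om t)).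
Proof.
move=> h1 h2 tT; have mS := measurable_eval t.
have [K HK] := laplace_exponent_linear_bound h1 h2.
have [t0 _] := tT.
apply/integrableP; split; first exact/measurable_EFinP.
under eq_integral do rewrite /= ger0_norm ?spath_ge0//.
apply: (@le_lt_trans _ _ (t * K)%:E); last by rewrite ltry.
have S0 om : 0 <= S om t by exact: spath_ge0.
pose u (n : nat) : R := n.+1%:R^-1; have u0 n : 0 < u n by rewrite invr_gt0.
have x0 n om : 0 <= 1 - expR (- (u n * S om t)).
  by rewrite subr_ge0 expR_le1 oppr_le0 mulr_ge0 ?(ltW (u0 n)).
have mx n : measurable_fun setT (fun om => 1 - expR (- (u n * S om t))).
  apply: measurable_funB => //.
  by apply: measurableT_comp => //; apply: measurable_funN; exact: measurable_funM.
apply: (@fatou_le _ _ _ P (fun n om => (u n)^-1 * (1 - expR (- (u n * S om t))))).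
- by move=> n; exact: measurable_funM.
- by move=> n om; rewrite mulr_ge0// invr_ge0 ltW.
- apply: aeW => om.
  (* Lower bound: exp(- y) <= 1 / (1 + y) with y = u S_t. Upper bound: 1 - exp(- y) <= y. *)
  apply: (@squeeze_cvgr _ _ _ _ (fun n => S om t / (1 + u n * S om t)) (fun=> S om t)).
  + apply: nearW => n; have y0 : 0 <= u n * S om t by rewrite mulr_ge0// ltW.
    have e0 := expR_gt0 (u n * S om t).
    have d0 : 0 < 1 + u n * S om t by rewrite ltr_pwDl.
    apply/andP; split; last rewrite (ler_pdivrMl _ _ (u0 n)).
      rewrite (ler_pdivlMl _ _ (u0 n)) mulrA ler_pdivrMr//.
      have e1 : expR (- (u n * S om t)) * (1 + u n * S om t) <= 1.
        by rewrite expRN mulrC ler_pdivrMr// mul1r expR_ge1Dx.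
      nra.
    by have := expR_ge1Dx (- (u n * S om t)); lra.
  + rewrite -[X in _ --> X]divr1; apply: cvgM; first exact: cvg_cst.
    apply: cvgV => //; rewrite -[X in _ --> X]addr0; apply: cvgD; first exact: cvg_cst.
    rewrite -[X in _ --> X](mul0r (S om t)).
    by apply: cvgM; [exact: cvg_harmonic|exact: cvg_cst].
  + exact: cvg_cst.
move=> n; under eq_integral do rewrite EFinM.
rewrite ge0_integralZl//; last 3 first.
- exact/measurable_EFinP.
- by move=> om _; rewrite lee_fin.
- by rewrite lee_fin invr_ge0 ltW.
apply: (@le_trans _ _ ((u n)^-1%:E * (t * phi (u n))%:E)%E).
  by apply: lee_wpmul2l; [rewrite lee_fin invr_ge0 ltW|exact: laplace_tail].
rewrite -EFinM lee_fin ler_pdivrMl// mulrCA ler_wpM2l//; exact: HK.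
Qed.

End subordinator_moments.

(** * Integrals of functions with a power tail *)

Section power_tail.
Context {R : realType}.
Local Notation mu := (@lebesgue_measure R).

Lemma powR_cvgy0 (c : R) : 0 < c -> x `^ (- c) @[x --> +oo] --> (0 : R).
Proof.
move=> c0; apply/cvgrPdist_lt => e e0.
near=> x; have x0 : 0 < x by near: x; exact: nbhs_pinfty_gt.
rewrite sub0r normrN ger0_norm ?powR_ge0// powRN invf_plt ?posrE ?powR_gt0//.
have e'0 : 0 <= e^-1 by rewrite invr_ge0 ltW.
have -> : e^-1 = (e^-1 `^ c^-1) `^ c by rewrite -powRrM mulVf ?gt_eqF// powRr1.
by apply: gt0_ltr_powR => //; rewrite nnegrE ?powR_ge0// ltW.
Unshelve. all: by end_near. Qed.

Lemma integral_power_tail (c s : R) : 1 < c -> 0 < s ->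
  (\int[mu]_(x in `[s, +oo[) (x `^ (- c))%:E < +oo)%E.
Proof.
move=> c1 s0; have c'0 : 0 < c - 1 by rewrite subr_gt0.
pose F (x : R) := - (c - 1)^-1 * x `^ (- (c - 1)).
have dF (x : R) : 0 < x -> is_derive x 1 F (x `^ (- c)).
  move=> x0; have h := is_derive1_powR (- (c - 1)) x0.
  have := is_deriveZ (- (c - 1)^-1) h; rewrite /F => h'.
  apply: (is_derive_eq h'); rewrite /GRing.scale/= mulrA mulrNN mulVf ?gt_eqF// mul1r.
  by congr (_ `^ _); ring.
have cF (x : R) : 0 < x -> {for x, continuous F}.
  by move=> x0; apply/differentiable_continuous/derivable1_diffP; have [] := dF x x0.
rewrite (@ge0_continuous_FTC2y _ _ F s 0) ?ltry//.
- by move=> x sx; rewrite powR_ge0.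
- apply: continuous_in_subspaceT => x; rewrite inE/= in_itv/= andbT => sx.
  have x0 := lt_le_trans s0 sx.
  apply/differentiable_continuous/derivable1_diffP.
  by have [] := is_derive1_powR (- c) x0.
- rewrite -[X in _ --> X](mulr0 (- (c - 1)^-1)); apply: cvgM; first exact: cvg_cst.
  exact: powR_cvgy0.
- by move=> x sx; have [] := dF x (lt_trans s0 sx).
- exact: cvg_at_right_filter (cF s s0).
- move=> x; rewrite in_itv/= andbT => sx; rewrite derive1E.
  by have /@derive_val := dF x (lt_trans s0 sx).
Qed.

Variable p : R -> R.
Hypotheses (p_ge0 : forall t, 0 <= p t) (p_le1 : forall t, p t <= 1)
  (p_noninc : forall s t, s <= t -> p t <= p s).

Lemma nonincreasing_power_measurable (r : R) : measurable_fun setT (fun t => p t `^ r).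
Proof.
apply: (measurableT_comp (measurable_powR r)).
exact: (nonincreasing_measurable measurableT).
Qed.

(** Up to [s] the integrand is at most 1; beyond it is at most C^r x^(- a r), with exponent a r >
    1. *)
Lemma integral_power_lty (a C s r : R) : 0 < r -> 1 < a * r -> 0 < s ->
  (forall t, s <= t -> p t <= C * t `^ (- a)) ->
  (\int[mu]_(x in `]0%R, +oo[) (p x `^ r)%:E < +oo)%E.
Proof.
move=> r0 ar s0 pC; have mp := nonincreasing_power_measurable r.
have C0 : 0 <= C.
  have sa : 0 < s `^ (- a) by rewrite powR_gt0.
  by rewrite -(pmulr_lge0 _ sa) (le_trans (p_ge0 s))// pC.
have -> : `]0%R, +oo[%classic = `]0%R, s] `|` `]s, +oo[ :> set R.
  by rewrite -itv_bndbnd_setU// bnd_simp ltW.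
rewrite ge0_integral_setU//=; last 3 first.
- by apply/measurable_EFinP; exact: measurable_funTS.
- by move=> x _; rewrite lee_fin powR_ge0.
- by apply/disj_setPS => x []/=; rewrite !in_itv/=; lra.
apply: lte_add_pinfty.
  apply: (@le_lt_trans _ _ (\int[mu]_(x in `]0%R, s]) cst 1%:E x)%E).
    apply: ge0_le_integral => //=.
    - by move=> x _; rewrite lee_fin powR_ge0.
    - by apply/measurable_EFinP; exact: measurable_funTS.
    - move=> x _; rewrite lee_fin (_ : 1 = 1 `^ r); last by rewrite powR1.
      rewrite ge0_ler_powR ?nnegrE//.
      exact: ltW.
  by rewrite integral_cst// mul1e lebesgue_itv_lty.
apply: (@le_lt_trans _ _ ((C `^ r)%:E * \int[mu]_(x in `[s, +oo[) (x `^ (- (a * r)))%:E)%E); last first.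
  by apply: lte_mul_pinfty => //; rewrite ?lee_fin ?powR_ge0//; exact: integral_power_tail.
rewrite -ge0_integralZl//=; last 3 first.
- by apply/measurable_EFinP; exact: measurable_funTS.
- by move=> x _; rewrite lee_fin powR_ge0.
- by rewrite lee_fin powR_ge0.
apply: (@le_trans _ _ (\int[mu]_(x in `[s, +oo[) (p x `^ r)%:E)%E).
  apply: ge0_subset_integral => //.
  - by apply/measurable_EFinP; exact: measurable_funTS.
  - by move=> x _; rewrite lee_fin powR_ge0.
  - by move=> x/=; rewrite !in_itv/= !andbT => /ltW.
apply: ge0_le_integral => //=.
- by move=> x _; rewrite lee_fin powR_ge0.
- by apply/measurable_EFinP; exact: measurable_funTS.
- by apply/measurable_EFinP; apply: measurable_funTS; exact: measurable_funM.
- move=> x; rewrite in_itv/= andbT => sx; rewrite -EFinM lee_fin.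
  rewrite -mulNr powRrM -powRM ?powR_ge0// ge0_ler_powR ?nnegrE ?mulr_ge0 ?powR_ge0//.
    exact: ltW.
  exact: pC.
Qed.

End power_tail.

(** * The weight given by the survival function *)

Section survival_moments.
Context {R : realType} (dO : measure_display) (Om : measurableType dO).
Variables (P : probability Om R) (r : R) (b : R).
Variables (nu : {measure set R -> \bar R}) (S : {RV P >-> spath r%:E}).
Hypotheses (r_gt0 : 0 < r) (Ssub : subordinator P b nu S).
Local Notation phi := (laplace_exponent b nu).
Local Notation p := (survival P S).
Local Notation mu := (@lebesgue_measure R).

Let mS : measurable_fun setT (fun om => S om r).
Proof. exact: measurable_eval. Qed.

Let mA t : measurable [set om | t <= S om r].
Proof.
rewrite (_ : [set om | _] = (fun om => S om r) @^-1` `[t, +oo[).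
  by rewrite -[X in measurable X]setTI; exact: mS.
by apply/seteqP; split=> x /=; rewrite in_itv/= andbT.
Qed.

Lemma survivalE t : p t = fine (P [set om | t <= S om r]).
Proof. by rewrite /survival; congr (fine (P _)); apply/seteqP; split=> om /=; rewrite lee_fin. Qed.

Lemma survival_fin t : P [set om | t <= S om r] = (p t)%:E.
Proof. by rewrite survivalE fineK//; exact: fin_num_measure. Qed.

Lemma survival_ge0 t : 0 <= p t.
Proof. by rewrite /survival fine_ge0. Qed.

Lemma survival_le1 t : p t <= 1.
Proof. by rewrite -lee_fin -survival_fin probability_le1. Qed.

Lemma survival_noninc s t : s <= t -> p t <= p s.
Proof.
move=> st; rewrite -lee_fin -!survival_fin le_measure ?inE//.
by move=> om /=; exact: le_trans.
Qed.

Lemma survival_gt0 t : ess_sup P (terminal S) = +oo%E -> 0 < p t.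
Proof.
move=> Sy; rewrite lt_neqAle survival_ge0 andbT; apply/negP => /eqP p0.
suff : (ess_sup P (terminal S) <= t%:E)%E by rewrite Sy.
apply/ess_supP; exists [set om | t <= S om r]; split=> //.
  by apply: etrans (survival_fin t) _; rewrite -p0.
by move=> om /=; rewrite /terminal lee_fin => /negP; rewrite -ltNge => /ltW.
Qed.

(** Near 0 the exponent is below u^a; the survival bound is used at u = 1 / t. The threshold 2 / dl
    makes 1 / t strictly smaller than [dl]. *)
Lemma survival_power_tail (a : R) : 0 <= a -> phi u / u `^ a @[u --> 0^'+] --> (0 : R) ->
  exists C s : R, 0 < s /\ forall t, s <= t -> p t <= C * t `^ (- a).
Proof.
move=> a0 Ha; have /cvgrPdist_lt/(_ 1 ltr01)[dl /= dl0 Hdl] := Ha.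
exists ((1 - expR (- 1))^-1 * r), (2 / dl); split; first by rewrite divr_gt0.
move=> t st; have t0 : 0 < t by apply: lt_le_trans st; rewrite divr_gt0.
have t'0 : 0 < t^-1 by rewrite invr_gt0.
have rT : time_dom r%:E r by split; rewrite // ltW.
rewrite survivalE; apply: (le_trans (survival_bound Ssub rT t0)).
rewrite mulrA ler_wpM2l//.
  by rewrite mulr_ge0 ?(ltW r_gt0)// invr_ge0 subr_ge0 expR_le1 oppr_le0.
have : `|0 - phi t^-1 / t^-1 `^ a| < 1.
  apply: Hdl => //=; rewrite sub0r normrN ger0_norm ?(ltW t'0)// invf_plt ?posrE//.
  by apply: lt_le_trans st; rewrite ltr_pdivlMr// mulVf ?gt_eqF// ltr1n.
have h : 0 < t^-1 `^ a by rewrite powR_gt0.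
rewrite sub0r normrN => /(le_lt_trans (ler_norm _)); rewrite ltr_pdivrMr// mul1r => /ltW.
by rewrite -powR_inv1 ?(ltW t0)// -powRrM mulN1r.
Qed.

(** The condition on [kappa] says that 1 / (1 - kappa) lies strictly below the supremum, so some
    admissible exponent exceeds it. *)
Lemma lower_index_power (kappa : R) : 0 < lower_index phi ->
  kappa < 1 - 1 / lower_index phi ->
  exists a : R, [/\ 0 <= a, phi u / u `^ a @[u --> 0^'+] --> (0 : R),
    0 < 1 - kappa & 1 < a * (1 - kappa)].
Proof.
set A := [set a : R | 0 <= a /\ phi u / u `^ a @[u --> 0^'+] --> (0 : R)].
rewrite -[lower_index phi]/(sup A) => A0 kA.
have i0 : 0 < 1 / sup A by rewrite divr_gt0.
have k0 : 0 < 1 - kappa by lra.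
(* [sup] is 0 for a set that is empty or unbounded above, so positivity of the index excludes
   both. *)
have hA : has_sup A.
  by apply: contrapT => /sup_out A'; move: A0; rewrite A' ltxx.
have e0 : 0 < sup A - (1 - kappa)^-1.
  rewrite subr_gt0 invf_plt ?posrE//; move: kA; rewrite div1r; lra.
have [a [a0 Ha] aA] := sup_adherent e0 hA.
exists a; split=> //; move: aA; rewrite subKr => aA.
by rewrite -ltr_pdivrMr// mul1r.
Qed.

Variable kappa : R.
Local Notation q := (fun t => p t `^ (- kappa)).
Hypotheses (Sy : ess_sup P (terminal S) = +oo%E).
Hypotheses (phi0 : 0 < lower_index phi) (kphi : kappa < 1 - 1 / lower_index phi).

Lemma weight_measurable : measurable_fun setT q.
Proof. by apply: nonincreasing_power_measurable; exact: survival_noninc. Qed.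

Lemma weight_ge0 t : 0 <= q t. Proof. exact: powR_ge0. Qed.

(** For kappa <= 0 the weight is at most 1. For kappa > 0 it is nondecreasing, and finite at [a]
    because M = oo keeps the survival function positive. *)
Lemma weight_bounded a : exists C : R, forall t, t <= a -> q t <= C.
Proof.
have p0 := survival_gt0 _ Sy.
have [k0|k0] := leP kappa 0.
  exists 1 => t _; rewrite (_ : 1 = 1 `^ (- kappa)); last by rewrite powR1.
  rewrite ge0_ler_powR ?nnegrE ?survival_ge0 ?oppr_ge0//.
  exact: survival_le1.
exists (q a) => t ta; rewrite /= !powRN lef_pV2 ?posrE ?powR_gt0//.
by rewrite ge0_ler_powR ?nnegrE ?survival_ge0 ?(ltW k0)// survival_noninc.
Qed.

Lemma weight_mul t : q t * p t `^ kappa = 1.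
Proof.
have pt0 := survival_gt0 t Sy.
by rewrite /= powRN mulVf// gt_eqF// powR_gt0.
Qed.

(* Tonelli: [E[int_0^{S_r} q] = int_0^oo P(S_r >= t) q(t) dt = int_0^oo p^{1 - kappa}] *)
Lemma primitive_terminal_integrable :
  P.-integrable setT (EFin \o (fun om => primitive q (S om r))).
Proof.
have mq := weight_measurable.
have mprim := measurable_primitive mq weight_ge0 weight_bounded.
apply/integrableP; split.
  by apply/measurable_EFinP; exact: (measurableT_comp mprim).
pose A := [set z : Om * measurableTypeR R | 0 < z.2 <= S z.1 r].
have mA' : measurable A.
  have m1 : measurable_fun setT (fun z : Om * measurableTypeR R => S z.1 r - z.2).
    by apply: measurable_funB => //; exact: (measurableT_comp mS).
  rewrite (_ : A = (fun z => z.2) @^-1` `]0, +oo[ `&`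
      (fun z : Om * measurableTypeR R => S z.1 r - z.2) @^-1` `[0, +oo[).
    apply: measurableI; rewrite -[X in measurable X]setTI; last exact: m1.
    exact: (@measurable_snd _ _ Om (measurableTypeR R)).
  by apply/seteqP; split=> z /=; rewrite !in_itv/= !andbT subr_ge0 => /andP.
pose f (z : Om * measurableTypeR R) : \bar R := (\1_A z * q z.2)%:E.
have f0 z : (0 <= f z)%E by rewrite lee_fin mulr_ge0// weight_ge0.
have mf : measurable_fun setT f.
  by apply/measurable_EFinP; apply: measurable_funM; [exact: measurable_indic|exact: (measurableT_comp mq)].
have := @fubini_tonelli _ _ Om (measurableTypeR R) R P mu f mf f0.
have E1 om : (\int[mu]_y f (om, y) = (primitive q (S om r))%:E)%E.
  have iq := weight_integrable mq weight_ge0 weight_bounded 0 (S om r).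
  rewrite /primitive /Rintegral fineK; last exact: integrable_fin_num.
  rewrite [RHS]integral_mkcond; apply: eq_integral => y _; rewrite patchE /f indicE.
  have -> : ((om, y) \in A) = (y \in `]0, (S om r)]%classic).
    by apply/idP/idP => /set_mem h; apply/mem_set; move: h; rewrite /A/= in_itv.
  by case: (_ \in _); rewrite ?mul1r ?mul0r.
have E2 y : (\int[P]_om f (om, y) =
    ((fun x => (p x `^ (1 - kappa))%:E) \_ `]0%R, +oo[) y)%E.
  rewrite patchE; have [y0|y0] := ltP 0 y.
    rewrite mem_set/= ?in_itv/= ?y0//.
    transitivity (\int[P]_om ((q y)%:E * (\1_[set om | y <= S om r] om)%:E))%E.
      apply: eq_integral => om _; rewrite /f -EFinM mulrC !indicE.
      by congr (_ * (nat_of_bool _)%:R)%:E; apply/idP/idP; rewrite !inE /A/= y0.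
    rewrite ge0_integralZl//; last 2 first.
    - by apply/measurable_EFinP; exact: measurable_indic.
    - by rewrite lee_fin; exact: weight_ge0.
    rewrite integral_indic// setIT.
    rewrite [X in (_ * X)%E](_ : _ = (p y)%:E); last exact: survival_fin.
    rewrite -EFinM mulrC -[X in X * _]powRr1 ?survival_ge0// -powRD//.
    by rewrite (gt_eqF (survival_gt0 y Sy)) implybT.
  rewrite memNset/= ?in_itv/= ?ltNge ?y0//.
  apply: integral0_eq => om _; rewrite /f indicE memNset ?mul0r//.
  by rewrite /A/= ltNge y0.
rewrite (eq_integral _ _ (fun om _ => E1 om)) (eq_integral _ _ (fun y _ => E2 y)) => E.
rewrite (eq_integral (fun om => (primitive q (S om r))%:E)); last first.
  by move=> om _; rewrite /= ger0_norm//; exact/primitive_ge0/weight_ge0.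
rewrite E -integral_mkcond.
have [a [a0 Ha k0 ak]] := lower_index_power phi0 kphi.
have [C [s [s0 HC]]] := survival_power_tail a0 Ha.
exact: (integral_power_lty survival_ge0 survival_le1 survival_noninc k0 ak s0 HC).
Qed.

Lemma primitive_integrable t : time_dom r%:E t ->
  P.-integrable setT (EFin \o (fun om => primitive q (S om t))).
Proof.
move=> tT; have [t0 tr] := tT.
have mprim := measurable_primitive weight_measurable weight_ge0 weight_bounded.
apply: (@le_integrable _ _ _ P _ measurableT _ (EFin \o (fun om => primitive q (S om r)))).
- by apply/measurable_EFinP; apply: (measurableT_comp mprim); exact: measurable_eval.
- move=> om _ /=; rewrite lee_fin.
  rewrite !ger0_norm; [|exact/primitive_ge0/weight_ge0..].
  apply: (primitive_le weight_measurable weight_ge0 weight_bounded).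
  have [[_ _ Sinc] _ _ _] := spathP (S om); apply: Sinc => //.
  by split; rewrite // ltW.
- exact: primitive_terminal_integrable.
Qed.

End survival_moments.

(** * Closability, Dirichlet form and conservativeness for a general weight *)

Section closure_properties.
Context {R : realType} (d : nat) (M T : \bar R).
Context {dO : measure_display} {Om : measurableType dO} (P : probability Om R).
Variables (W : {RV P >-> wpath d M}) (S : {RV P >-> spath T}).
Hypothesis T_ge0 : (0 <= T)%E.
Hypothesis W_brownian : brownian_motion P W.
Variables (p q : R -> R) (kappa : R).
Hypotheses (mq : measurable_fun setT q) (q_ge0 : forall t, 0 <= q t)
  (q_bnd : forall a, exists C : R, forall t, t <= a -> q t <= C)
  (qp : forall t, open_time_dom M t -> q t * p t `^ kappa = 1).
Hypothesis int_primitive : forall t, time_dom T t ->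
  P.-integrable setT (EFin \o (fun om => primitive q (S om t))).
Local Notation E := (grad_form p (distribution P W \x distribution P S)%E kappa).

Lemma grad_form_closure :
  [/\ closable (mu_S W S) (@FCb R d M T) E,
      dirichlet_form (mu_S W S) (closure_dom (mu_S W S) (@FCb R d M T) E)
        (closure_form (mu_S W S) (@FCb R d M T) E)
    & conservative (mu_S W S) (closure_dom (mu_S W S) (@FCb R d M T) E)
        (closure_form (mu_S W S) (@FCb R d M T) E)].
Proof.
have intp t : time_dom T t ->
    (distribution P S).-integrable setT (EFin \o (fun l : spath T => primitive q (l t))).
  move=> tT; apply: (@integrable_pushforward _ _ _ _ _ S _ P setT) => //.
  - by apply/measurable_EFinP; apply: (measurableT_comp (measurable_primitive mq q_ge0 q_bnd));
      exact: measurable_scoord.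
  - exact: int_primitive.
have bm := brownian_motion_distribution W_brownian.
have cl := form_closable T_ge0 bm mq q_ge0 q_bnd qp intp.
have nn := form_nonneg T_ge0 (distribution P W) mq q_ge0 q_bnd qp intp.
have sq := @FCb_sq R d M T T_ge0 (distribution P W) (distribution P S).
split.
- exact: cl.
- apply: (closure_dirichlet_form sq nn cl).
    by move=> u e; exact: FCb_dense.
  move=> u e Cu e0.
  exact: (form_markov T_ge0 (distribution P W) mq q_ge0 q_bnd qp intp Cu e0).
- apply: (closure_conservative sq nn cl); first exact: FCb_cst.
  apply: (form_cst T_ge0 (distribution P W) (distribution P S) mq q_ge0 q_bnd qp).
  exact: FCb_cst.
Qed.

End closure_properties.

Unset Implicit Arguments.

Theorem proposition3p12 (R : realType) (d : nat) (d_gt0 : (0 < d)%N)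
    (T : \bar R) (T_gt0 : (0 < T)%E)
    (b : R) (b_ge0 : 0 <= b) (nu : {measure set R -> \bar R})
    (nu_levy : (\int[nu]_(x in `]0%R, +oo[) (Num.min x 1)%:E < +oo)%E)
    (dO : measure_display) (Om : measurableType dO) (P : probability Om R)
    (S : {RV P >-> spath T}) (S_subordinator : subordinator P b nu S)
    (S_nontrivial : nontrivial P S)
    (M : \bar R) (M_def : M = ess_sup P (terminal S))
    (W : {RV P >-> wpath d M}) (W_brownian : brownian_motion P W)
    (WS_independent : independent_elements P W S) :
  let muxlambda := (distribution P W \x distribution P S)%E in
  let mS := mu_S W S in
  let E kappa := grad_form (survival P S) muxlambda kappa in
  ((\int[nu]_(x in `]1%R, +oo[) x%:E < +oo)%E ->
    [/\ closable mS (@FCb R d M T) (E 0),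
        dirichlet_form mS (closure_dom mS (@FCb R d M T) (E 0))
          (closure_form mS (@FCb R d M T) (E 0))
      & conservative mS (closure_dom mS (@FCb R d M T) (E 0))
          (closure_form mS (@FCb R d M T) (E 0))]) /\
  (forall kappa : R, (T < +oo)%E -> M = +oo%E ->
    0 < lower_index (laplace_exponent b nu) ->
    kappa < 1 - 1 / lower_index (laplace_exponent b nu) ->
    [/\ closable mS (@FCb R d M T) (E kappa),
        dirichlet_form mS (closure_dom mS (@FCb R d M T) (E kappa))
          (closure_form mS (@FCb R d M T) (E kappa))
      & conservative mS (closure_dom mS (@FCb R d M T) (E kappa))
          (closure_form mS (@FCb R d M T) (E kappa))]).
Proof.
split=> [nu1|kappa].
  (* For kappa = 0 the weight is 1 and its primitive is the identity on nonnegative reals, so the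
     integrability condition is the finiteness of E[S_t]. *)
  apply: (@grad_form_closure _ _ _ _ _ _ _ W S _ _ _ (cst 1)) => //.
  - exact: ltW.
  - by move=> a; exists 1.
  - by move=> t _; rewrite powRr0 mulr1.
  move=> t tT.
  have := subordinator_integrable S_subordinator nu_levy nu1 tT.
  congr (_.-integrable _ _); apply/funext => om /=; congr (_%:E).
  have S0 : 0 <= S om t by exact: spath_ge0.
  have := @lebesgue_measure_itv R `]0, (S om t)]; rewrite /= lte_fin => E.
  rewrite /primitive Rintegral_cst// mul1r [X in fine X]E.
  by have [|] := ltP 0 (S om t); rewrite /= ?subr0//; lra.
move=> Ty My phi0 kphi.
have [r Tr] : exists r, T = r%:E.
  by move: T T_gt0 Ty {S S_subordinator S_nontrivial M_def WS_independent} => [r| |]//; exists r.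
subst T; move: T_gt0; rewrite lte_fin => r0.
have Sy : ess_sup P (terminal S) = +oo%E by rewrite -M_def.
(* Here M = oo makes the survival function positive everywhere, so that its power - kappa is an
   inverse weight on the whole line. *)
apply: (@grad_form_closure _ _ _ _ _ _ _ W S _ _ _ (fun t => survival P S t `^ (- kappa))).
- by rewrite lee_fin ltW.
- exact: W_brownian.
- exact: weight_measurable.
- by move=> t; exact: powR_ge0.
- exact: weight_bounded Sy.
- by move=> t _; exact: weight_mul kappa Sy t.
- by move=> t; exact: (primitive_integrable r0 S_subordinator Sy phi0 kphi).
Qed.
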